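(* Let $n,s\in\mathbb{N}$ and $\rho>1$. If $f$ is analytic in the interior $\mathcal{D}$ of the region bounded by the ellipse $\mathcal{E}_\rho$ and continuous on $\overline{\mathcal{D}}$, then $$\left|R_{n,s}(f)\right|\le 2\pi\left(\max_{z\in\mathcal{E}_\rho}|f(z)|\right)\frac{\sum_{k=0}^{s}(-1)^k\binom{2s+1}{s-k}\rho^{2n(s-k)}}{\rho^{n}\,(\rho^{2n}-1)^{2s}} .$$
   Context: $\mathbb{N}=\{1,2,\dots\}$. $T_n$ is the Chebyshev polynomial of the first kind of degree $n$, $T_n(\cos\theta)=\cos n\theta$, with zeros $\xi_1,\dots,\xi_n\in(-1,1)$. The remainder $R_{n,s}(f)$ is defined by the quadrature formula $$\int_{-1}^1 f(t)T_n(t)\frac{dt}{\sqrt{1-t^2}}=\sum_{\nu=1}^n\sum_{i=0}^{2s-1}A_{i,\nu}f^{(i)}(\xi_\nu)+R_{n,s}(f),\qquad A_{i,\nu}=\int_{-1}^1 \ell_{i,\nu}(t)T_n(t)\frac{dt}{\sqrt{1-t^2}},$$ where $\ell_{i,\nu}$ are the fundamental polynomials of Hermite interpolation at $\xi_1,\dots,\xi_n$, each with multiplicity $2s$: $\ell_{i,\nu}$ is the polynomial of degree at most $2sn-1$ with $\ell_{i,\nu}^{(j)}(\xi_\mu)=1$ if $(j,\mu)=(i,\nu)$ and $0$ otherwise, for $0\le j\le 2s-1$, $1\le\mu\le n$. The ellipse is $\mathcal{E}_\rho=\{z\in\mathbb{C}: z=\tfrac12(u+u^{-1}),\ u=\rho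 e^{i\theta},\ 0\le\theta\le2\pi\}$. *)

(* Defs.v *)
From Stdlib Require Import Reals Lra Lia.
From Coquelicot Require Import Coquelicot.
(* [C] is the complex plane; the binomial coefficient is [Binomial.C]. *)
Open Scope R_scope.

Fixpoint chebyshev (n : nat) (x : R) : R :=
  match n with
  | O => 1
  | S m => match m with
           | O => x
           | S k => 2 * x * chebyshev m x - chebyshev k x
           end
  end.

Lemma chebyshev_cos (n : nat) (theta : R) :
  chebyshev n (cos theta) = cos (INR n * theta).
Proof.
enough (H : chebyshev n (cos theta) = cos (INR n * theta) /\
            chebyshev (S n) (cos theta) = cos (INR (S n) * theta)) by apply H.
induction n as [|n [IH1 IH2]].
- split; simpl; [rewrite Rmult_0_l, cos_0 | rewrite Rmult_1_l]; reflexivity.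
- split; [exact IH2 |].
  change (2 * cos theta * chebyshev (S n) (cos theta) - chebyshev n (cos theta)
          = cos (INR (S (S n)) * theta)).
  rewrite IH1, IH2.
  replace (INR (S (S n)) * theta) with (INR (S n) * theta + theta)
    by (rewrite (S_INR (S n)); ring).
  replace (INR n * theta) with (INR (S n) * theta - theta)
    by (rewrite (S_INR n); ring).
  rewrite cos_plus, cos_minus; ring.
Qed.

(* xi 1, ..., xi n enumerate the n zeros of the degree n Chebyshev polynomial;
   the other values of xi are irrelevant. *)
Definition chebyshev_zeros (n : nat) (xi : nat -> R) : Prop :=
  (forall nu, (1 <= nu <= n)%nat ->
     -1 < xi nu < 1 /\ chebyshev n (xi nu) = 0) /\
  (forall mu nu, (1 <= mu <= n)%nat -> (1 <= nu <= n)%nat ->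
     xi mu = xi nu -> mu = nu).

Definition polynomial_le (d : nat) (p : R -> R) : Prop :=
  exists a : nat -> R, forall t, p t = sum_n (fun k => a k * t ^ k) d.

Definition hermite_fundamental (n s : nat) (xi : nat -> R)
    (l : nat -> nat -> R -> R) : Prop :=
  forall i nu, (i <= 2 * s - 1)%nat -> (1 <= nu <= n)%nat ->
    polynomial_le (2 * s * n - 1) (l i nu) /\
    forall j mu, (j <= 2 * s - 1)%nat -> (1 <= mu <= n)%nat ->
      Derive_n (l i nu) j (xi mu) =
      if andb (Nat.eqb j i) (Nat.eqb mu nu) then 1 else 0.

(* The weight is singular at both end points, hence improper integrals. *)
Definition quadrature_weight (n : nat) (l : nat -> nat -> R -> R)
    (i nu : nat) : R :=
  RInt_gen (V := R_CompleteNormedModule)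
    (fun t => l i nu t * chebyshev n t / sqrt (1 - t ^ 2))
    (at_right (-1)) (at_left 1).

Definition fourier_chebyshev (n : nat) (f : C -> C) : C :=
  RInt_gen (V := C_R_CompleteNormedModule)
    (fun t => (f (RtoC t) * RtoC (chebyshev n t / sqrt (1 - t ^ 2)))%C)
    (at_right (-1)) (at_left 1).

Definition remainder (n s : nat) (xi : nat -> R) (l : nat -> nat -> R -> R)
    (f : C -> C) : C :=
  (fourier_chebyshev n f -
   sum_n_m (G := C_AbelianMonoid) (fun nu =>
     sum_n_m (G := C_AbelianMonoid) (fun i =>
       RtoC (quadrature_weight n l i nu) *
       Nat.iter i C_derive f (RtoC (xi nu))) 0 (2 * s - 1)) 1 n)%C.

Definition ellipse (rho : R) (z : C) : Prop :=
  exists theta : R, 0 <= theta <= 2 * PI /\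
    let u : C := (RtoC rho * (cos theta, sin theta))%C in
    z = (/ 2 * (u + / u))%C.

(* For [1 < rho] the semi-axes of the ellipse are (rho + 1/rho)/2 and
   (rho - 1/rho)/2. *)
Definition ellipse_form (rho : R) (z : C) : R :=
  (Re z / ((rho + / rho) / 2)) ^ 2 + (Im z / ((rho - / rho) / 2)) ^ 2.

Definition ellipse_interior (rho : R) (z : C) : Prop :=
  ellipse_form rho z < 1.

Lemma ellipse_param (rho theta : R) : 1 < rho ->
  let u : C := (RtoC rho * (cos theta, sin theta))%C in
  (/ 2 * (u + / u))%C =
  ((rho + / rho) / 2 * cos theta, (rho - / rho) / 2 * sin theta).
Proof.
intros Hrho u.
assert (Hu : Cinv u = (cos theta / rho, - sin theta / rho)).
{ unfold u, Cinv, Cmult, RtoC; simpl.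
  assert (E : (rho * cos theta - 0 * sin theta) *
              ((rho * cos theta - 0 * sin theta) * 1) +
              (rho * sin theta + 0 * cos theta) *
              ((rho * sin theta + 0 * cos theta) * 1) = rho * rho).
  { generalize (sin2_cos2 theta); unfold Rsqr; intros H.
    transitivity (rho * rho *
      (sin theta * sin theta + cos theta * cos theta)); [ring |].
    rewrite H; ring. }
  rewrite E; f_equal; field; lra. }
rewrite Hu.
replace (/ 2)%C with (RtoC (/ 2)) by (apply RtoC_inv; lra).
unfold u, Cmult, Cplus, RtoC; simpl; f_equal; field; lra.
Qed.

Lemma ellipse_formE (rho : R) (z : C) : 1 < rho ->
  ellipse rho z <-> ellipse_form rho z = 1.
Proof.
intros Hrho.
assert (Hinv : / rho < 1) by (rewrite <- Rinv_1; apply Rinv_lt_contravar; lra).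
assert (Hinv0 : 0 < / rho) by (apply Rinv_0_lt_compat; lra).
unfold ellipse_form.
set (a := (rho + / rho) / 2); set (b := (rho - / rho) / 2).
assert (Ha : 0 < a) by (unfold a; lra).
assert (Hb : 0 < b) by (unfold b; lra).
split.
- intros [theta [_ Hz]]; cbv zeta in Hz.
  rewrite ellipse_param in Hz by assumption.
  rewrite Hz; simpl; fold a b.
  generalize (sin2_cos2 theta); unfold Rsqr; intros H.
  transitivity (sin theta * sin theta + cos theta * cos theta);
    [field; lra | exact H].
- destruct z as [x y]; simpl Re; simpl Im; intros H.
  set (p := x / a) in *; set (q := y / b) in *.
  assert (Hp : -1 <= p <= 1) by nra.
  assert (Hx : x = a * p) by (unfold p; field; lra).
  assert (Hy : y = b * q) by (unfold q; field; lra).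
  generalize (acos_bound p); intros Hac.
  assert (Hs : sin (acos p) = Rabs q).
  { rewrite sin_acos by assumption.
    rewrite <- sqrt_Rsqr_abs; f_equal; unfold Rsqr; nra. }
  destruct (Rle_dec 0 q) as [Hq | Hq].
  + exists (acos p); split; [lra |]; cbv zeta.
    rewrite ellipse_param by assumption; fold a b.
    rewrite Hs, cos_acos, Rabs_pos_eq by assumption; congruence.
  + exists (2 * PI - acos p); split; [lra |]; cbv zeta.
    rewrite ellipse_param by assumption; fold a b.
    rewrite cos_minus, sin_minus, cos_2PI, sin_2PI, Hs, cos_acos by assumption.
    rewrite Rabs_left by lra.
    rewrite Hx, Hy; f_equal; ring.
Qed.

Definition closure (A : C -> Prop) (z : C) : Prop :=
  forall eps : R, 0 < eps -> exists w : C, A w /\ Cmod (w - z)%C < eps.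

(* Complex differentiability at every point; meant for open [A]. *)
Definition analytic_on (A : C -> Prop) (f : C -> C) : Prop :=
  forall z : C, A z -> ex_derive (K := C_AbsRing) (V := C_NormedModule) f z.

Definition is_max_modulus (A : C -> Prop) (f : C -> C) (M : R) : Prop :=
  (exists z, A z /\ Cmod (f z) = M) /\ (forall z, A z -> Cmod (f z) <= M).

(* Main.v *)
(* Put z = cosh w. The function f (cosh w) is 2 pi i-periodic and holomorphic in
   the strip |Re w| < ln rho, so Goursat's theorem moves the integrals defining
   its Fourier coefficients to the line Re w = ln rho: the Chebyshev coefficients
   of f satisfy |b_k| <= 2 M rho^(-k). Hence f = sum b_k T_k on [-1, 1], with
   term-by-term differentiation inside, and R(f) = sum b_k R(T_k).

   The numbers r_k = R(T_k), extended to an even family over Z, are found from a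
   recurrence. R kills polynomials of degree < 2sn, so r_k = 0 for |k| < 2sn, and
   the quadrature sum kills multiples of T_n^(2s), so R (T_n^(2s) T_k) is the
   integral of T_n^(2s+1) T_k. Since 2 T_n T_k = T_(k+n) + T_(k-n), this reads
   A^(2s) r = (pi/2) A^(2s+1) delta_0 with (A x)_k = x_(k+n) + x_(k-n). Its only
   solution is supported on k = (2s+1)n + 2nj, with value (pi/2) (-1)^j g_j there,
   where g is the 2s-fold partial sum of the alternating half row
   (-1)^j C(2s+1, s-j) of Pascal's triangle. One partial summation already makes
   that row nonnegative, so g >= 0, and the triangle inequality gives
   |R(f)| <= pi M sum_j g_j rho^(-(2s+1)n - 2nj), half of the claimed bound. *)

Require Import Defs.
From Stdlib Require Import Reals Lra Lia ZArith FunctionalExtensionality List.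
From Coquelicot Require Import Coquelicot.
Open Scope R_scope.

(** * Goursat's theorem for real closed forms *)

(** Three obstacles shape the proof. Analyticity is given as mere differentiability at each point,
    so the integral theorem must not use continuity of [f']: hence the bisection argument, and the
    period [2 PI] makes rectangles the only contours that occur. On the ellipse itself [f] is only
    continuous, so the integrals are moved to lines [Re w = x] with [x < ln rho], and the bound at
    [ln rho] is a limit by uniform continuity. Finally the quadrature sum contains iterated
    derivatives of [f], whose existence is not among the hypotheses: they are obtained from the
    Chebyshev series, since geometric decay of the coefficients beats the polynomial growth of the
    derivatives of [T_k].

    The remainder is handled on the real and imaginary parts of [f] separately, but the two are
    joined again before absolute values are taken, so that no constant is lost.

    The quotient in the bound is a generating function: with [y = rho^(-2n)], each partial summation
    divides by [1 - y], and the [2s] of them applied to the half row give the power [(1 - y)^(2s)]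
    under the numerator. *)

Lemma halving_limit (A : R) (x : nat -> R) : 0 <= A ->
  (forall n, x n <= x (S n) <= x n + A / 2 ^ S n) ->
  exists z, forall n, x n <= z <= x n + A / 2 ^ n.
Proof.
intros HA Hx.
assert (Hp : forall n, 0 < 2 ^ n) by (intros n; apply pow_lt; lra).
assert (Hinc : forall n k, x n <= x (n + k)%nat).
{ intros n k; induction k as [|k IH]; [rewrite Nat.add_0_r; lra|].
  rewrite Nat.add_succ_r; specialize (Hx (n + k)%nat); lra. }
assert (Hdec : forall n k, x (n + k)%nat + A / 2 ^ (n + k) <= x n + A / 2 ^ n).
{ intros n k; induction k as [|k IH]; [rewrite Nat.add_0_r; lra|].
  rewrite Nat.add_succ_r; specialize (Hx (n + k)%nat).
  assert (A / 2 ^ (n + k) = 2 * (A / 2 ^ S (n + k))).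
  { simpl; field; apply Rgt_not_eq, Hp. }
  lra. }
assert (Hpos : forall n, 0 <= A / 2 ^ n).
{ intros n; apply Rle_mult_inv_pos; auto. }
destruct (completeness (fun y => exists n, y = x n)) as [z [Hz1 Hz2]].
- exists (x O + A / 2 ^ O); intros y [n ->].
  generalize (Hdec O n) (Hpos n); simpl; lra.
- exists (x O), O; reflexivity.
- exists z; intros n; split; [apply Hz1; exists n; reflexivity|].
  apply Hz2; intros y [m ->].
  destruct (Nat.le_ge_cases n m) as [H|H].
  + replace m with (n + (m - n))%nat by lia.
    generalize (Hdec n (m - n)%nat) (Hpos (n + (m - n))%nat); lra.
  + replace n with (m + (n - m))%nat by lia.
    generalize (Hinc m (n - m)%nat) (Hpos (m + (n - m))%nat); lra.
Qed.

(* Fréchet differentiability of [P] and [Q] with [dP/dy = dQ/dx]. *)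
Definition closed_form_at (P Q : R -> R -> R) (x y : R) : Prop :=
  exists al be ga, forall eps, 0 < eps -> exists del, 0 < del /\
    forall u v, Rabs (u - x) < del -> Rabs (v - y) < del ->
      Rabs (P u v - (P x y + al * (u - x) + be * (v - y)))
        <= eps * (Rabs (u - x) + Rabs (v - y)) /\
      Rabs (Q u v - (Q x y + be * (u - x) + ga * (v - y)))
        <= eps * (Rabs (u - x) + Rabs (v - y)).

(** The integral of [P dx + Q dy] counterclockwise around the rectangle, with opposite sides paired
    in one integrand. *)
Definition circulation (P Q : R -> R -> R) (a b c d : R) : R :=
  RInt (fun x => P x c - P x d) a b + RInt (fun y => Q b y - Q a y) c d.

Lemma linear_bound_continuous (g : R -> R) (x al : R) :
  (forall eps, 0 < eps -> exists del, 0 < del /\ forall u, Rabs (u - x) < del ->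
    Rabs (g u - (g x + al * (u - x))) <= eps * Rabs (u - x)) ->
  continuous g x.
Proof.
intros H; apply (ex_derive_continuous (K := R_AbsRing) (V := R_NormedModule)).
exists al; apply is_derive_Reals; intros eps Heps.
destruct (H (eps / 2)) as [del [Hd Hb]]; [lra|].
exists (mkposreal del Hd); intros h Hh0 Hh; simpl in Hh.
specialize (Hb (x + h)); replace (x + h - x) with h in Hb by ring.
specialize (Hb Hh).
replace ((g (x + h) - g x) / h - al)
  with ((g (x + h) - (g x + al * h)) / h) by (field; assumption).
unfold Rdiv; rewrite Rabs_mult, Rabs_inv.
apply Rabs_pos_lt in Hh0.
apply Rle_lt_trans with (eps / 2); [|lra].
apply Rmult_le_reg_r with (Rabs h); [assumption|].
rewrite Rmult_assoc, Rinv_l, Rmult_1_r; lra.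
Qed.

Lemma closed_form_continuous (P Q : R -> R -> R) (x y : R) :
  closed_form_at P Q x y ->
  continuous (fun u => P u y) x /\ continuous (fun v => Q x v) y.
Proof.
intros (al & be & ga & H); split.
- apply linear_bound_continuous with al; intros eps Heps.
  destruct (H eps Heps) as [del [Hd Hb]]; exists del; split; [assumption|].
  intros u Hu; destruct (Hb u y Hu) as [H1 _].
  { rewrite Rminus_diag, Rabs_R0; assumption. }
  rewrite Rminus_diag, Rabs_R0, Rmult_0_r, !Rplus_0_r in H1; exact H1.
- apply linear_bound_continuous with ga; intros eps Heps.
  destruct (H eps Heps) as [del [Hd Hb]]; exists del; split; [assumption|].
  intros v Hv; destruct (Hb x v) as [_ H1]; [|assumption|].
  { rewrite Rminus_diag, Rabs_R0; assumption. }
  rewrite Rminus_diag, Rabs_R0, Rmult_0_r, Rplus_0_l, Rplus_0_r in H1; exact H1.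
Qed.

Lemma ex_RInt_continuous_le (g : R -> R) (a b : R) : a <= b ->
  (forall x, a <= x <= b -> continuous g x) -> ex_RInt g a b.
Proof.
intros Hab H; apply (ex_RInt_continuous (V := R_CompleteNormedModule)); intros z.
rewrite Rmin_left, Rmax_right by assumption; apply H.
Qed.

Lemma RInt_near_const (g : R -> R) (a b K e : R) : a <= b -> ex_RInt g a b ->
  (forall x, a <= x <= b -> Rabs (g x - K) <= e) ->
  Rabs (RInt g a b - K * (b - a)) <= e * (b - a).
Proof.
intros Hab Hg H.
assert (Hc : ex_RInt (fun _ => K) a b) by apply ex_RInt_const.
replace (RInt g a b - K * (b - a)) with (RInt (fun x => g x - K) a b).
- rewrite Rmult_comm.
  apply (norm_RInt_le_const (V := R_NormedModule) (fun x => g x - K)); auto.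
  apply (RInt_correct (V := R_CompleteNormedModule)).
  apply (ex_RInt_minus (V := R_NormedModule)); assumption.
- rewrite (RInt_minus (V := R_CompleteNormedModule)) by assumption.
  rewrite RInt_const; unfold minus, plus, opp, scal; simpl; unfold mult; simpl; ring.
Qed.

Section Green.
Variables (P Q : R -> R -> R) (a b c d : R).
Hypothesis closed : forall x y, a <= x <= b -> c <= y <= d ->
  closed_form_at P Q x y.

Lemma ex_RInt_closed_P (a' b' y : R) :
  a <= a' -> a' <= b' -> b' <= b -> c <= y <= d ->
  ex_RInt (fun x => P x y) a' b'.
Proof.
intros H1 H2 H3 Hy; apply ex_RInt_continuous_le; [assumption|].
intros x Hx; apply (closed_form_continuous P Q x y), closed; lra.
Qed.

Lemma ex_RInt_closed_Q (c' d' x : R) :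
  c <= c' -> c' <= d' -> d' <= d -> a <= x <= b ->
  ex_RInt (fun y => Q x y) c' d'.
Proof.
intros H1 H2 H3 Hy; apply ex_RInt_continuous_le; [assumption|].
intros y Hx; apply (closed_form_continuous P Q x y), closed; lra.
Qed.

Lemma circulation_expand (a' b' c' d' : R) :
  a <= a' -> a' <= b' -> b' <= b -> c <= c' -> c' <= d' -> d' <= d ->
  circulation P Q a' b' c' d' =
  RInt (fun x => P x c') a' b' - RInt (fun x => P x d') a' b' +
  (RInt (fun y => Q b' y) c' d' - RInt (fun y => Q a' y) c' d').
Proof.
intros; unfold circulation.
rewrite (RInt_minus (V := R_CompleteNormedModule)) by (apply ex_RInt_closed_P; lra).
rewrite (RInt_minus (V := R_CompleteNormedModule)) by (apply ex_RInt_closed_Q; lra).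
reflexivity.
Qed.

Lemma circulation_split (a' m b' c' p d' : R) :
  a <= a' -> a' <= m -> m <= b' -> b' <= b ->
  c <= c' -> c' <= p -> p <= d' -> d' <= d ->
  circulation P Q a' b' c' d' =
  circulation P Q a' m c' p + circulation P Q m b' c' p +
  circulation P Q a' m p d' + circulation P Q m b' p d'.
Proof.
intros.
rewrite !circulation_expand by lra.
assert (HP : forall y, c <= y <= d ->
  RInt (fun x => P x y) a' b' = RInt (fun x => P x y) a' m + RInt (fun x => P x y) m b').
{ intros y Hy; symmetry; apply (RInt_Chasles (V := R_CompleteNormedModule));
    apply ex_RInt_closed_P; lra. }
assert (HQ : forall x, a <= x <= b ->
  RInt (fun y => Q x y) c' d' = RInt (fun y => Q x y) c' p + RInt (fun y => Q x y) p d').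
{ intros y Hy; symmetry; apply (RInt_Chasles (V := R_CompleteNormedModule));
    apply ex_RInt_closed_Q; lra. }
rewrite (HP c'), (HP d'), (HQ a'), (HQ b') by lra; ring.
Qed.

(* The affine part of [(P, Q)] at a point of the rectangle has zero circulation. *)
Lemma circulation_small (x y eps : R) (a' b' c' d' : R) :
  a <= a' -> a' <= b' -> b' <= b -> c <= c' -> c' <= d' -> d' <= d ->
  a' <= x <= b' -> c' <= y <= d' -> 0 < eps ->
  (exists al be ga, forall u v, a' <= u <= b' -> c' <= v <= d' ->
      Rabs (P u v - (P x y + al * (u - x) + be * (v - y)))
        <= eps * (Rabs (u - x) + Rabs (v - y)) /\
      Rabs (Q u v - (Q x y + be * (u - x) + ga * (v - y)))
        <= eps * (Rabs (u - x) + Rabs (v - y))) ->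
  Rabs (circulation P Q a' b' c' d') <= 2 * eps * ((b' - a') + (d' - c')) ^ 2.
Proof.
intros H1 H2 H3 H4 H5 H6 Hx Hy Heps (al & be & ga & H).
set (D := (b' - a') + (d' - c')).
assert (HD : forall u v, a' <= u <= b' -> c' <= v <= d' ->
  eps * (Rabs (u - x) + Rabs (v - y)) <= eps * D).
{ intros u v Hu Hv; apply Rmult_le_compat_l; [lra|].
  apply Rplus_le_compat; apply Rabs_le; lra. }
unfold circulation.
(* The affine part leaves the constants of [E1] and [E2], which are opposite because the same [be]
   serves as [dP/dy] and as [dQ/dx]. *)
assert (E1 : Rabs (RInt (fun u => P u c' - P u d') a' b' -
   (be * (c' - d')) * (b' - a')) <= (2 * eps * D) * (b' - a')).
{ apply RInt_near_const; [assumption| |].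
  - apply (ex_RInt_minus (V := R_NormedModule)); apply ex_RInt_closed_P; lra.
  - intros u Hu.
    destruct (H u c') as [A1 _]; [lra|lra|].
    destruct (H u d') as [A2 _]; [lra|lra|].
    generalize (HD u c' Hu ltac:(lra)) (HD u d' Hu ltac:(lra)); intros B1 B2.
    apply Rabs_le_between in A1; apply Rabs_le_between in A2.
    apply Rabs_le; lra. }
assert (E2 : Rabs (RInt (fun v => Q b' v - Q a' v) c' d' -
   (be * (b' - a')) * (d' - c')) <= (2 * eps * D) * (d' - c')).
{ apply RInt_near_const; [assumption| |].
  - apply (ex_RInt_minus (V := R_NormedModule)); apply ex_RInt_closed_Q; lra.
  - intros v Hv.
    destruct (H b' v) as [_ A1]; [lra|lra|].
    destruct (H a' v) as [_ A2]; [lra|lra|].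
    generalize (HD b' v ltac:(lra) Hv) (HD a' v ltac:(lra) Hv); intros B1 B2.
    apply Rabs_le_between in A1; apply Rabs_le_between in A2.
    apply Rabs_le; lra. }
apply Rabs_le_between in E1; apply Rabs_le_between in E2.
apply Rabs_le; fold D.
replace (D ^ 2) with (D * (b' - a') + D * (d' - c')) by (unfold D; ring).
lra.
Qed.

(* Bisection: some quarter carries at least a quarter of the circulation. *)
Lemma circulation_closed : a <= b -> c <= d -> circulation P Q a b c d = 0.
Proof.
intros Hab Hcd.
set (A := b - a); set (B := d - c).
set (h := fun n => A / 2 ^ n); set (k := fun n => B / 2 ^ n).
assert (Hp : forall n, 0 < 2 ^ n) by (intros n; apply pow_lt; lra).
assert (Hh : forall n, h n = h (S n) + h (S n)).
{ intros n; unfold h; simpl; field; apply Rgt_not_eq, Hp. }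
assert (Hk : forall n, k n = k (S n) + k (S n)).
{ intros n; unfold k; simpl; field; apply Rgt_not_eq, Hp. }
assert (Hh0 : forall n, 0 <= h n).
{ intros n; apply Rle_mult_inv_pos; [unfold A; lra|auto]. }
assert (Hk0 : forall n, 0 <= k n).
{ intros n; apply Rle_mult_inv_pos; [unfold B; lra|auto]. }
set (E := fun n (z : R * R) =>
  Rabs (circulation P Q (fst z) (fst z + h n) (snd z) (snd z + k n))).
(* The last branch is untested: if each of the first three quarters carries less than a quarter of
   [E n z], the triangle inequality leaves enough for the fourth. *)
set (step := fun n (z : R * R) =>
  let (x, y) := z in
  if Rle_dec (E n z) (4 * E (S n) (x, y)) then (x, y) else
  if Rle_dec (E n z) (4 * E (S n) (x + h (S n), y)) then (x + h (S n), y) else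
  if Rle_dec (E n z) (4 * E (S n) (x, y + k (S n))) then (x, y + k (S n)) else
  (x + h (S n), y + k (S n))).
set (corner := nat_rect (fun _ => (R * R)%type) (a, c) step).
assert (Hstep : forall n z,
  fst z <= fst (step n z) <= fst z + h (S n) /\
  snd z <= snd (step n z) <= snd z + k (S n)).
{ intros n [x y]; generalize (Hh0 (S n)) (Hk0 (S n)); intros; unfold step.
  repeat destruct Rle_dec; simpl; lra. }
assert (Hin : forall n, a <= fst (corner n) /\ fst (corner n) + h n <= b /\
   c <= snd (corner n) /\ snd (corner n) + k n <= d).
{ induction n as [|n IH].
  - simpl; unfold h, k, A, B; simpl; lra.
  - generalize (Hstep n (corner n)) (Hh n) (Hk n).
    change (corner (S n)) with (step n (corner n)); intros; lra. }
assert (HE : forall n, E n (corner n) <= 4 * E (S n) (corner (S n))).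
{ intros n; change (corner (S n)) with (step n (corner n)).
  generalize (Hin n); destruct (corner n) as [x y]; simpl fst; simpl snd; intros Hz.
  unfold step.
  generalize (Hh0 (S n)) (Hk0 (S n)) (Hh n) (Hk n); intros.
  destruct Rle_dec as [|N1]; [assumption|].
  destruct Rle_dec as [|N2]; [assumption|].
  destruct Rle_dec as [|N3]; [assumption|].
  assert (S4 := circulation_split x (x + h (S n)) (x + h n) y (y + k (S n)) (y + k n)
   ltac:(lra) ltac:(lra) ltac:(lra) ltac:(lra) ltac:(lra) ltac:(lra) ltac:(lra) ltac:(lra)).
  apply Rnot_le_lt in N1; apply Rnot_le_lt in N2; apply Rnot_le_lt in N3.
  unfold E in *; simpl fst in *; simpl snd in *.
  rewrite (Hh n), (Hk n), <- !Rplus_assoc in S4, N1, N2, N3 |- *.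
  revert S4 N1 N2 N3.
  set (z1 := circulation P Q x (x + h (S n)) y (y + k (S n))).
  set (z2 := circulation P Q (x + h (S n)) _ y _).
  set (z3 := circulation P Q x (x + h (S n)) (y + k (S n)) _).
  set (z4 := circulation P Q (x + h (S n)) _ (y + k (S n)) _).
  intros ->; intros N1 N2 N3.
  generalize (Rabs_triang (z1 + z2 + z3) z4) (Rabs_triang (z1 + z2) z3)
    (Rabs_triang z1 z2); lra. }
assert (HE0 : forall n, Rabs (circulation P Q a b c d) <= 4 ^ n * E n (corner n)).
{ induction n as [|n IH].
  - unfold E; simpl; unfold h, k, A, B; simpl.
    replace (a + (b - a) / 1) with b by field.
    replace (c + (d - c) / 1) with d by field. lra.
  - eapply Rle_trans; [exact IH|].
    replace (4 ^ S n) with (4 ^ n * 4) by (simpl; ring).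
    rewrite Rmult_assoc; apply Rmult_le_compat_l; [apply pow_le; lra|apply HE]. }
destruct (halving_limit A (fun n => fst (corner n))) as [x Hx];
  [unfold A; lra|intros n; apply (Hstep n (corner n))|].
destruct (halving_limit B (fun n => snd (corner n))) as [y Hy];
  [unfold B; lra|intros n; apply (Hstep n (corner n))|].
assert (Hxy : a <= x <= b /\ c <= y <= d).
{ specialize (Hx O); specialize (Hy O); simpl in Hx, Hy; unfold A, B in *; lra. }
destruct (closed x y) as (al & be & ga & H); [apply Hxy|apply Hxy|].
(* The local error is [eps] times the square of the side lengths, which shrinks exactly like
   [4^(-n)]; it absorbs the factor [4 ^ n] of [HE0] and only [eps] remains. *)
assert (Hlim : forall eps, 0 < eps ->
  Rabs (circulation P Q a b c d) <= 2 * eps * (A + B) ^ 2).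
{ intros eps Heps.
  destruct (H eps Heps) as [del [Hd Hdel]].
  assert (exists n, h n + k n < del) as [n Hn].
  { destruct (Rle_lt_dec (A + B) 0) as [HAB|HAB].
    - exists O; unfold h, k; simpl; unfold A, B in *; lra.
    - destruct (pow_lt_1_zero (/ 2) ltac:(rewrite Rabs_pos_eq; lra) (del / (A + B)))
        as [n Hn]; [apply Rdiv_lt_0_compat; lra|].
      exists n; specialize (Hn n (Nat.le_refl n)).
      rewrite Rabs_pos_eq in Hn by (apply pow_le; lra).
      rewrite pow_inv in Hn.
      unfold h, k.
      replace (A / 2 ^ n + B / 2 ^ n) with ((A + B) * / 2 ^ n)
        by (field; apply Rgt_not_eq, Hp).
      apply Rmult_lt_reg_r with (/ (A + B)); [apply Rinv_0_lt_compat; lra|].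
      replace ((A + B) * / 2 ^ n * / (A + B)) with (/ 2 ^ n)
        by (field; split; [lra|apply Rgt_not_eq, Hp]).
      exact Hn. }
  eapply Rle_trans; [apply (HE0 n)|].
  specialize (Hx n); specialize (Hy n); fold (h n) in Hx; fold (k n) in Hy.
  destruct (Hin n) as (I1 & I2 & I3 & I4).
  generalize (Hh0 n) (Hk0 n); intros.
  assert (HS := circulation_small x y eps (fst (corner n)) (fst (corner n) + h n)
    (snd (corner n)) (snd (corner n) + k n) ltac:(lra) ltac:(lra) ltac:(lra)
    ltac:(lra) ltac:(lra) ltac:(lra) ltac:(lra) ltac:(lra) Heps).
  assert (HS' : E n (corner n) <= 2 * eps * (h n + k n) ^ 2).
  { unfold E; eapply Rle_trans; [apply HS|apply Req_le; ring].
    exists al, be, ga; intros u v Hu Hv; apply Hdel; apply Rabs_lt_between; lra. }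
  replace (2 * eps * (A + B) ^ 2) with (4 ^ n * (2 * eps * (h n + k n) ^ 2)).
  - apply Rmult_le_compat_l; [apply pow_le; lra|exact HS'].
  - replace 4 with (2 * 2) at 1 by ring; rewrite Rpow_mult_distr.
    unfold h, k; field; apply Rgt_not_eq, Hp. }
destruct (Req_dec (circulation P Q a b c d) 0) as [|N]; [assumption|exfalso].
apply Rabs_pos_lt in N.
set (K := (A + B) ^ 2) in *.
assert (0 <= K) by apply pow2_ge_0.
specialize (Hlim (Rabs (circulation P Q a b c d) / (4 * (K + 1)))
  ltac:(apply Rdiv_lt_0_compat; lra)).
set (Z := Rabs _) in *.
assert (2 * (Z / (4 * (K + 1))) * K < Z); [|lra].
apply Rmult_lt_reg_r with (4 * (K + 1)); [lra|].
replace (2 * (Z / (4 * (K + 1))) * K * (4 * (K + 1))) with (2 * Z * K) by (field; lra).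
nra.
Qed.

End Green.

(** * The recurrence for the remainders of Chebyshev polynomials *)

Ltac to_R :=
  repeat match goal with
  | |- context [@minus ?G ?a ?b] => change (@minus G a b) with (Rminus a b)
  | |- context [@plus ?G ?a ?b] => change (@plus G a b) with (Rplus a b)
  | |- context [@opp ?G ?a] => change (@opp G a) with (Ropp a)
  | |- context [@mult ?G ?a ?b] => change (@mult G a b) with (Rmult a b)
  | |- context [@scal ?K ?G ?a ?b] => change (@scal K G a b) with (Rmult a b)
  end;
  try match goal with
  | |- @eq _ ?a ?b => change (@eq R a b)
  | |- @eq _ ?a ?b -> ?G => change (@eq R a b -> G)
  end.

Lemma sum_n_zero (u : nat -> R) (N : nat) :
  (forall k, (k <= N)%nat -> u k = 0) -> sum_n u N = 0.
Proof.
induction N as [|N IH]; intros H; [rewrite sum_O; apply H; lia|].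
rewrite sum_Sn, (H (S N)), IH by auto; to_R; simpl; ring.
Qed.

Lemma sum_n_extend (u : nat -> R) (N d : nat) :
  (forall k, (N < k < N + S d)%nat -> u k = 0) ->
  sum_n u (N + S d) = sum_n u N + u (N + S d)%nat.
Proof.
intros H; rewrite Nat.add_succ_r, sum_Sn; unfold plus; simpl; f_equal.
assert (E : forall e, (e <= d)%nat -> sum_n u (N + e) = sum_n u N).
{ induction e as [|e IH]; intros He; [rewrite Nat.add_0_r; reflexivity|].
  rewrite Nat.add_succ_r, sum_Sn, IH, H by lia; to_R; simpl; ring. }
apply E; lia.
Qed.

Definition shift_sum (n : nat) (x : Z -> R) (k : Z) : R :=
  x (k + Z.of_nat n)%Z + x (k - Z.of_nat n)%Z.

(* The family supported on [b + 2 n j], [j >= 0], with value [c j] there. *)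
Definition comb (n : nat) (c : nat -> R) (b k : Z) : R :=
  if andb (b <=? k)%Z ((k - b) mod (2 * Z.of_nat n) =? 0)%Z
  then c (Z.to_nat ((k - b) / (2 * Z.of_nat n))) else 0.

(** Multiplication of the generating function by [1 + X], which is what [shift_sum] becomes along a
    progression of step [2n]. *)
Definition pascal_step (c : nat -> R) (j : nat) : R :=
  c j + match j with O => 0 | S i => c i end.

Definition delta0 (j : nat) : R := if Nat.eqb j 0 then 1 else 0.

Definition zdelta0 (k : Z) : R := if (k =? 0)%Z then 1 else 0.

(** The coefficients of [(1 + X)^m], zero beyond the row. [Binomial.C] does not vanish there,
    because of truncated subtraction. *)
Definition bin (m : nat) : nat -> R := Nat.iter m pascal_step delta0.

(** Division of the generating function by [1 - X]. *)
Definition psum (c : nat -> R) : nat -> R := sum_n c.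

Section Comb.
Variable n : nat.
Hypothesis n_gt0 : (1 <= n)%nat.
Let N := Z.of_nat n.

Lemma comb_at (c : nat -> R) (b : Z) (j : nat) :
  comb n c b (b + 2 * N * Z.of_nat j) = c j.
Proof.
unfold comb; fold N.
replace (b + 2 * N * Z.of_nat j - b)%Z with (Z.of_nat j * (2 * N))%Z by ring.
rewrite Z_mod_mult, Z_div_mult by lia.
rewrite (proj2 (Z.leb_le _ _)) by nia; cbn [andb]; rewrite Nat2Z.id; reflexivity.
Qed.

Lemma comb_out (c : nat -> R) (b k : Z) :
  (forall j : nat, k <> (b + 2 * N * Z.of_nat j)%Z) -> comb n c b k = 0.
Proof.
intros H; unfold comb; fold N.
destruct (Z.leb_spec b k) as [Hb|Hb]; cbn [andb]; [|reflexivity].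
destruct (Z.eqb_spec ((k - b) mod (2 * N)) 0) as [Hm|Hm]; [|reflexivity].
exfalso; apply (H (Z.to_nat ((k - b) / (2 * N)))).
assert (0 <= (k - b) / (2 * N))%Z by (apply Z.div_pos; lia).
rewrite Z2Nat.id by assumption.
generalize (Z_div_mod_eq_full (k - b) (2 * N)); lia.
Qed.

Lemma comb_dec (b k : Z) :
  (exists j : nat, k = (b + 2 * N * Z.of_nat j)%Z) \/
  (forall j : nat, k <> (b + 2 * N * Z.of_nat j)%Z).
Proof.
destruct (Z.leb_spec b k) as [Hb|Hb]; [|right; intros j; nia].
destruct (Z.eqb_spec ((k - b) mod (2 * N)) 0) as [Hm|Hm].
- left; exists (Z.to_nat ((k - b) / (2 * N))).
  assert (0 <= (k - b) / (2 * N))%Z by (apply Z.div_pos; lia).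
  rewrite Z2Nat.id by assumption.
  generalize (Z_div_mod_eq_full (k - b) (2 * N)); lia.
- right; intros j ->; apply Hm.
  replace (b + 2 * N * Z.of_nat j - b)%Z with (Z.of_nat j * (2 * N))%Z by ring.
  apply Z_mod_mult.
Qed.

Lemma comb_lt (c : nat -> R) (b k : Z) : (k < b)%Z -> comb n c b k = 0.
Proof. intros H; apply comb_out; intros j; nia. Qed.

(** The point [b + 2nj] lies midway between the points of index [j - 1] and [j] of the progression
    from [b + n]; for [j = 0] the left one is missing. *)
Lemma shift_sum_comb (c : nat -> R) (b k : Z) :
  shift_sum n (comb n c (b + N)) k = comb n (pascal_step c) b k.
Proof.
unfold shift_sum; fold N.
destruct (comb_dec b k) as [[j ->]|H].
- rewrite comb_at; unfold pascal_step; f_equal.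
  + replace (b + 2 * N * Z.of_nat j + N)%Z with (b + N + 2 * N * Z.of_nat j)%Z by ring.
    apply comb_at.
  + destruct j as [|j]; [apply comb_lt; lia|].
    replace (b + 2 * N * Z.of_nat (S j) - N)%Z with (b + N + 2 * N * Z.of_nat j)%Z by lia.
    apply comb_at.
- rewrite !comb_out; [ring|exact H| |].
  + intros j Hj; apply (H (S j)); lia.
  + intros j Hj; apply (H j); lia.
Qed.

Lemma iter_shift_sum_comb (c : nat -> R) (m : nat) (b : Z) :
  Nat.iter m (shift_sum n) (comb n c (b + Z.of_nat m * N)) =
  comb n (Nat.iter m pascal_step c) b.
Proof.
revert b; induction m as [|m IH]; intros b.
- simpl; f_equal; lia.
- rewrite !Nat.iter_succ.
  replace (b + Z.of_nat (S m) * N)%Z with ((b + N) + Z.of_nat m * N)%Z by lia.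
  rewrite IH; apply functional_extensionality; intros k; apply shift_sum_comb.
Qed.

(** With [d = s + 1] this discards the left half of row [2s + 1] of Pascal's triangle, which sits at
    negative indices. *)
Lemma comb_skip (c : nat -> R) (b k : Z) (d : nat) :
  (b + 2 * N * Z.of_nat d - 2 * N < k)%Z ->
  comb n c b k = comb n (fun j => c (d + j)%nat) (b + 2 * N * Z.of_nat d) k.
Proof.
intros Hk; destruct (comb_dec (b + 2 * N * Z.of_nat d) k) as [[j ->]|H].
- rewrite comb_at.
  replace (b + 2 * N * Z.of_nat d + 2 * N * Z.of_nat j)%Z
    with (b + 2 * N * Z.of_nat (d + j))%Z by lia.
  apply comb_at.
- rewrite (comb_out (fun j => c (d + j)%nat)) by exact H.
  apply comb_out; intros j ->.
  assert (d <= j)%nat by nia.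
  apply (H (j - d)%nat); rewrite Nat2Z.inj_sub by lia; ring.
Qed.

Lemma iter_shift_sum_ext (m : nat) (x y : Z -> R) (k : Z) :
  (forall j, (k - Z.of_nat m * N <= j <= k + Z.of_nat m * N)%Z -> x j = y j) ->
  Nat.iter m (shift_sum n) x k = Nat.iter m (shift_sum n) y k.
Proof.
revert k; induction m as [|m IH]; intros k H.
- simpl; apply H; lia.
- rewrite !Nat.iter_succ; unfold shift_sum at 1 3; fold N.
  f_equal; apply IH; intros j Hj; apply H; nia.
Qed.

Lemma iter_shift_sum_lin (m : nat) (x y : Z -> R) (a : R) (k : Z) :
  Nat.iter m (shift_sum n) (fun j => x j + a * y j) k =
  Nat.iter m (shift_sum n) x k + a * Nat.iter m (shift_sum n) y k.
Proof.
revert k; induction m as [|m IH]; intros k; [reflexivity|].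
rewrite !Nat.iter_succ; unfold shift_sum at 1 3 5; rewrite !IH; ring.
Qed.

Lemma iter_shift_sum_even (m : nat) (x : Z -> R) :
  (forall k, x (- k)%Z = x k) ->
  forall k, Nat.iter m (shift_sum n) x (- k)%Z = Nat.iter m (shift_sum n) x k.
Proof.
intros Hx; induction m as [|m IH]; intros k; [apply Hx|].
rewrite !Nat.iter_succ; unfold shift_sum at 1 3.
replace (- k + Z.of_nat n)%Z with (- (k - Z.of_nat n))%Z by ring.
replace (- k - Z.of_nat n)%Z with (- (k + Z.of_nat n))%Z by ring.
rewrite !IH; ring.
Qed.

(** All the shifts in [A^m] except the rightmost land where [x] vanishes, so the recurrence can be
    solved for its last term. *)
Lemma iter_shift_sum_last (m : nat) (x : Z -> R) (k : Z) :
  (forall j, (k - Z.of_nat m * N <= j < k + Z.of_nat m * N)%Z -> x j = 0) ->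
  Nat.iter m (shift_sum n) x k = x (k + Z.of_nat m * N)%Z.
Proof.
revert k; induction m as [|m IH]; intros k H.
- simpl; f_equal; lia.
- rewrite !Nat.iter_succ; unfold shift_sum at 1; fold N.
  rewrite !IH by (intros j Hj; apply H; nia).
  rewrite (H (k - N + _)%Z) by nia.
  rewrite Rplus_0_r; f_equal; lia.
Qed.

(** The recurrence is solved outwards: for [k > 0], the only index in its window not yet covered is
    [k + mn]. At [k = 0] both extremes [mn] and [-mn] are open; evenness makes them a single
    unknown, counted twice. *)
Lemma shift_sum_kernel (m : nat) (x : Z -> R) : (1 <= m)%nat ->
  (forall k, x (- k)%Z = x k) ->
  (forall k, (Z.abs k < Z.of_nat m * N)%Z -> x k = 0) ->
  (forall k, (0 <= k)%Z -> Nat.iter m (shift_sum n) x k = 0) ->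
  forall k, x k = 0.
Proof.
intros Hm Hev H0 HA.
assert (Habs : forall k, x k = x (Z.abs k)).
{ intros k; destruct (Z.abs_spec k) as [[_ ->]|[_ ->]]; [|rewrite Hev]; reflexivity. }
assert (Hfirst : x (Z.of_nat m * N)%Z = 0).
{ specialize (HA 0%Z (Z.le_refl 0)).
  destruct m as [|m]; [lia|].
  rewrite Nat.iter_succ in HA; unfold shift_sum at 1 in HA; fold N in HA.
  replace (0 - N)%Z with (- (0 + N))%Z in HA by ring.
  rewrite iter_shift_sum_even in HA by exact Hev.
  rewrite iter_shift_sum_last in HA by (intros j Hj; apply H0; nia).
  replace (Z.of_nat (S m) * N)%Z with (0 + N + Z.of_nat m * N)%Z by lia; lra. }
assert (Hnat : forall k : nat, x (Z.of_nat k) = 0).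
{ intros k; induction k as [k IH] using lt_wf_ind.
  destruct (Z_lt_le_dec (Z.of_nat k) (Z.of_nat m * N)) as [H|H];
    [apply H0; lia|].
  destruct (Z.eq_dec (Z.of_nat k) (Z.of_nat m * N)) as [->|Hne]; [exact Hfirst|].
  specialize (HA (Z.of_nat k - Z.of_nat m * N)%Z ltac:(lia)).
  rewrite iter_shift_sum_last in HA.
  - rewrite <- HA; f_equal; lia.
  - intros j Hj; rewrite Habs, <- (Z2Nat.id (Z.abs j)) by lia.
    apply IH; lia. }
intros k; rewrite Habs, <- (Z2Nat.id (Z.abs k)) by lia; apply Hnat.
Qed.

Lemma sum_n_comb (u c : nat -> R) (B J : nat) :
  sum_n (fun k => u k * comb n c (Z.of_nat B) (Z.of_nat k)) (B + 2 * n * J) =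
  sum_n (fun j => u (B + 2 * n * j)%nat * c j) J.
Proof.
assert (HB : forall j, comb n c (Z.of_nat B) (Z.of_nat (B + 2 * n * j)) = c j).
{ intros j; rewrite <- (comb_at c (Z.of_nat B) j); f_equal; unfold N; lia. }
induction J as [|J IH].
- rewrite sum_O, <- (HB O) at 1.
  replace (B + 2 * n * 0)%nat with B by lia.
  destruct B as [|B]; [rewrite sum_O; reflexivity|].
  rewrite sum_Sn, sum_n_zero; [to_R; simpl; ring|].
  intros k Hk; rewrite comb_lt by lia; ring.
- rewrite sum_Sn, <- IH.
  replace (B + 2 * n * S J)%nat with ((B + 2 * n * J) + S (2 * n - 1))%nat by lia.
  rewrite sum_n_extend.
  + replace ((B + 2 * n * J) + S (2 * n - 1))%nat with (B + 2 * n * S J)%nat by lia.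
    rewrite HB; reflexivity.
  + intros k Hk; rewrite comb_out; [ring|intros j Hj].
    assert (k = B + 2 * n * j)%nat by (unfold N in Hj; lia).
    assert (J < j < S J)%nat; [|lia]. nia.
Qed.

End Comb.

(** * Binomial coefficients and the partial sums of the alternating half row *)

Lemma bin_out (m j : nat) : (m < j)%nat -> bin m j = 0.
Proof.
revert j; induction m as [|m IH]; intros j Hj.
- destruct j; [lia|reflexivity].
- unfold bin; rewrite Nat.iter_succ; fold (bin m); unfold pascal_step.
  destruct j as [|j]; [lia|]; rewrite !IH by lia; ring.
Qed.

Lemma bin_S (m j : nat) : bin (S m) (S j) = bin m (S j) + bin m j.
Proof. reflexivity. Qed.

Lemma bin_0_r (m : nat) : bin m 0 = 1.
Proof.
induction m as [|m IH]; [reflexivity|].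
unfold bin; rewrite Nat.iter_succ; fold (bin m); unfold pascal_step; lra.
Qed.

Lemma bin_C (m j : nat) : (j <= m)%nat -> bin m j = Binomial.C m j.
Proof.
revert j; induction m as [|m IH]; intros j Hj.
- replace j with O by lia.
  unfold bin, Binomial.C; simpl; unfold delta0; simpl; field.
- destruct j as [|j].
  + rewrite bin_0_r; unfold Binomial.C; rewrite Nat.sub_0_r; simpl fact at 2.
    rewrite Rmult_1_l; symmetry; apply Rinv_r, INR_fact_neq_0.
  + rewrite bin_S; destruct (Nat.eq_dec j m) as [->|H].
    * rewrite bin_out by lia; rewrite IH by lia.
      unfold Binomial.C; rewrite !Nat.sub_diag; simpl (INR (fact 0)).
      field; split; apply INR_fact_neq_0.
    * rewrite !IH by lia; rewrite Rplus_comm; apply pascal; lia.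
Qed.

(** The two conditions say that [i] is at least as close to [m / 2] as [j]. Pascal's rule preserves
    this when the four entries of the previous row are compared crosswise, [S i] with [j] and [i]
    with [S j]. *)
Lemma bin_le (m i j : nat) : (i <= j)%nat -> (m <= i + j)%nat -> bin m j <= bin m i.
Proof.
revert i j; induction m as [|m IH]; intros i j Hij Hm.
- destruct j as [|j]; [replace i with O by lia; lra|].
  rewrite bin_out by lia.
  unfold bin, delta0; simpl; destruct Nat.eqb; lra.
- destruct (Nat.eq_dec i j) as [->|Hne]; [lra|].
  destruct i as [|i].
  + rewrite bin_0_r; destruct j as [|j]; [lia|].
    destruct (Nat.eq_dec m j) as [->|H].
    * rewrite bin_S, bin_out by lia.
      generalize (IH O j ltac:(lia) ltac:(lia)); rewrite bin_0_r; lra.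
    * rewrite bin_out by lia; lra.
  + destruct j as [|j]; [lia|]; rewrite !bin_S.
    generalize (IH (S i) j ltac:(lia) ltac:(lia)) (IH i (S j) ltac:(lia) ltac:(lia)); lra.
Qed.

Lemma bin_ge0 (m j : nat) : 0 <= bin m j.
Proof.
destruct (Nat.le_gt_cases m j) as [H|H].
- rewrite <- (bin_out m (S (j + m))) by lia; apply bin_le; lia.
- rewrite <- (bin_out m (S (2 * m))) by lia; apply bin_le; lia.
Qed.

(** The signs [(-1)^j] turn multiplication by [1 + X] into multiplication by [1 - X], the inverse of
    [psum]. *)
Lemma pascal_step_alternate (c : nat -> R) :
  pascal_step (fun j => (-1) ^ j * psum c j) = (fun j => (-1) ^ j * c j).
Proof.
apply functional_extensionality; intros [|j]; unfold pascal_step, psum.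
- rewrite sum_O; ring.
- rewrite sum_Sn; to_R; simpl; ring.
Qed.

Lemma iter_pascal_step_alternate (m : nat) (c : nat -> R) :
  Nat.iter m pascal_step (fun j => (-1) ^ j * Nat.iter m psum c j) =
  (fun j => (-1) ^ j * c j).
Proof.
induction m as [|m IH]; [reflexivity|].
rewrite Nat.iter_succ_r.
replace (fun j => (-1) ^ j * Nat.iter (S m) psum c j)
  with (fun j => (-1) ^ j * psum (Nat.iter m psum c) j) by reflexivity.
rewrite pascal_step_alternate; exact IH.
Qed.

(* Coefficients of the numerator of the bound, as a polynomial in [rho^(-2n)]. *)
Definition half_row (s j : nat) : R := (-1) ^ j * bin (2 * s + 1) (s + 1 + j).

(** Pascal's rule splits each entry of row [2s + 1] into two neighbours of row [2s], and the
    alternating sum telescopes. *)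
Lemma psum_half_row (s m : nat) :
  psum (half_row s) m = bin (2 * s) s + (-1) ^ m * bin (2 * s) (s + 1 + m).
Proof.
unfold psum, half_row; rewrite (Nat.add_comm (2 * s) 1).
induction m as [|m IH].
- rewrite sum_O; replace (s + 1 + 0)%nat with (S s) by lia.
  change (1 + 2 * s)%nat with (S (2 * s)); rewrite bin_S; simpl pow; ring.
- rewrite sum_Sn, IH; to_R.
  replace (s + 1 + S m)%nat with (S (s + 1 + m)) by lia.
  change (1 + 2 * s)%nat with (S (2 * s)); rewrite bin_S; simpl pow; ring.
Qed.

(** The fixed term [bin (2 * s) s] is the central coefficient, the largest of its row. *)
Lemma psum_half_row_ge0 (s m : nat) : 0 <= psum (half_row s) m.
Proof.
rewrite psum_half_row.
assert (bin (2 * s) (s + 1 + m) <= bin (2 * s) s) by (apply bin_le; lia).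
assert (H0 := bin_ge0 (2 * s) (s + 1 + m)).
assert (Hs : (-1) ^ m = 1 \/ (-1) ^ m = -1).
{ clear; induction m as [|m [IH|IH]]; simpl; [left|rewrite IH; right|rewrite IH; left]; ring. }
destruct Hs as [-> | ->]; lra.
Qed.

Lemma psum_ge0 (c : nat -> R) : (forall j, 0 <= c j) -> forall j, 0 <= psum c j.
Proof.
intros H j; unfold psum; induction j as [|j IH]; [rewrite sum_O; apply H|].
rewrite sum_Sn; unfold plus; simpl; specialize (H (S j)); lra.
Qed.

Lemma iter_psum_half_row_ge0 (s m j : nat) :
  0 <= Nat.iter (S m) psum (half_row s) j.
Proof.
revert j; induction m as [|m IH]; intros j; [apply psum_half_row_ge0|].
rewrite Nat.iter_succ; apply psum_ge0, IH.
Qed.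

(** Summation by parts. Truncation at [J] leaves the nonnegative term [psum c J * x ^ S J], so the
    identity between generating functions becomes an inequality in the useful direction and no
    infinite sum enters. *)
Lemma psum_sum_le (c : nat -> R) (x : R) (J : nat) :
  0 <= x -> (forall j, 0 <= psum c j) ->
  (1 - x) * sum_n (fun j => psum c j * x ^ j) J <= sum_n (fun j => c j * x ^ j) J.
Proof.
intros Hx Hc.
assert (E : (1 - x) * sum_n (fun j => psum c j * x ^ j) J =
            sum_n (fun j => c j * x ^ j) J - psum c J * x ^ S J).
{ unfold psum; induction J as [|J IH]; [rewrite !sum_O; simpl; ring|].
  rewrite (sum_Sn (fun j => sum_n c j * x ^ j)), (sum_Sn (fun j => c j * x ^ j)).
  cbv beta; rewrite (sum_Sn c).
  to_R.
  rewrite Rmult_plus_distr_l, IH; simpl;  ring. }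
rewrite E; assert (0 <= psum c J * x ^ S J); [|lra].
apply Rmult_le_pos; [apply Hc|apply pow_le, Hx].
Qed.

Lemma iter_psum_sum_le (s m J : nat) (x : R) : 0 <= x <= 1 ->
  (1 - x) ^ m * sum_n (fun j => Nat.iter m psum (half_row s) j * x ^ j) J <=
  sum_n (fun j => half_row s j * x ^ j) J.
Proof.
intros Hx; induction m as [|m IH]; [simpl; lra|].
eapply Rle_trans; [|exact IH].
replace ((1 - x) ^ S m) with ((1 - x) ^ m * (1 - x)) by (simpl; ring).
rewrite Rmult_assoc; apply Rmult_le_compat_l; [apply pow_le; lra|].
apply (psum_sum_le (Nat.iter m psum (half_row s))); [lra|].
intros j; apply (iter_psum_half_row_ge0 s m j).
Qed.

(** The numbers [(-1)^j g_j]: their generating function is that of [bin (2 * s + 1) (s + 1 + j)]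
    divided by [(1 + X)^(2s)]. *)
Definition alt_coef (s j : nat) : R := (-1) ^ j * Nat.iter (2 * s) psum (half_row s) j.

(** Both sides are even and vanish for [|k| < 2sn], so once the candidate is seen to satisfy the
    recurrence for [k >= 0], [shift_sum_kernel] applies to the difference. *)
Lemma shift_sum_solution (n s : nat) (r : Z -> R) :
  (1 <= n)%nat -> (1 <= s)%nat ->
  (forall k, r (- k)%Z = r k) ->
  (forall k, (Z.abs k < Z.of_nat (2 * s) * Z.of_nat n)%Z -> r k = 0) ->
  (forall k, (0 <= k)%Z ->
    Nat.iter (2 * s) (shift_sum n) r k = Nat.iter (2 * s + 1) (shift_sum n) zdelta0 k) ->
  forall k, r k = comb n (alt_coef s) (Z.of_nat ((2 * s + 1) * n)) (Z.abs k).
Proof.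
intros Hn Hs Hev H0 HA k.
set (b := Z.of_nat ((2 * s + 1) * n)).
set (sol := fun k => comb n (alt_coef s) b (Z.abs k)).
cut (r k + (-1) * sol k = 0); [unfold sol; lra|].
apply (shift_sum_kernel n Hn (2 * s) (fun k => r k + (-1) * sol k)); [lia| | |].
- intros j; rewrite Hev; unfold sol; rewrite Z.abs_opp; reflexivity.
- intros j Hj; rewrite H0 by exact Hj; unfold sol.
  rewrite comb_lt by (try exact Hn; unfold b; nia); ring.
- intros j Hj; rewrite iter_shift_sum_lin, HA by exact Hj.
  (* For [j >= 0] the window of [A^(2s)] reaches down only to [-2sn], while the mirror image of the
     comb starts at [-(2s + 1)n]; hence the one-sided comb may replace [sol]. *)
  rewrite (iter_shift_sum_ext n Hn _ sol (comb n (alt_coef s) b)).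
  2:{ intros i Hi; unfold sol.
      destruct (Z_le_gt_dec 0 i) as [Hi0|Hi0]; [rewrite Z.abs_eq by lia; reflexivity|].
      rewrite !comb_lt; try exact Hn; try reflexivity; unfold b; nia. }
  replace b with (Z.of_nat n + Z.of_nat (2 * s) * Z.of_nat n)%Z by (unfold b; lia).
  rewrite iter_shift_sum_comb by exact Hn.
  replace (alt_coef s) with (fun j => (-1) ^ j * Nat.iter (2 * s) psum (half_row s) j)
    by reflexivity.
  rewrite iter_pascal_step_alternate.
  (* The base 0 is written so that [2s + 1] applications bring it down to [-(2s + 1)n]; this
     produces the whole row [2s + 1]. *)
  replace zdelta0 with
    (comb n delta0 (- Z.of_nat ((2 * s + 1) * n) + Z.of_nat (2 * s + 1) * Z.of_nat n)).
  2:{ replace (- Z.of_nat ((2 * s + 1) * n) + Z.of_nat (2 * s + 1) * Z.of_nat n)%Z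
        with 0%Z by lia.
      apply functional_extensionality; intros i; unfold zdelta0.
      destruct (comb_dec n Hn 0 i) as [[l ->]|Hi].
      - rewrite comb_at by exact Hn; unfold delta0.
        destruct l; [rewrite Z.mul_0_r; reflexivity|].
        destruct (Z.eqb_spec (0 + 2 * Z.of_nat n * Z.of_nat (S l)) 0); [lia|reflexivity].
      - rewrite comb_out by (try exact Hn; exact Hi).
        destruct (Z.eqb_spec i 0) as [->|]; [|reflexivity].
        destruct (Hi O); lia. }
  rewrite iter_shift_sum_comb by exact Hn; fold (bin (2 * s + 1)).
  (* Dropping [s + 1] entries raises the base to [n], where [A^(2s)] has also brought the other
     side. *)
  rewrite (comb_skip n Hn _ _ _ (s + 1)) by nia.
  replace (- Z.of_nat ((2 * s + 1) * n) + 2 * Z.of_nat n * Z.of_nat (s + 1))%Z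
    with (Z.of_nat n) by lia.
  replace (fun j => (-1) ^ j * half_row s j) with (fun j => bin (2 * s + 1) (s + 1 + j)).
  { ring. }
  apply functional_extensionality; intros i; unfold half_row.
  rewrite <- Rmult_assoc, <- Rpow_mult_distr.
  replace (-1 * -1) with 1 by ring; rewrite pow1; ring.
Qed.

Lemma half_row_C (s j : nat) : (j <= s)%nat ->
  half_row s j = (-1) ^ j * Binomial.C (2 * s + 1) (s - j).
Proof.
intros Hj; unfold half_row; rewrite bin_C by lia; f_equal.
rewrite pascal_step1 by lia; f_equal; lia.
Qed.

Lemma half_row_sum (s J : nat) (x : R) : (s <= J)%nat ->
  sum_n (fun j => half_row s j * x ^ j) J =
  sum_n (fun k => (-1) ^ k * Binomial.C (2 * s + 1) (s - k) * x ^ k) s.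
Proof.
intros H; replace J with (s + (J - s))%nat by lia; generalize (J - s)%nat as d.
induction d as [|d IH].
- rewrite Nat.add_0_r; apply sum_n_ext_loc; intros j Hj.
  rewrite half_row_C by exact Hj; reflexivity.
- rewrite Nat.add_succ_r, sum_Sn, IH; unfold half_row at 1.
  rewrite bin_out by lia; to_R; simpl; ring.
Qed.

Lemma alt_coef_sum_le (s J : nat) (x : R) : (1 <= s)%nat -> 0 <= x < 1 ->
  sum_n (fun j => Rabs (alt_coef s j) * x ^ j) J <=
  sum_n (fun k => (-1) ^ k * Binomial.C (2 * s + 1) (s - k) * x ^ k) s
    / (1 - x) ^ (2 * s).
Proof.
intros Hs Hx.
assert (Hge : forall j, 0 <= Nat.iter (2 * s) psum (half_row s) j).
{ intros j; replace (2 * s)%nat with (S (2 * s - 1)) by lia; apply iter_psum_half_row_ge0. }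
assert (Habs : forall j, Rabs (alt_coef s j) = Nat.iter (2 * s) psum (half_row s) j).
{ intros j; unfold alt_coef; rewrite Rabs_mult, pow_1_abs, Rmult_1_l.
  apply Rabs_pos_eq, Hge. }
(* The terms are nonnegative, so the sum may be lengthened by [s], which guarantees that it covers
   the whole half row. *)
apply Rle_trans with (sum_n (fun j => Rabs (alt_coef s j) * x ^ j) (J + s)).
- generalize s at 3 as d; induction d as [|d IH]; [rewrite Nat.add_0_r; lra|].
  eapply Rle_trans; [exact IH|].
  rewrite Nat.add_succ_r, sum_Sn; to_R.
  assert (0 <= Rabs (alt_coef s (S (J + d))) * x ^ S (J + d)); [|lra].
  apply Rmult_le_pos; [apply Rabs_pos|apply pow_le, Hx].
- apply Rmult_le_reg_l with ((1 - x) ^ (2 * s)); [apply pow_lt; lra|].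
  eapply Rle_trans.
  2:{ apply Req_le; symmetry; unfold Rdiv; rewrite (Rmult_comm _ (/ _)), <- Rmult_assoc.
      rewrite Rinv_r, Rmult_1_l by (apply pow_nonzero; lra).
      symmetry; apply (half_row_sum s (J + s)); lia. }
  rewrite (sum_n_ext _ (fun j => Nat.iter (2 * s) psum (half_row s) j * x ^ j))
    by (intros j; rewrite Habs; reflexivity).
  apply iter_psum_sum_le; lra.
Qed.

(** * Polynomials, Hermite interpolation and Chebyshev polynomials *)

Lemma sum_n_first (u : nat -> R) (N : nat) :
  sum_n u (S N) = u O + sum_n (fun k => u (S k)) N.
Proof.
induction N as [|N IH]; [rewrite sum_Sn, !sum_O; reflexivity|].
rewrite sum_Sn, IH, (sum_Sn (fun k => u (S k))); to_R; ring.
Qed.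

Lemma polynomial_le_ext (d : nat) (p q : R -> R) :
  (forall t, p t = q t) -> polynomial_le d p -> polynomial_le d q.
Proof. intros E [a H]; exists a; intros t; rewrite <- E; apply H. Qed.

(** Horner's form lets closure properties, products in particular, go by induction on the degree
    bound instead of through double sums of coefficients. *)
Lemma polynomial_le_horner (d : nat) (p : R -> R) :
  polynomial_le (S d) p <->
  exists c q, polynomial_le d q /\ forall t, p t = c + t * q t.
Proof.
split.
- intros [a H]; exists (a O), (fun t => sum_n (fun k => a (S k) * t ^ k) d); split.
  + exists (fun k => a (S k)); reflexivity.
  + intros t; rewrite H, sum_n_first; f_equal; [simpl; ring|].
    rewrite <- (sum_n_mult_l (K := R_Ring)); apply sum_n_ext; intros k.
    to_R; simpl; ring.
- intros (c & q & [a Hq] & H).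
  exists (fun k => match k with O => c | S i => a i end); intros t.
  rewrite H, Hq, sum_n_first; f_equal; [simpl; ring|].
  rewrite <- (sum_n_mult_l (K := R_Ring)); apply sum_n_ext; intros k.
  to_R; simpl; ring.
Qed.

Lemma polynomial_le_0 (p : R -> R) :
  polynomial_le 0 p <-> exists c, forall t, p t = c.
Proof.
split.
- intros [a H]; exists (a O); intros t; rewrite H, sum_O; simpl; ring.
- intros [c H]; exists (fun _ => c); intros t; rewrite H, sum_O; simpl; ring.
Qed.

Lemma polynomial_le_S (d : nat) (p : R -> R) :
  polynomial_le d p -> polynomial_le (S d) p.
Proof.
revert p; induction d as [|d IH]; intros p H; apply polynomial_le_horner.
- apply polynomial_le_0 in H; destruct H as [c H]; exists c, (fun _ => 0); split.
  + apply polynomial_le_0; exists 0; reflexivity.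
  + intros t; rewrite H; ring.
- apply polynomial_le_horner in H; destruct H as (c & q & Hq & H).
  exists c, q; auto.
Qed.

Lemma polynomial_le_weaken (d e : nat) (p : R -> R) :
  (d <= e)%nat -> polynomial_le d p -> polynomial_le e p.
Proof. induction 1; auto using polynomial_le_S. Qed.

Lemma polynomial_le_const (d : nat) (c : R) : polynomial_le d (fun _ => c).
Proof.
apply polynomial_le_weaken with O; [lia|].
apply polynomial_le_0; exists c; reflexivity.
Qed.

Lemma polynomial_le_lin (d : nat) (p q : R -> R) (c : R) :
  polynomial_le d p -> polynomial_le d q -> polynomial_le d (fun t => p t + c * q t).
Proof.
intros [a Ha] [b Hb]; exists (fun k => a k + c * b k); intros t; rewrite Ha, Hb.
rewrite <- (sum_n_mult_l (K := R_Ring)).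
to_R.
rewrite <- (sum_n_plus (G := R_AbelianMonoid)).
apply sum_n_ext; intros k; to_R; ring.
Qed.

Lemma polynomial_le_mulX (d : nat) (p : R -> R) :
  polynomial_le d p -> polynomial_le (S d) (fun t => t * p t).
Proof.
intros H; apply polynomial_le_horner; exists 0, p; split; [assumption|].
intros t; ring.
Qed.

Lemma polynomial_le_mul (d e : nat) (p q : R -> R) :
  polynomial_le d p -> polynomial_le e q -> polynomial_le (d + e) (fun t => p t * q t).
Proof.
revert p; induction d as [|d IH]; intros p Hp Hq.
- apply polynomial_le_0 in Hp; destruct Hp as [c Hp].
  apply (polynomial_le_ext _ (fun t => 0 + c * q t)); [intros t; rewrite Hp; ring|].
  apply polynomial_le_lin; [apply polynomial_le_const|exact Hq].
- apply polynomial_le_horner in Hp; destruct Hp as (c & p1 & Hp1 & Hp).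
  apply (polynomial_le_ext _ (fun t => t * (p1 t * q t) + c * q t));
    [intros t; rewrite Hp; ring|].
  apply polynomial_le_lin; [apply polynomial_le_mulX, IH; assumption|].
  apply polynomial_le_weaken with e; [lia|assumption].
Qed.

Lemma polynomial_le_derive (d : nat) (p : R -> R) : polynomial_le d p ->
  exists p', polynomial_le d p' /\ forall t, is_derive p t (p' t).
Proof.
revert p; induction d as [|d IH]; intros p Hp.
- apply polynomial_le_0 in Hp; destruct Hp as [c Hp].
  exists (fun _ => 0); split; [apply polynomial_le_const|].
  intros t; apply is_derive_ext with (fun _ => c); [intros; symmetry; apply Hp|].
  apply (is_derive_const (K := R_AbsRing) (V := R_NormedModule)).
- apply polynomial_le_horner in Hp; destruct Hp as (c & q & Hq & Hp).
  destruct (IH q Hq) as (q' & Hq' & Dq).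
  exists (fun t => t * q' t + 1 * q t); split.
  + apply polynomial_le_lin; [apply polynomial_le_mulX, Hq'|apply polynomial_le_S, Hq].
  + intros t; apply is_derive_ext with (fun t => c + t * q t);
      [intros; symmetry; apply Hp|].
    specialize (Dq t); auto_derive; [exists (q' t); exact Dq|].
    replace (Derive (fun t => q t) t) with (q' t)
      by (symmetry; apply is_derive_unique, Dq); ring.
Qed.

Lemma polynomial_le_Derive_n (d i : nat) (p : R -> R) :
  polynomial_le d p -> polynomial_le d (Derive_n p i).
Proof.
intros Hp; induction i as [|i IH]; [exact Hp|].
destruct (polynomial_le_derive d _ IH) as (p' & Hp' & D).
apply (polynomial_le_ext _ p'); [|exact Hp'].
intros t; symmetry; apply is_derive_unique, D.
Qed.

Lemma polynomial_le_ex_derive (d : nat) (p : R -> R) (t : R) :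
  polynomial_le d p -> ex_derive p t.
Proof.
intros Hp; destruct (polynomial_le_derive d p Hp) as (p' & _ & D).
exists (p' t); apply D.
Qed.

Lemma polynomial_le_ex_derive_n (d i : nat) (p : R -> R) (t : R) :
  polynomial_le d p -> ex_derive_n p i t.
Proof.
intros Hp; destruct i as [|i]; [exact I|].
apply (polynomial_le_ex_derive d), polynomial_le_Derive_n, Hp.
Qed.

Lemma polynomial_le_continuous (d : nat) (p : R -> R) (t : R) :
  polynomial_le d p -> continuous p t.
Proof.
intros Hp; apply (ex_derive_continuous (K := R_AbsRing) (V := R_NormedModule)).
apply (polynomial_le_ex_derive d), Hp.
Qed.

Definition is_poly (p : R -> R) : Prop := exists d, polynomial_le d p.

Lemma is_poly_lin (p q : R -> R) (c : R) :
  is_poly p -> is_poly q -> is_poly (fun t => p t + c * q t).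
Proof.
intros [d Hp] [e Hq]; exists (d + e)%nat.
apply polynomial_le_lin;
  [apply polynomial_le_weaken with d|apply polynomial_le_weaken with e];
  assumption || lia.
Qed.

Lemma is_poly_mul (p q : R -> R) :
  is_poly p -> is_poly q -> is_poly (fun t => p t * q t).
Proof. intros [d Hp] [e Hq]; exists (d + e)%nat; apply polynomial_le_mul; assumption. Qed.

Lemma is_poly_ext (p q : R -> R) :
  (forall t, p t = q t) -> is_poly p -> is_poly q.
Proof. intros E [d H]; exists d; apply (polynomial_le_ext d p); assumption. Qed.

Lemma polynomial_le_factor (d : nat) (p : R -> R) (x : R) : polynomial_le (S d) p ->
  exists q, polynomial_le d q /\ forall t, p t = p x + (t - x) * q t.
Proof.
revert p; induction d as [|d IH]; intros p Hp;
  apply polynomial_le_horner in Hp; destruct Hp as (c & q1 & Hq1 & Hp).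
- exists q1; split; [assumption|].
  apply polynomial_le_0 in Hq1; destruct Hq1 as [c1 Hq1].
  intros t; rewrite !Hp, !Hq1; ring.
- destruct (IH q1 Hq1) as (q2 & Hq2 & E).
  exists (fun t => q1 t + x * q2 t); split.
  + apply polynomial_le_lin; [assumption|apply polynomial_le_S; assumption].
  + intros t; rewrite !Hp.
    replace (t * q1 t) with (x * q1 t + (t - x) * q1 t) by ring.
    rewrite (E t) at 1; ring.
Qed.

Lemma Derive_n_mul_linear (q : R -> R) (x y : R) (j : nat) : is_poly q ->
  Derive_n (fun t => (t - x) * q t) (S j) y =
  (y - x) * Derive_n q (S j) y + INR (S j) * Derive_n q j y.
Proof.
intros [d Hq]; revert y; induction j as [|j IH]; intros y.
- simpl Derive_n; apply is_derive_unique.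
  auto_derive; [apply (polynomial_le_ex_derive d), Hq|simpl; ring].
- change (Derive_n (fun t => (t - x) * q t) (S (S j)) y)
    with (Derive (Derive_n (fun t => (t - x) * q t) (S j)) y).
  rewrite (Derive_ext _ _ _ IH); apply is_derive_unique.
  assert (D : forall i, is_derive (Derive_n q i) y (Derive_n q (S i) y)).
  { intros i; apply Derive_correct, (polynomial_le_ex_derive d).
    apply polynomial_le_Derive_n, Hq. }
  assert (D1 := D (S j)); assert (D0 := D j).
  set (g1 := Derive_n q (S j)) in *; set (g0 := Derive_n q j) in *.
  set (n := INR (S j)); rewrite (S_INR (S j)); fold n.
  auto_derive; [split; [eexists; exact D1|split; [eexists; exact D0|exact I]]|].
  replace (Derive (fun t => g1 t) y) with (Derive_n q (S (S j)) y)
    by (symmetry; apply is_derive_unique, D1).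
  replace (Derive (fun t => g0 t) y) with (g1 y)
    by (symmetry; apply is_derive_unique, D0).
  ring.
Qed.

(** * Zeros with multiplicity, linear functionals and Hermite interpolation *)

Definition vanishes (m : nat) (p : R -> R) (x : R) : Prop :=
  forall j, (j < m)%nat -> Derive_n p j x = 0.

Lemma vanishes_ext (m : nat) (p q : R -> R) (x : R) :
  (forall t, p t = q t) -> vanishes m p x -> vanishes m q x.
Proof. intros E H j Hj; rewrite <- (Derive_n_ext p q j x E); auto. Qed.

Lemma vanishes_mul_linear (m : nat) (q : R -> R) (x : R) : is_poly q ->
  vanishes m q x -> vanishes (S m) (fun t => (t - x) * q t) x.
Proof.
intros Hq H [|j] Hj; [simpl; ring|].
rewrite Derive_n_mul_linear, (H j) by (assumption || lia); ring.
Qed.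

Lemma vanishes_div_same (m : nat) (q : R -> R) (x : R) : is_poly q ->
  vanishes (S m) (fun t => (t - x) * q t) x -> vanishes m q x.
Proof.
intros Hq H j Hj; specialize (H (S j) ltac:(lia)).
rewrite Derive_n_mul_linear in H by assumption.
apply Rmult_eq_reg_l with (INR (S j)); [lra|apply not_0_INR; lia].
Qed.

Lemma vanishes_div_other (m : nat) (q : R -> R) (x y : R) : is_poly q -> y <> x ->
  vanishes m (fun t => (t - x) * q t) y -> vanishes m q y.
Proof.
intros Hq Hxy H j Hj; induction j as [|j IH].
- specialize (H O Hj); simpl in H |- *.
  apply Rmult_integral in H; destruct H; [lra|assumption].
- specialize (H (S j) Hj); rewrite Derive_n_mul_linear, IH in H by (assumption || lia).
  rewrite Rmult_0_r, Rplus_0_r in H.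
  apply Rmult_integral in H; destruct H; [lra|assumption].
Qed.

(* [l] lists the zeros with multiplicity. *)
Lemma polynomial_many_zeros (l : list R) (d : nat) (p : R -> R) :
  polynomial_le d p -> (d < length l)%nat ->
  (forall y, vanishes (count_occ Req_dec_T l y) p y) -> forall t, p t = 0.
Proof.
revert d p; induction l as [|x l IH]; intros d p Hp Hd H; [simpl in Hd; lia|].
assert (Hx : p x = 0).
{ apply (H x O); simpl; destruct Req_dec_T; [lia|congruence]. }
destruct d as [|d].
- apply polynomial_le_0 in Hp; destruct Hp as [c Hc].
  intros t; rewrite Hc, <- (Hc x); exact Hx.
- destruct (polynomial_le_factor d p x Hp) as (q & Hq & E).
  assert (E' : forall t, p t = (t - x) * q t) by (intros t; rewrite E, Hx; ring).
  assert (Hq0 : forall t, q t = 0); [|intros t; rewrite E', Hq0; ring].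
  apply (IH d q Hq); [simpl in Hd; lia|].
  intros y; specialize (H y); apply (vanishes_ext _ _ _ _ E') in H.
  simpl in H; destruct Req_dec_T as [Hxy|Hxy].
  + subst y; apply vanishes_div_same in H; [exact H|exists d; exact Hq].
  + apply vanishes_div_other in H; [exact H|exists d; exact Hq|congruence].
Qed.

Definition node_list (m : nat) (xi : nat -> R) (n : nat) : list R :=
  flat_map (fun nu => repeat (xi nu) m) (seq 1 n).

Lemma node_list_S (m : nat) (xi : nat -> R) (n : nat) :
  node_list m xi (S n) = node_list m xi n ++ repeat (xi (S n)) m.
Proof.
unfold node_list; rewrite seq_S, flat_map_app; simpl; rewrite app_nil_r; reflexivity.
Qed.

Lemma node_list_length (m : nat) (xi : nat -> R) (n : nat) :
  length (node_list m xi n) = (m * n)%nat.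
Proof.
induction n as [|n IH]; [simpl; lia|].
rewrite node_list_S, length_app, IH, repeat_length; lia.
Qed.

Lemma node_list_count (m : nat) (xi : nat -> R) (n : nat) (y : R) :
  (forall mu nu, (1 <= mu <= n)%nat -> (1 <= nu <= n)%nat -> xi mu = xi nu -> mu = nu) ->
  let c := count_occ Req_dec_T (node_list m xi n) y in
  (c <= m)%nat /\ ((0 < c)%nat -> exists nu, (1 <= nu <= n)%nat /\ y = xi nu).
Proof.
intros Hinj; cbv zeta; induction n as [|n IH]; [simpl; split; lia|].
rewrite node_list_S, count_occ_app.
destruct IH as [IH1 IH2]; [intros; apply Hinj; auto; lia|].
destruct (Req_dec_T (xi (S n)) y) as [<-|Hy].
- rewrite count_occ_repeat_eq by reflexivity.
  assert (count_occ Req_dec_T (node_list m xi n) (xi (S n)) = 0)%nat as ->.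
  { destruct (count_occ Req_dec_T (node_list m xi n) (xi (S n))); [reflexivity|].
    destruct IH2 as (nu & Hnu & E); [lia|].
    apply Hinj in E; lia. }
  split; [lia|]; intros _; exists (S n); split; [lia|reflexivity].
- rewrite count_occ_repeat_neq by congruence; split; [lia|].
  intros Hc; destruct IH2 as (nu & Hnu & E); [lia|exists nu; split; [lia|exact E]].
Qed.

(** Linearity is asked on polynomials only: on arbitrary functions, integrals and derivatives may
    take default values and fail to be linear. *)
Definition poly_linear (L : (R -> R) -> R) : Prop :=
  forall p q c, is_poly p -> is_poly q ->
    L (fun t => p t + c * q t) = L p + c * L q.

Lemma poly_linear_0 (L : (R -> R) -> R) : poly_linear L -> L (fun _ => 0) = 0.
Proof.
intros HL; assert (H0 : is_poly (fun _ => 0)) by (exists O; apply polynomial_le_const).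
specialize (HL _ _ 1 H0 H0).
cbv beta in HL; replace (0 + 1 * 0) with 0 in HL by ring; lra.
Qed.

Lemma polynomial_le_sum_n_m (d m N : nat) (c : nat -> R) (u : nat -> R -> R) :
  (forall k, (m <= k <= N)%nat -> polynomial_le d (u k)) ->
  polynomial_le d (fun t => sum_n_m (fun k => c k * u k t) m N).
Proof.
intros H; induction N as [|N IH].
- destruct m as [|m].
  + apply (polynomial_le_ext d (fun t => 0 + c O * u O t)).
    { intros t; rewrite sum_n_n; ring. }
    apply polynomial_le_lin; [apply polynomial_le_const|apply H; lia].
  + apply (polynomial_le_ext d (fun _ => 0)); [|apply polynomial_le_const].
    intros t; rewrite sum_n_m_zero by lia; reflexivity.
- destruct (Nat.le_gt_cases m (S N)) as [Hm|Hm].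
  + apply (polynomial_le_ext d (fun t => sum_n_m (fun k => c k * u k t) m N + c (S N) * u (S N) t)).
    { intros t; rewrite sum_n_Sm by lia; reflexivity. }
    apply polynomial_le_lin; [apply IH; intros; apply H; lia|apply H; lia].
  + apply (polynomial_le_ext d (fun _ => 0)); [|apply polynomial_le_const].
    intros t; rewrite sum_n_m_zero by lia; reflexivity.
Qed.

Lemma poly_linear_sum_n_m (L : (R -> R) -> R) (d m N : nat) (c : nat -> R)
    (u : nat -> R -> R) : poly_linear L ->
  (forall k, (m <= k <= N)%nat -> polynomial_le d (u k)) ->
  L (fun t => sum_n_m (fun k => c k * u k t) m N) =
  sum_n_m (fun k => c k * L (u k)) m N.
Proof.
intros HL H.
assert (Hz : forall n, (n < m)%nat -> L (fun t => sum_n_m (fun k => c k * u k t) m n) =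
  sum_n_m (fun k => c k * L (u k)) m n).
{ intros n Hn; rewrite sum_n_m_zero by assumption.
  rewrite <- (poly_linear_0 L HL : _ = zero); f_equal.
  apply functional_extensionality; intros t; apply (sum_n_m_zero (G := R_AbelianMonoid)), Hn. }
induction N as [|N IH].
- destruct m as [|m]; [|apply Hz; lia].
  rewrite sum_n_n, <- (Rplus_0_l (c O * _)), <- (poly_linear_0 L HL).
  rewrite <- HL.
  + f_equal; apply functional_extensionality; intros t; rewrite sum_n_n; to_R; ring.
  + exists O; apply polynomial_le_const.
  + exists d; apply H; lia.
- destruct (Nat.le_gt_cases m (S N)) as [Hm|Hm]; [|apply Hz; lia].
  rewrite sum_n_Sm by lia; rewrite <- IH by (intros; apply H; lia).
  to_R; rewrite <- HL.
  + f_equal; apply functional_extensionality; intros t; rewrite sum_n_Sm by lia; reflexivity.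
  + exists d; apply polynomial_le_sum_n_m; intros; apply H; lia.
  + exists d; apply H; lia.
Qed.

Lemma poly_linear_Derive_n (j : nat) (x : R) : poly_linear (fun p => Derive_n p j x).
Proof.
intros p q c [d Hp] [e Hq].
rewrite <- (Derive_n_scal_l q j c x); apply Derive_n_plus; apply filter_forall;
  intros t k _.
- apply (polynomial_le_ex_derive_n d), Hp.
- apply (polynomial_le_ex_derive_n e).
  apply (polynomial_le_ext e (fun t => 0 + c * q t)); [intros; ring|].
  apply polynomial_le_lin; [apply polynomial_le_const|exact Hq].
Qed.

Lemma sum_n_m_single (u : nat -> R) (m N i : nat) : (m <= i <= N)%nat ->
  (forall k, (m <= k <= N)%nat -> k <> i -> u k = 0) -> sum_n_m u m N = u i.
Proof.
intros Hi H.
rewrite (sum_n_m_ext_loc u (fun k => if Nat.eqb k i then u i else 0)).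
2:{ intros k Hk; destruct (Nat.eqb_spec k i) as [->|Hne]; [reflexivity|apply H; assumption]. }
clear H; induction N as [|N IH].
- replace m with O by lia; rewrite sum_n_n; replace i with O by lia; reflexivity.
- rewrite sum_n_Sm by lia; to_R.
  destruct (Nat.eqb_spec (S N) i) as [<-|Hne].
  + rewrite (sum_n_m_ext_loc _ (fun _ => 0)).
    2:{ intros k Hk; destruct (Nat.eqb_spec k (S N)); [lia|reflexivity]. }
    rewrite sum_n_m_const; ring.
  + rewrite IH by lia; ring.
Qed.

Section Hermite.
Variables (n s : nat) (xi : nat -> R) (l : nat -> nat -> R -> R).
Hypotheses (n_gt0 : (1 <= n)%nat) (s_gt0 : (1 <= s)%nat).
Hypothesis inj : forall mu nu, (1 <= mu <= n)%nat -> (1 <= nu <= n)%nat ->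
     xi mu = xi nu -> mu = nu.
Hypothesis fund : hermite_fundamental n s xi l.

(** The difference of the two sides has degree at most [2sn - 1], yet a zero of order [2s] at each
    of [n] distinct nodes. *)
Lemma hermite_interpolation (p : R -> R) : polynomial_le (2 * s * n - 1) p ->
  forall t, p t = sum_n_m (fun nu => sum_n_m (fun i =>
    Derive_n p i (xi nu) * l i nu t) 0 (2 * s - 1)) 1 n.
Proof.
intros Hp.
set (d := (2 * s * n - 1)%nat) in *.
set (u := fun nu t => sum_n_m (fun i => Derive_n p i (xi nu) * l i nu t) 0 (2 * s - 1)).
assert (Hu : forall nu, (1 <= nu <= n)%nat -> polynomial_le d (u nu)).
{ intros nu Hnu; apply polynomial_le_sum_n_m; intros i Hi; apply fund; lia. }
assert (HU : polynomial_le d (fun t => sum_n_m (fun nu => 1 * u nu t) 1 n)).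
{ apply polynomial_le_sum_n_m; exact Hu. }
assert (H0 : forall t, p t + (-1) * sum_n_m (fun nu => 1 * u nu t) 1 n = 0).
{ apply (polynomial_many_zeros (node_list (2 * s) xi n) d).
  - apply polynomial_le_lin; assumption.
  - rewrite node_list_length; unfold d; nia.
  - intros y j Hj.
    destruct (node_list_count (2 * s) xi n y inj) as [Hc Hy].
    destruct Hy as (mu & Hmu & ->); [lia|].
    rewrite (poly_linear_Derive_n j (xi mu)) by (exists d; assumption).
    rewrite (poly_linear_sum_n_m (fun p => Derive_n p j (xi mu)) d)
      by (apply poly_linear_Derive_n || exact Hu).
    rewrite (sum_n_m_single _ 1 n mu Hmu).
    + unfold u.
      rewrite (poly_linear_sum_n_m (fun p => Derive_n p j (xi mu)) d).
      2: apply poly_linear_Derive_n.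
      2:{ intros i Hi; apply fund; lia. }
      rewrite (sum_n_m_single _ 0 (2 * s - 1) j) by
        (lia || (intros i Hi Hne; rewrite (proj2 (fund i mu ltac:(lia) Hmu)) by lia;
                 destruct (Nat.eqb_spec j i); [lia|simpl; ring])).
      rewrite (proj2 (fund j mu ltac:(lia) Hmu)) by lia.
      rewrite !Nat.eqb_refl; simpl; ring.
    + intros nu Hnu Hne; unfold u.
      rewrite (poly_linear_sum_n_m (fun p => Derive_n p j (xi mu)) d).
      2: apply poly_linear_Derive_n.
      2:{ intros i Hi; apply fund; lia. }
      rewrite (sum_n_m_ext_loc _ (fun _ => 0)).
      * rewrite sum_n_m_const; ring.
      * intros i Hi; rewrite (proj2 (fund i nu ltac:(lia) Hnu)) by lia.
        destruct (Nat.eqb_spec mu nu); [congruence|].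
        rewrite Bool.andb_false_r; to_R; ring. }
intros t; specialize (H0 t).
rewrite (sum_n_m_ext (fun nu => 1 * u nu t) (fun nu => u nu t)) in H0
  by (intros; apply Rmult_1_l).
unfold u in H0; lra.
Qed.

(** For [L = cheb_integral n] this says that the quadrature formula is exact below degree [2sn]. *)
Lemma hermite_exact (L : (R -> R) -> R) (p : R -> R) : poly_linear L ->
  polynomial_le (2 * s * n - 1) p ->
  L p = sum_n_m (fun nu => sum_n_m (fun i =>
    L (l i nu) * Derive_n p i (xi nu)) 0 (2 * s - 1)) 1 n.
Proof.
intros HL Hp.
set (d := (2 * s * n - 1)%nat) in *.
set (u := fun nu t => sum_n_m (fun i => Derive_n p i (xi nu) * l i nu t) 0 (2 * s - 1)).
assert (Hu : forall nu, (1 <= nu <= n)%nat -> polynomial_le d (u nu)).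
{ intros nu Hnu; apply polynomial_le_sum_n_m; intros i Hi; apply fund; lia. }
replace (L p) with (L (fun t => sum_n_m (fun nu => 1 * u nu t) 1 n)).
- rewrite (poly_linear_sum_n_m L d) by assumption.
  apply sum_n_m_ext_loc; intros nu Hnu; unfold u; rewrite Rmult_1_l.
  rewrite (poly_linear_sum_n_m L d); [|exact HL|intros i Hi; apply fund; lia].
  apply sum_n_m_ext; intros i; apply Rmult_comm.
- f_equal; apply functional_extensionality; intros t.
  rewrite (hermite_interpolation p Hp t).
  apply sum_n_m_ext; intros nu; apply Rmult_1_l.
Qed.

End Hermite.

(** * Chebyshev polynomials: products, zeros and derivatives *)

Lemma chebyshev_SS (k : nat) (x : R) :
  chebyshev (S (S k)) x = 2 * x * chebyshev (S k) x - chebyshev k x.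
Proof. reflexivity. Qed.

Lemma two_step_ind (P : nat -> Prop) :
  P O -> P 1%nat -> (forall k, P k -> P (S k) -> P (S (S k))) -> forall k, P k.
Proof.
intros H0 H1 HS k; enough (P k /\ P (S k)) by tauto.
induction k as [|k [IH1 IH2]]; auto.
Qed.

Lemma polynomial_le_chebyshev (k : nat) : polynomial_le k (chebyshev k).
Proof.
induction k as [| |k IH1 IH2] using two_step_ind.
- apply polynomial_le_const.
- apply (polynomial_le_ext 1 (fun t => t * 1)); [intros; simpl; ring|].
  apply polynomial_le_mulX, polynomial_le_const.
- apply (polynomial_le_ext _ (fun t => (-1) * chebyshev k t + 2 * (t * chebyshev (S k) t))).
  { intros t; rewrite chebyshev_SS; ring. }
  apply polynomial_le_lin; [|apply polynomial_le_mulX, IH2].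
  apply (polynomial_le_ext _ (fun t => 0 + (-1) * chebyshev k t)); [intros; ring|].
  apply polynomial_le_lin; [apply polynomial_le_const|].
  apply polynomial_le_weaken with k; [lia|exact IH1].
Qed.

(** The convention [T_(-k) = T_k], in accordance with [cos (k theta)], makes the three-term
    recurrence hold over all of Z, so that shifts of the index never leave the family. *)
Definition zchebyshev (k : Z) : R -> R := chebyshev (Z.abs_nat k).

Lemma is_poly_zchebyshev (k : Z) : is_poly (zchebyshev k).
Proof. exists (Z.abs_nat k); apply polynomial_le_chebyshev. Qed.

Lemma zchebyshev_recurrence (k : Z) (x : R) :
  zchebyshev (k + 1) x + zchebyshev (k - 1) x = 2 * x * zchebyshev k x.
Proof.
assert (Hnat : forall j : nat, zchebyshev (Z.of_nat j + 1) x +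
   zchebyshev (Z.of_nat j - 1) x = 2 * x * zchebyshev (Z.of_nat j) x).
{ intros j; unfold zchebyshev; destruct j as [|j]; [simpl; ring|].
  replace (Z.abs_nat (Z.of_nat (S j) + 1)) with (S (S j)) by lia.
  replace (Z.abs_nat (Z.of_nat (S j) - 1)) with j by lia.
  replace (Z.abs_nat (Z.of_nat (S j))) with (S j) by lia.
  rewrite chebyshev_SS; ring. }
assert (Hopp : forall j, zchebyshev (- j) x = zchebyshev j x).
{ intros j; unfold zchebyshev; f_equal; lia. }
destruct (Z_le_gt_dec 0 k) as [Hk|Hk].
- rewrite <- (Z2Nat.id k) by assumption; apply Hnat.
- rewrite <- (Hopp (k + 1)%Z), <- (Hopp (k - 1)%Z), <- (Hopp k).
  assert (E := Hnat (Z.to_nat (- k))); rewrite Z2Nat.id in E by lia.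
  rewrite <- E, Rplus_comm; f_equal; f_equal; lia.
Qed.

(** The formula [2 cos a cos b = cos (a + b) + cos (a - b)]. Induction on [n] gives it for every
    real [x], as an identity of polynomials. *)
Lemma zchebyshev_product (n : nat) (k : Z) (x : R) :
  shift_sum n (fun j => zchebyshev j x) k = 2 * chebyshev n x * zchebyshev k x.
Proof.
unfold shift_sum; revert k; induction n as [| |n IH1 IH2] using two_step_ind; intros k.
- rewrite Z.add_0_r, Z.sub_0_r; simpl; ring.
- apply zchebyshev_recurrence.
- rewrite chebyshev_SS.
  assert (A := zchebyshev_recurrence (k + Z.of_nat (S n)) x).
  assert (B := zchebyshev_recurrence (k - Z.of_nat (S n)) x).
  replace (k + Z.of_nat (S n) + 1)%Z with (k + Z.of_nat (S (S n)))%Z in A by lia.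
  replace (k + Z.of_nat (S n) - 1)%Z with (k + Z.of_nat n)%Z in A by lia.
  replace (k - Z.of_nat (S n) + 1)%Z with (k - Z.of_nat n)%Z in B by lia.
  replace (k - Z.of_nat (S n) - 1)%Z with (k - Z.of_nat (S (S n)))%Z in B by lia.
  specialize (IH1 k); specialize (IH2 k).
  transitivity (2 * x * (2 * chebyshev (S n) x * zchebyshev k x) -
    2 * chebyshev n x * zchebyshev k x); [|ring].
  rewrite <- IH1, <- IH2; lra.
Qed.

Lemma is_poly_pow_mul (p q : R -> R) (m : nat) :
  is_poly p -> is_poly q -> is_poly (fun t => p t ^ m * q t).
Proof.
intros Hp Hq; induction m as [|m IH].
- apply (is_poly_ext q); [intros; simpl; ring|exact Hq].
- apply (is_poly_ext (fun t => p t * (p t ^ m * q t))); [intros; simpl; ring|].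
  apply is_poly_mul; assumption.
Qed.

Lemma is_poly_scal (c : R) (p : R -> R) : is_poly p -> is_poly (fun t => c * p t).
Proof.
intros Hp; apply (is_poly_ext (fun t => 0 + c * p t)); [intros; ring|].
apply is_poly_lin; [exists O; apply polynomial_le_const|exact Hp].
Qed.

(** By [zchebyshev_product], a factor [2 T_n] under [L] amounts to one [shift_sum] on the sequence
    of values [L (T_j)]. *)
Lemma poly_linear_iter (L : (R -> R) -> R) (n m : nat) (k : Z) : poly_linear L ->
  L (fun x => (2 * chebyshev n x) ^ m * zchebyshev k x) =
  Nat.iter m (shift_sum n) (fun j => L (zchebyshev j)) k.
Proof.
intros HL; revert k; induction m as [|m IH]; intros k.
- simpl; f_equal; apply functional_extensionality; intros; ring.
- rewrite Nat.iter_succ; unfold shift_sum at 1; rewrite <- !IH.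
  rewrite <- (Rmult_1_l (L (fun x => _ * zchebyshev (k - _) x))), <- HL.
  + f_equal; apply functional_extensionality; intros x.
    rewrite Rmult_1_l, <- Rmult_plus_distr_l.
    change (zchebyshev (k + Z.of_nat n) x + zchebyshev (k - Z.of_nat n) x)
      with (shift_sum n (fun j => zchebyshev j x) k).
    rewrite zchebyshev_product; simpl; ring.
  + apply is_poly_pow_mul; [|apply is_poly_zchebyshev].
    apply is_poly_scal; exists n; apply polynomial_le_chebyshev.
  + apply is_poly_pow_mul; [|apply is_poly_zchebyshev].
    apply is_poly_scal; exists n; apply polynomial_le_chebyshev.
Qed.

(** The factor [h] is arbitrary so that it can absorb the cofactor [q] each time a linear factor is
    extracted from [p]. *)
Lemma vanishes_pow_mul (p h : R -> R) (m : nat) (x : R) : is_poly p -> is_poly h ->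
  p x = 0 -> vanishes m (fun t => p t ^ m * h t) x.
Proof.
intros [d Hp] Hh Hx.
destruct (polynomial_le_factor d p x (polynomial_le_S d p Hp)) as (q & Hq & E).
assert (Pq : is_poly q) by (exists d; exact Hq).
revert h Hh; induction m as [|m IH]; intros h Hh; [intros j Hj; lia|].
apply (vanishes_ext _ (fun t => (t - x) * (p t ^ m * (q t * h t)))).
- intros t; simpl; rewrite (E t) at 2; rewrite Hx; ring.
- apply vanishes_mul_linear.
  + apply is_poly_pow_mul; [exists d; exact Hp|apply is_poly_mul; assumption].
  + apply IH, is_poly_mul; assumption.
Qed.

(** The Chebyshev polynomials of the second kind, [U_n]; they enter through
    [T_(n+1)' = (n + 1) U_n]. *)
Fixpoint chebyshev2 (n : nat) (x : R) : R :=
  match n with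
  | O => 1
  | S m => match m with
           | O => 2 * x
           | S k => 2 * x * chebyshev2 m x - chebyshev2 k x
           end
  end.

Lemma chebyshev2_SS (k : nat) (x : R) :
  chebyshev2 (S (S k)) x = 2 * x * chebyshev2 (S k) x - chebyshev2 k x.
Proof. reflexivity. Qed.

(** Expresses [U] as a sum of polynomials [T], which turns a bound on derivatives of [T] into one on
    derivatives of [U]. *)
Lemma chebyshev2_diff (k : nat) (x : R) :
  chebyshev2 (S (S k)) x = chebyshev2 k x + 2 * chebyshev (S (S k)) x.
Proof.
induction k as [| |k IH1 IH2] using two_step_ind; [simpl; ring|simpl; ring|].
rewrite (chebyshev2_SS (S (S k))), IH1, IH2, (chebyshev_SS (S (S k))).
rewrite (chebyshev2_SS k) in IH1.
replace (2 * x * (chebyshev2 (S k) x + 2 * chebyshev (S (S (S k))) x)) with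
  (2 * x * chebyshev2 (S k) x + 2 * (2 * x * chebyshev (S (S (S k))) x)) by ring.
lra.
Qed.

Lemma is_derive_chebyshev (k : nat) (x : R) :
  is_derive (chebyshev (S k)) x (INR (S k) * chebyshev2 k x).
Proof.
induction k as [| |k IH1 IH2] using two_step_ind.
- simpl chebyshev; auto_derive; [exact I|simpl; ring].
- simpl chebyshev; auto_derive; [exact I|simpl; ring].
- apply (is_derive_ext (fun x => 2 * x * chebyshev (S (S k)) x - chebyshev (S k) x));
    [intros; symmetry; apply chebyshev_SS|].
  set (f := chebyshev (S (S k))) in *; set (g := chebyshev (S k)) in *.
  auto_derive; [split; [eexists; exact IH2|split; [eexists; exact IH1|exact I]]|].
  replace (Derive (fun x => f x) x) with (INR (S (S k)) * chebyshev2 (S k) x)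
    by (symmetry; apply is_derive_unique, IH2).
  replace (Derive (fun x => g x) x) with (INR (S k) * chebyshev2 k x)
    by (symmetry; apply is_derive_unique, IH1).
  assert (E := chebyshev2_diff k x); rewrite chebyshev2_SS in E |- *.
  unfold f; rewrite !S_INR.
  set (a := chebyshev2 (S k) x) in *; set (b := chebyshev2 k x) in *.
  set (c := chebyshev (S (S k)) x) in *.
  transitivity (2 * c + (INR k + 1 + 1) * (2 * x * a) - (INR k + 1) * b); [ring|].
  transitivity ((2 * x * a - b) + (INR k + 1 + 1) * (2 * x * a - b)); [|ring].
  rewrite E at 1; ring.
Qed.

Lemma chebyshev_bound (k : nat) (x : R) : -1 <= x <= 1 -> Rabs (chebyshev k x) <= 1.
Proof.
intros Hx; rewrite <- (cos_acos x Hx), chebyshev_cos; apply Rabs_le, COS_bound.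
Qed.

(* A crude form of Markov's inequality. *)
Lemma chebyshev_Derive_n_bound (i k : nat) (x : R) : -1 <= x <= 1 ->
  Rabs (Derive_n (chebyshev k) i x) <= 2 ^ i * (INR k + 1) ^ (2 * i).
Proof.
intros Hx; revert k; induction i as [|i IH]; intros k.
- simpl; rewrite Rmult_1_l; apply chebyshev_bound, Hx.
- destruct k as [|k].
  + replace (chebyshev 0) with (fun _ : R => 1) by reflexivity.
    rewrite Derive_n_const, Rabs_R0.
    apply Rmult_le_pos; apply pow_le; simpl; lra.
  + assert (E : Derive_n (chebyshev (S k)) (S i) x =
       INR (S k) * Derive_n (chebyshev2 k) i x).
    { replace (S i) with (i + 1)%nat by lia.
      rewrite <- Derive_n_comp, <- Derive_n_scal_l.
      apply Derive_n_ext; intros t; simpl Derive_n.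
      apply is_derive_unique, is_derive_chebyshev. }
    (* [U_j] is a sum of at most [j + 1] polynomials [T_m], [m <= j], with coefficients 1 or 2. With
       the factor [INR (S k)] of [E], one differentiation thus costs at most [2 (k + 1)^2]. *)
    assert (H2 : forall j, Rabs (Derive_n (chebyshev2 j) i x) <=
       2 * (INR j + 1) * (2 ^ i * (INR j + 1) ^ (2 * i))).
    { intros j; induction j as [| |j IH1 IH2] using two_step_ind.
      - specialize (IH O).
        replace (chebyshev2 0) with (chebyshev 0) by reflexivity.
        eapply Rle_trans; [exact IH|simpl INR; rewrite Rplus_0_l, pow1].
        assert (0 < 2 ^ i) by (apply pow_lt; lra); lra.
      - specialize (IH 1%nat).
        replace (chebyshev2 1) with (fun x => 2 * chebyshev 1 x) by reflexivity.
        rewrite Derive_n_scal_l, Rabs_mult, (Rabs_pos_eq 2) by lra.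
        simpl INR in *; set (K := 2 ^ i * _) in *.
        assert (0 <= Rabs (Derive_n (chebyshev 1) i x)) by apply Rabs_pos; lra.
      - assert (E2 : Derive_n (chebyshev2 (S (S j))) i x =
          Derive_n (chebyshev2 j) i x + 2 * Derive_n (chebyshev (S (S j))) i x).
        { assert (P2 : forall m, is_poly (chebyshev2 m)).
          { intros m; induction m as [| |m A1 A2] using two_step_ind.
            - exists O; apply polynomial_le_const.
            - exists 1%nat; apply (polynomial_le_ext _ (fun t => t * 2)); [intros; simpl; ring|].
              apply polynomial_le_mulX, polynomial_le_const.
            - apply (is_poly_ext (fun t => chebyshev2 m t + 2 * chebyshev (S (S m)) t)).
              + intros; symmetry; apply chebyshev2_diff.
              + apply is_poly_lin; [exact A1|eexists; apply polynomial_le_chebyshev]. }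
          rewrite <- (poly_linear_Derive_n i x) by
            (apply P2 || (eexists; apply polynomial_le_chebyshev)).
          apply Derive_n_ext, chebyshev2_diff. }
        rewrite E2; eapply Rle_trans; [apply Rabs_triang|].
        rewrite Rabs_mult, (Rabs_pos_eq 2) by lra.
        specialize (IH (S (S j))); rewrite !S_INR in *.
        assert (0 <= INR j) by apply pos_INR.
        assert (0 < 2 ^ i) by (apply pow_lt; lra).
        assert ((INR j + 1) ^ (2 * i) <= (INR j + 1 + 1 + 1) ^ (2 * i))
          by (apply pow_incr; lra).
        assert (0 <= (INR j + 1) ^ (2 * i)) by (apply pow_le; lra).
        set (A := (INR j + 1) ^ (2 * i)) in *.
        set (B := (INR j + 1 + 1 + 1) ^ (2 * i)) in *.
        assert (2 ^ i * A <= 2 ^ i * B) by (apply Rmult_le_compat_l; lra).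
        assert (0 <= 2 ^ i * B) by (apply Rmult_le_pos; lra).
        assert (2 * (INR j + 1) * (2 ^ i * A) <= 2 * (INR j + 1) * (2 ^ i * B))
          by (apply Rmult_le_compat_l; lra).
        lra. }
    rewrite E, Rabs_mult, (Rabs_pos_eq (INR (S k))) by apply pos_INR.
    rewrite S_INR.
    assert (0 <= INR k) by apply pos_INR.
    eapply Rle_trans; [apply Rmult_le_compat_l; [lra|apply H2]|].
    apply Rle_trans with (2 ^ S i * (INR k + 1) ^ (2 * S i)).
    * apply Req_le; replace (2 * S i)%nat with (S (S (2 * i))) by lia.
      rewrite <- !tech_pow_Rmult; ring.
    * apply Rmult_le_compat_l; [apply pow_le; lra|].
      apply pow_incr; lra.
Qed.

(** * Integrals against the Chebyshev weight *)

Lemma at_right_between (a b : R) : a < b -> at_right a (fun t => a < t < b).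
Proof.
intros Hab; exists (mkposreal (b - a) (proj2 (Rlt_0_minus _ _) Hab)); intros y Hy Hlt.
apply Rabs_lt_between' in Hy; simpl in Hy; split; [exact Hlt|lra].
Qed.

Lemma at_left_between (a b : R) : a < b -> at_left b (fun t => a < t < b).
Proof.
intros Hab; exists (mkposreal (b - a) (proj2 (Rlt_0_minus _ _) Hab)); intros y Hy Hlt.
apply Rabs_lt_between' in Hy; simpl in Hy; split; [lra|exact Hlt].
Qed.

Lemma acos_lt_of_cos (x t : R) : -1 <= t <= 1 -> 0 <= x <= PI -> cos x < t -> acos t < x.
Proof.
intros Ht Hx H; apply Rnot_le_lt; intros N; assert (B := acos_bound t).
apply Rle_lt_or_eq_dec in N; destruct N as [N| ->]; [|rewrite cos_acos in H; lra].
apply cos_decreasing_1 in N; try lra; rewrite cos_acos in N; lra.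
Qed.

Lemma acos_gt_of_cos (x t : R) : -1 <= t <= 1 -> 0 <= x <= PI -> t < cos x -> x < acos t.
Proof.
intros Ht Hx H; apply Rnot_le_lt; intros N; assert (B := acos_bound t).
apply Rle_lt_or_eq_dec in N; destruct N as [N|E]; [|rewrite <- E, cos_acos in H; lra].
apply cos_decreasing_1 in N; try lra; rewrite cos_acos in N; lra.
Qed.

Lemma filterlim_acos_left : filterlim acos (at_left 1) (locally 0).
Proof.
apply filterlim_locally; intros [eps Heps].
set (x := Rmin eps (PI / 2)).
assert (HPI := PI_RGT_0).
assert (Hx : 0 < x <= PI / 2 /\ x <= eps).
{ unfold x; split; [split; [apply Rmin_glb_lt; lra|apply Rmin_r]|apply Rmin_l]. }
assert (Hc : cos x < 1) by (rewrite <- cos_0; apply cos_decreasing_1; lra).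
assert (Hc' := COS_bound x).
apply filter_imp with (2 := at_left_between (cos x) 1 Hc); intros t Ht.
apply Rabs_lt_between'; simpl.
assert (acos t < x) by (apply acos_lt_of_cos; lra).
generalize (acos_bound t); lra.
Qed.

Lemma filterlim_acos_right : filterlim acos (at_right (-1)) (locally PI).
Proof.
apply filterlim_locally; intros [eps Heps].
set (x := Rmin eps (PI / 2)).
assert (HPI := PI_RGT_0).
assert (Hx : 0 < x <= PI / 2 /\ x <= eps).
{ unfold x; split; [split; [apply Rmin_glb_lt; lra|apply Rmin_r]|apply Rmin_l]. }
assert (Hc : -1 < cos (PI - x)) by (rewrite <- cos_PI; apply cos_decreasing_1; lra).
assert (Hc' := COS_bound (PI - x)).
apply filter_imp with (2 := at_right_between (-1) (cos (PI - x)) Hc); intros t Ht.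
apply Rabs_lt_between'; simpl.
assert (PI - x < acos t) by (apply acos_gt_of_cos; lra).
generalize (acos_bound t); lra.
Qed.

Lemma is_derive_acos (x : R) : -1 < x < 1 -> is_derive acos x (- / sqrt (1 - x ^ 2)).
Proof.
intros Hx; apply is_derive_Reals.
replace (- / sqrt (1 - x ^ 2)) with (derive_pt acos x (derivable_pt_acos x Hx)).
- apply derive_pt_eq_1 with (derivable_pt_acos x Hx); reflexivity.
- rewrite derive_pt_acos; replace (x ^ 2) with (x²) by (unfold Rsqr; ring).
  unfold Rdiv; ring.
Qed.

Lemma continuous_comp_cos {V : UniformSpace} (g : R -> V) :
  (forall t, -1 <= t <= 1 -> continuous g t) ->
  forall theta, continuous (fun x => g (cos x)) theta.
Proof.
intros Hg theta; apply continuous_comp; [apply continuous_cos|apply Hg, COS_bound].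
Qed.

(** The substitution [t = cos x] is made on [[a, b]] inside [(-1, 1)], where [acos] is
    differentiable. The result is a proper integral from [acos b] to [acos a], continuous in both
    bounds, which yields the improper one. The general [V] covers real and complex integrands. *)
Lemma is_RInt_gen_chebyshev_weight {V : CompleteNormedModule R_AbsRing} (g : R -> V) :
  (forall t, -1 <= t <= 1 -> continuous g t) ->
  is_RInt_gen (fun t => scal (/ sqrt (1 - t ^ 2)) (g t)) (at_right (-1)) (at_left 1)
    (RInt (fun x => g (cos x)) 0 PI).
Proof.
intros Hg.
assert (Hc := continuous_comp_cos g Hg).
assert (Hex : forall a b, ex_RInt (fun x => g (cos x)) a b).
{ intros a b; apply ex_RInt_continuous; intros; apply Hc. }
assert (HI : forall a b, -1 < a < 1 -> -1 < b < 1 ->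
  is_RInt (fun t => scal (/ sqrt (1 - t ^ 2)) (g t)) a b
    (RInt (fun x => g (cos x)) (acos b) (acos a))).
{ intros a b Ha Hb.
  assert (Hab : forall x, Rmin a b <= x <= Rmax a b -> -1 < x < 1).
  { intros x; unfold Rmin, Rmax; destruct Rle_dec; lra. }
  rewrite <- (opp_RInt_swap (V := V)) by apply Hex.
  apply is_RInt_ext with
    (fun t => opp (scal (- / sqrt (1 - t ^ 2)) (g (cos (acos t))))).
  - intros t Ht; rewrite cos_acos by (generalize (Hab t ltac:(lra)); lra).
    rewrite <- (opp_opp (scal (/ sqrt (1 - t ^ 2)) (g t))); f_equal.
    apply (scal_opp_l (K := R_Ring)).
  - refine (is_RInt_opp (V := V) _ _ _ _ _).
    apply (is_RInt_comp (fun x => g (cos x)) acos (fun t => - / sqrt (1 - t ^ 2)));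
      intros x Hx; [apply Hc|].
    apply Hab in Hx.
    split; [apply is_derive_acos, Hx|].
    assert (Hpos : 0 < 1 - x ^ 2) by nra.
    apply (ex_derive_continuous (K := R_AbsRing) (V := R_NormedModule)).
    auto_derive; simpl in Hpos |- *; split; [lra|split; [|exact I]].
    apply Rgt_not_eq, sqrt_lt_R0; lra. }
intros P HP.
assert (HF : filterlim (fun ab : R * R => (acos (snd ab), acos (fst ab)))
   (filter_prod (at_right (-1)) (at_left 1)) (locally (0, PI))).
{ apply filterlim_locally; intros eps.
  assert (H1 : filterlim (fun ab : R * R => acos (snd ab))
    (filter_prod (at_right (-1)) (at_left 1)) (locally 0)).
  { eapply filterlim_comp; [apply (filterlim_snd (F := at_right (-1)))|apply filterlim_acos_left]. }
  assert (H2 : filterlim (fun ab : R * R => acos (fst ab))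
    (filter_prod (at_right (-1)) (at_left 1)) (locally PI)).
  { eapply filterlim_comp; [apply (filterlim_fst (G := at_left 1))|apply filterlim_acos_right]. }
  apply (proj1 (filterlim_locally _ _)) with (eps := eps) in H1.
  apply (proj1 (filterlim_locally _ _)) with (eps := eps) in H2.
  generalize (filter_and _ _ H1 H2); apply filter_imp; intros ab Hab; exact Hab. }
assert (HC : continuous (fun z : R * R => RInt (fun x => g (cos x)) (fst z) (snd z)) (0, PI)).
{ apply (continuous_RInt (fun x => g (cos x)) 0 PI).
  apply filter_forall; intros z; apply RInt_correct, Hex. }
assert (HL := filterlim_comp _ _ _ _ _ _ _ _ HF HC P HP).
assert (HB : filter_prod (at_right (-1)) (at_left 1)
  (fun ab : R * R => -1 < fst ab < 1 /\ -1 < snd ab < 1)).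
{ apply Filter_prod with (1 := at_right_between (-1) 1 ltac:(lra))
    (2 := at_left_between (-1) 1 ltac:(lra)).
  intros; simpl; lra. }
unfold filtermapi; unfold filtermap in HL.
generalize (filter_and _ _ HL HB); apply filter_imp.
intros [a b] [H1 [H2 H3]]; simpl in *.
eexists; split; [apply HI; assumption|exact H1].
Qed.

Lemma RInt_gen_chebyshev_weight {V : CompleteNormedModule R_AbsRing} (f g : R -> V) :
  (forall t, -1 <= t <= 1 -> continuous g t) ->
  (forall t, -1 < t < 1 -> f t = scal (/ sqrt (1 - t ^ 2)) (g t)) ->
  RInt_gen f (at_right (-1)) (at_left 1) = RInt (fun x => g (cos x)) 0 PI.
Proof.
intros Hg Hf; apply is_RInt_gen_unique.
apply is_RInt_gen_ext with (fun t => scal (/ sqrt (1 - t ^ 2)) (g t)).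
- apply Filter_prod with (1 := at_right_between (-1) 1 ltac:(lra))
    (2 := at_left_between (-1) 1 ltac:(lra)).
  intros a b Ha Hb t Ht; symmetry; apply Hf.
  simpl in Ht; revert Ht; unfold Rmin, Rmax; destruct Rle_dec; lra.
- apply is_RInt_gen_chebyshev_weight, Hg.
Qed.

(** The integral of [g] against [dt / sqrt (1 - t^2)], in the variable [acos t] that removes the
    singularities. *)
Definition cos_integral (g : R -> R) : R := RInt (fun x => g (cos x)) 0 PI.

Definition cheb_integral (n : nat) (g : R -> R) : R :=
  cos_integral (fun t => chebyshev n t * g t).

Lemma ex_RInt_cos_comp (g : R -> R) (a b : R) :
  (forall t, -1 <= t <= 1 -> continuous g t) -> ex_RInt (fun x => g (cos x)) a b.
Proof.
intros Hg; apply (ex_RInt_continuous (V := R_CompleteNormedModule)); intros z _.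
apply continuous_comp_cos, Hg.
Qed.

Lemma cos_integral_lin (p q : R -> R) (c : R) :
  (forall t, -1 <= t <= 1 -> continuous p t) ->
  (forall t, -1 <= t <= 1 -> continuous q t) ->
  cos_integral (fun t => p t + c * q t) = cos_integral p + c * cos_integral q.
Proof.
intros Hp Hq; unfold cos_integral.
rewrite (RInt_plus (V := R_CompleteNormedModule) (fun x => p (cos x))
  (fun x => c * q (cos x))).
- rewrite (RInt_scal (V := R_CompleteNormedModule) (fun x => q (cos x)));
    [reflexivity|apply ex_RInt_cos_comp, Hq].
- apply ex_RInt_cos_comp, Hp.
- apply (ex_RInt_scal (V := R_NormedModule) (fun x => q (cos x))).
  apply ex_RInt_cos_comp, Hq.
Qed.

Lemma is_poly_continuous (p : R -> R) (t : R) : is_poly p -> continuous p t.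
Proof. intros [d Hp]; apply (polynomial_le_continuous d), Hp. Qed.

Lemma is_poly_chebyshev (n : nat) : is_poly (chebyshev n).
Proof. exists n; apply polynomial_le_chebyshev. Qed.

Lemma continuous_Rmult (f g : R -> R) (x : R) :
  continuous f x -> continuous g x -> continuous (fun t => f t * g t) x.
Proof. intros; apply (continuous_mult (K := R_AbsRing)); assumption. Qed.

Lemma poly_linear_cos_integral : poly_linear cos_integral.
Proof.
intros p q c Hp Hq; apply cos_integral_lin; intros; apply is_poly_continuous; assumption.
Qed.

Lemma poly_linear_cheb_integral (n : nat) : poly_linear (cheb_integral n).
Proof.
intros p q c Hp Hq; unfold cheb_integral; rewrite <- poly_linear_cos_integral.
- f_equal; apply functional_extensionality; intros; ring.
- apply is_poly_mul; [apply is_poly_chebyshev|assumption].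
- apply is_poly_mul; [apply is_poly_chebyshev|assumption].
Qed.

Lemma cos_integral_zchebyshev (k : Z) : cos_integral (zchebyshev k) = PI * zdelta0 k.
Proof.
unfold cos_integral, zdelta0.
rewrite (RInt_ext _ (fun x => cos (INR (Z.abs_nat k) * x)))
  by (intros; apply chebyshev_cos).
destruct (Z.eqb_spec k 0) as [->|Hk].
- rewrite (RInt_ext _ (fun _ => 1)).
  + rewrite RInt_const; to_R; ring.
  + intros; simpl; rewrite Rmult_0_l; apply cos_0.
- set (m := Z.abs_nat k).
  assert (Hm : INR m <> 0) by (apply not_0_INR; unfold m; lia).
  apply is_RInt_unique.
  replace (PI * 0) with (minus (sin (INR m * PI) / INR m) (sin (INR m * 0) / INR m)).
  + apply (is_RInt_derive (V := R_CompleteNormedModule) (fun x => sin (INR m * x) / INR m)).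
    * intros x _; auto_derive; [exact I|field; exact Hm].
    * intros x _; apply (ex_derive_continuous (K := R_AbsRing) (V := R_NormedModule)).
      auto_derive; exact I.
  + assert (sin (INR m * PI) = 0) as ->.
    { apply sin_eq_0_1; exists (Z.of_nat m); rewrite INR_IZR_INZ; reflexivity. }
    rewrite Rmult_0_r, sin_0; unfold minus, plus, opp; simpl; field; exact Hm.
Qed.

Lemma quadrature_weightE (n : nat) (l : nat -> nat -> R -> R) (i nu : nat) :
  is_poly (l i nu) -> quadrature_weight n l i nu = cheb_integral n (l i nu).
Proof.
intros Hl; unfold quadrature_weight, cheb_integral, cos_integral.
apply (RInt_gen_chebyshev_weight (V := R_CompleteNormedModule) _
  (fun t => chebyshev n t * l i nu t)).
- intros t _; apply is_poly_continuous, is_poly_mul; [apply is_poly_chebyshev|exact Hl].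
- intros t _; unfold scal; simpl; unfold mult; simpl; unfold Rdiv; ring.
Qed.

Lemma continuous_pair_R (g h : R -> R) (x : R) :
  continuous g x -> continuous h x ->
  continuous (fun t => (g t, h t) : C_R_CompleteNormedModule) x.
Proof.
intros Hg Hh; apply filterlim_locally; intros eps.
apply (proj1 (filterlim_locally _ _)) with (eps := eps) in Hg.
apply (proj1 (filterlim_locally _ _)) with (eps := eps) in Hh.
generalize (filter_and _ _ Hg Hh); apply filter_imp; intros y Hy; exact Hy.
Qed.

Lemma fourier_chebyshevE (n : nat) (f : C -> C) :
  (forall t, -1 <= t <= 1 -> continuous (fun t => fst (f (RtoC t))) t) ->
  (forall t, -1 <= t <= 1 -> continuous (fun t => snd (f (RtoC t))) t) ->
  fourier_chebyshev n f = (cheb_integral n (fun t => fst (f (RtoC t))),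
                           cheb_integral n (fun t => snd (f (RtoC t)))).
Proof.
intros H1 H2; unfold fourier_chebyshev.
assert (Hp : forall t, continuous (chebyshev n) t)
  by (intros; apply is_poly_continuous, is_poly_chebyshev).
rewrite (RInt_gen_chebyshev_weight (V := C_R_CompleteNormedModule) _
  (fun t => (chebyshev n t * fst (f (RtoC t)), chebyshev n t * snd (f (RtoC t))))).
- apply (is_RInt_unique (V := C_R_CompleteNormedModule)).
  apply (is_RInt_fct_extend_pair (U := R_NormedModule) (V := R_NormedModule)); simpl;
    apply (RInt_correct (V := R_CompleteNormedModule)).
  + apply (ex_RInt_cos_comp (fun t => chebyshev n t * fst (f (RtoC t)))).
    intros t Ht; apply continuous_Rmult; auto.
  + apply (ex_RInt_cos_comp (fun t => chebyshev n t * snd (f (RtoC t)))).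
    intros t Ht; apply continuous_Rmult; auto.
- intros t Ht; apply continuous_pair_R; apply continuous_Rmult; auto.
- intros t _; destruct (f (RtoC t)) as [u v]; unfold scal; simpl.
  unfold prod_scal, Cmult, RtoC, scal; simpl; unfold mult; simpl.
  apply injective_projections; simpl; unfold Rdiv; ring.
Qed.

(** * The remainder as a linear functional on polynomials *)

Section Remainder.
Variables (n s : nat) (xi : nat -> R) (l : nat -> nat -> R -> R).
Hypotheses (n_gt0 : (1 <= n)%nat) (s_gt0 : (1 <= s)%nat).
Hypothesis zeros : chebyshev_zeros n xi.
Hypothesis fund : hermite_fundamental n s xi l.

(** The remainder of a real function; for [f : C -> C] it will be applied to the real and the
    imaginary part of [f] on the real line. *)
Definition real_remainder (p : R -> R) : R :=
  cheb_integral n p - sum_n_m (fun nu => sum_n_m (fun i =>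
    cheb_integral n (l i nu) * Derive_n p i (xi nu)) 0 (2 * s - 1)) 1 n.

Lemma poly_linear_sum (N m : nat) (c : nat -> R) (L : nat -> (R -> R) -> R) :
  (forall k, poly_linear (L k)) ->
  poly_linear (fun p => sum_n_m (fun k => c k * L k p) m N).
Proof.
intros HL p q a Hp Hq.
rewrite <- (sum_n_m_mult_l (K := R_Ring)).
rewrite <- (sum_n_m_plus (G := R_AbelianMonoid)).
apply sum_n_m_ext; intros k; rewrite HL by assumption; to_R; ring.
Qed.

Lemma poly_linear_real_remainder : poly_linear real_remainder.
Proof.
assert (HQ : poly_linear (fun p => sum_n_m (fun nu => 1 * sum_n_m (fun i =>
    cheb_integral n (l i nu) * Derive_n p i (xi nu)) 0 (2 * s - 1)) 1 n)).
{ apply poly_linear_sum; intros nu.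
  apply (poly_linear_sum _ _ _ (fun i p => Derive_n p i (xi nu))); intros i.
  apply poly_linear_Derive_n. }
intros p q c Hp Hq; unfold real_remainder.
rewrite poly_linear_cheb_integral by assumption.
assert (E : forall p, sum_n_m (fun nu => 1 * sum_n_m (fun i =>
    cheb_integral n (l i nu) * Derive_n p i (xi nu)) 0 (2 * s - 1)) 1 n =
  sum_n_m (fun nu => sum_n_m (fun i =>
    cheb_integral n (l i nu) * Derive_n p i (xi nu)) 0 (2 * s - 1)) 1 n).
{ intros; apply sum_n_m_ext; intros; apply Rmult_1_l. }
specialize (HQ p q c Hp Hq); cbv beta in HQ; rewrite !E in HQ; rewrite HQ; ring.
Qed.

Lemma real_remainder_zchebyshev (k : Z) :
  real_remainder (zchebyshev k) =
  PI / 2 * comb n (alt_coef s) (Z.of_nat ((2 * s + 1) * n)) (Z.abs k).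
Proof.
assert (HPI := PI_RGT_0).
(* Under this normalization the 2 and the weight [T_n] make up one further factor [2 T_n], in an
   integral divided by [PI]; the right-hand side of the recurrence is then exactly
   [A^(2s + 1) zdelta0]. *)
set (L := fun p => 2 / PI * real_remainder p).
assert (HL : poly_linear L).
{ intros p q c Hp Hq; unfold L; rewrite poly_linear_real_remainder by assumption; ring. }
rewrite <- (shift_sum_solution n s (fun k => L (zchebyshev k)) n_gt0 s_gt0).
- unfold L; field; lra.
- intros j; f_equal; unfold zchebyshev; f_equal; lia.
- intros j Hj; unfold L, real_remainder.
  rewrite (hermite_exact n s xi l n_gt0 s_gt0 (proj2 zeros) fund (cheb_integral n)).
  + ring.
  + apply poly_linear_cheb_integral.
  + apply polynomial_le_weaken with (Z.abs_nat j); [lia|apply polynomial_le_chebyshev].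
- intros j Hj; rewrite <- (poly_linear_iter L) by exact HL.
  (* By orthogonality [zdelta0] is the sequence of values [J (T_j)], so [poly_linear_iter] also
     describes the right-hand side. *)
  set (J := fun p => / PI * cos_integral p).
  assert (HJ : poly_linear J).
  { intros p q c Hp Hq; unfold J; rewrite poly_linear_cos_integral by assumption; ring. }
  replace zdelta0 with (fun j => J (zchebyshev j)).
  2:{ apply functional_extensionality; intros i; unfold J.
      rewrite cos_integral_zchebyshev; field; lra. }
  rewrite <- (poly_linear_iter J) by exact HJ.
  assert (HP : forall m, is_poly (fun x => (2 * chebyshev n x) ^ m * zchebyshev j x)).
  { intros m; apply is_poly_pow_mul; [|apply is_poly_zchebyshev].
    apply is_poly_scal, is_poly_chebyshev. }
  unfold L, J, real_remainder.
  rewrite (sum_n_m_ext_loc _ (fun _ => 0)).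
  2:{ intros nu Hnu; rewrite (sum_n_m_ext_loc _ (fun _ => 0)).
      - rewrite sum_n_m_const; apply Rmult_0_r.
      - intros i Hi; rewrite (vanishes_pow_mul (fun x => 2 * chebyshev n x)).
        + apply Rmult_0_r.
        + apply is_poly_scal, is_poly_chebyshev.
        + apply is_poly_zchebyshev.
        + rewrite (proj2 (proj1 zeros nu Hnu)); ring.
        + lia. }
  rewrite sum_n_m_const, Rmult_0_r, Rminus_0_r; unfold cheb_integral.
  replace (cos_integral (fun x => (2 * chebyshev n x) ^ (2 * s + 1) * zchebyshev j x))
    with (2 * cos_integral (fun t => chebyshev n t * ((2 * chebyshev n t) ^ (2 * s) * zchebyshev j t))).
  + field; lra.
  + rewrite <- (Rplus_0_l (2 * _)), <- (poly_linear_0 _ poly_linear_cos_integral).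
    rewrite <- poly_linear_cos_integral.
    * f_equal; apply functional_extensionality; intros x.
      rewrite (Nat.add_comm _ 1); simpl pow; ring.
    * exists O; apply polynomial_le_const.
    * apply is_poly_mul; [apply is_poly_chebyshev|apply HP].
Qed.

End Remainder.

(** * Chebyshev expansions *)

Lemma RInt_ge_const (g : R -> R) (a b c : R) : a <= b -> ex_RInt g a b ->
  (forall x, a < x < b -> c <= g x) -> c * (b - a) <= RInt g a b.
Proof.
intros Hab Hg H.
replace (c * (b - a)) with (RInt (fun _ => c) a b)
  by (rewrite RInt_const; to_R; ring).
apply RInt_le; auto; apply ex_RInt_const.
Qed.

Lemma ex_RInt_continuous_all (g : R -> R) (a b : R) :
  (forall x, continuous g x) -> ex_RInt g a b.
Proof. intros H; apply (ex_RInt_continuous (V := R_CompleteNormedModule)); auto. Qed.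

Section Uniqueness.
Variable E : R -> R.
Hypothesis E_cont : forall x, continuous E x.
Hypothesis E_orth : forall k : nat, RInt (fun x => E x * chebyshev k (cos x)) 0 PI = 0.

Lemma continuous_mul_poly_cos (p : R -> R) (x : R) : is_poly p ->
  continuous (fun x => E x * p (cos x)) x.
Proof.
intros Hp; apply continuous_Rmult; [apply E_cont|].
apply (continuous_comp_cos p); intros; apply is_poly_continuous, Hp.
Qed.

Lemma orthogonal_poly (p : R -> R) : is_poly p ->
  RInt (fun x => E x * p (cos x)) 0 PI = 0.
Proof.
assert (HL : poly_linear (fun p => RInt (fun x => E x * p (cos x)) 0 PI)).
{ intros p1 p2 c H1 H2.
  rewrite <- (RInt_scal (V := R_CompleteNormedModule) (fun x => E x * p2 (cos x))).
  - rewrite <- (RInt_plus (V := R_CompleteNormedModule)).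
    + apply RInt_ext; intros x _; to_R; ring.
    + apply ex_RInt_continuous_all; intros; apply continuous_mul_poly_cos, H1.
    + apply (ex_RInt_scal (V := R_NormedModule)).
      apply ex_RInt_continuous_all; intros; apply continuous_mul_poly_cos, H2.
  - apply ex_RInt_continuous_all; intros; apply continuous_mul_poly_cos, H2. }
set (L := fun p => RInt (fun x => E x * p (cos x)) 0 PI) in *.
(* The induction on the degree carries a factor [T_k] with arbitrary [k], since [t T_k] is the mean
   of [T_(k+1)] and [T_(k-1)]. *)
assert (H : forall d q, polynomial_le d q -> forall k : Z,
  L (fun t => q t * zchebyshev k t) = 0).
{ induction d as [|d IH]; intros q Hq k.
  - apply polynomial_le_0 in Hq; destruct Hq as [c Hq].
    replace (fun t => q t * zchebyshev k t) with (fun t => 0 + c * zchebyshev k t)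
      by (apply functional_extensionality; intros; rewrite Hq; ring).
    rewrite (HL (fun _ => 0)), (poly_linear_0 L HL).
    + unfold L, zchebyshev; rewrite E_orth; to_R; ring.
    + exists O; apply polynomial_le_const.
    + apply is_poly_zchebyshev.
  - apply polynomial_le_horner in Hq; destruct Hq as (c & q1 & Hq1 & Hq).
    assert (P : forall j, is_poly (fun t => q1 t * zchebyshev j t)).
    { intros j; apply is_poly_mul; [exists d; exact Hq1|apply is_poly_zchebyshev]. }
    replace (fun t => q t * zchebyshev k t) with (fun t =>
      (c * zchebyshev k t + / 2 * (q1 t * zchebyshev (k + 1) t)) +
      / 2 * (q1 t * zchebyshev (k - 1) t)).
    2:{ apply functional_extensionality; intros t; rewrite Hq.
        assert (R := zchebyshev_recurrence k t).
        replace ((c + t * q1 t) * zchebyshev k t) with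
          (c * zchebyshev k t + / 2 * q1 t * (2 * t * zchebyshev k t)) by field.
        rewrite <- R; ring. }
    assert (Pc : is_poly (fun t => c * zchebyshev k t))
      by (apply is_poly_scal, is_poly_zchebyshev).
    rewrite (HL (fun t => c * zchebyshev k t + _)), (HL (fun t => c * zchebyshev k t));
      auto; [|apply is_poly_lin; auto].
    rewrite (IH (fun _ => c)) by apply polynomial_le_const.
    rewrite !(IH q1) by exact Hq1; to_R; ring. }
intros [d Hp]; transitivity (L (fun t => p t * zchebyshev 0 t));
  [unfold L|apply (H d p Hp)].
apply RInt_ext; intros x _; unfold zchebyshev; simpl; ring.
Qed.

(* A positive value would be detected by the peaked kernel
   [(1 - (cos x - cos x0)^2 / 4)^N]. *)
Lemma orthogonal_nonpos (x0 : R) : 0 <= x0 <= PI -> E x0 <= 0.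
Proof.
intros Hx0; apply Rnot_lt_le; intros Hpos.
assert (HPI := PI_RGT_0).
set (de := E x0) in *.
assert (exists eta, 0 < eta /\ forall x, Rabs (x - x0) < eta -> de / 2 < E x)
  as (eta & Heta & Hnear).
{ destruct (proj1 (filterlim_locally _ _) (E_cont x0) (mkposreal (de / 2) ltac:(lra)))
    as [eta Heta].
  exists eta; split; [apply cond_pos|]; intros x Hx.
  specialize (Heta x Hx); apply Rabs_lt_between' in Heta; simpl in Heta.
  unfold de in *; lra. }
destruct (continuity_ab_min E 0 PI ltac:(lra)) as (xm & Hmin & _).
{ intros x _; apply continuity_pt_filterlim, E_cont. }
set (Mx := Rabs (E xm)).
assert (HMx : forall x, 0 <= x <= PI -> - Mx <= E x).
{ intros x Hx; specialize (Hmin x Hx); unfold Mx.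
  generalize (Rle_abs (- E xm)); rewrite Rabs_Ropp; lra. }
assert (HMx0 : 0 <= Mx) by apply Rabs_pos.
assert (exists ka, 0 < ka <= 1 /\ forall x, 0 <= x <= PI -> eta <= Rabs (x - x0) ->
  ka <= Rabs (cos x - cos x0)) as (ka & Hka & Hfar).
(* Strict monotonicity of the cosine gives the gap. The value 1 stands for a side of [x0] on which
   [[0, PI]] has no point at distance [eta]. *)
{ set (k1 := if Rle_dec (x0 + eta) PI then cos x0 - cos (x0 + eta) else 1).
  set (k2 := if Rle_dec 0 (x0 - eta) then cos (x0 - eta) - cos x0 else 1).
  assert (H1 : 0 < k1).
  { unfold k1; destruct (Rle_dec (x0 + eta) PI); [|lra].
    assert (cos (x0 + eta) < cos x0) by (apply cos_decreasing_1; lra); lra. }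
  assert (H2 : 0 < k2).
  { unfold k2; destruct (Rle_dec 0 (x0 - eta)); [|lra].
    assert (cos x0 < cos (x0 - eta)) by (apply cos_decreasing_1; lra); lra. }
  exists (Rmin 1 (Rmin k1 k2)).
  assert (A1 := Rmin_l 1 (Rmin k1 k2)); assert (A2 := Rmin_r 1 (Rmin k1 k2)).
  assert (A3 := Rmin_l k1 k2); assert (A4 := Rmin_r k1 k2).
  split; [split; [repeat apply Rmin_glb_lt; lra|lra]|].
  intros x Hx; unfold Rabs at 1; destruct Rcase_abs; intros Hxe.
  - assert (k2 <= cos x - cos x0).
    { unfold k2; destruct (Rle_dec 0 (x0 - eta)); [|lra].
      assert (cos (x0 - eta) <= cos x) by (apply cos_decr_1; lra); lra. }
    rewrite Rabs_pos_eq; lra.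
  - assert (k1 <= cos x0 - cos x).
    { unfold k1; destruct (Rle_dec (x0 + eta) PI); [|lra].
      assert (cos x <= cos (x0 + eta)) by (apply cos_decr_1; lra); lra. }
    rewrite Rabs_minus_sym, Rabs_pos_eq; lra. }
set (be := fun t => 1 - (t - cos x0) ^ 2 / 4).
assert (Hbe : forall x, 0 <= be (cos x) <= 1).
{ intros x; unfold be; generalize (COS_bound x) (COS_bound x0); intros.
  generalize (pow2_ge_0 (cos x - cos x0)).
  assert ((cos x - cos x0) ^ 2 <= 2 ^ 2); [|lra].
  rewrite <- (pow2_abs (cos x - cos x0)); apply pow_incr; split; [apply Rabs_pos|].
  apply Rabs_le; lra. }
(* [q] bounds [be] from above away from [x0]; [q'] bounds it from below within [ka / 2] of [x0], the
   cosine being 1-Lipschitz. Since [q < q'], the peak wins for large [N]. *)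
set (q := 1 - ka ^ 2 / 4); set (q' := 1 - ka ^ 2 / 16).
assert (Hq : 0 < q < q' /\ q' <= 1).
{ assert (0 < ka ^ 2 <= 1) by (simpl; nra); unfold q, q'; lra. }
assert (Hbefar : forall x, 0 <= x <= PI -> eta <= Rabs (x - x0) -> be (cos x) <= q).
{ intros x Hx Hxe; specialize (Hfar x Hx Hxe); unfold be, q.
  rewrite <- (pow2_abs (cos x - cos x0)).
  assert (ka ^ 2 <= Rabs (cos x - cos x0) ^ 2) by (apply pow_incr; lra); lra. }
assert (Hbenear : forall x, Rabs (x - x0) <= ka / 2 -> q' <= be (cos x)).
{ intros x Hx.
  assert (Rabs (cos x - cos x0) <= ka / 2).
  { eapply Rle_trans; [|exact Hx].
    destruct (MVT_gen cos x0 x (fun t => - sin t)) as (c & _ & Hc).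
    - intros; auto_derive; [exact I|ring].
    - intros; apply continuity_cos.
    - rewrite Hc, Rabs_mult, Rabs_Ropp.
      rewrite <- (Rmult_1_l (Rabs (x - x0))) at 2.
      apply Rmult_le_compat_r; [apply Rabs_pos|].
      apply Rabs_le, SIN_bound. }
  unfold be, q'; rewrite <- (pow2_abs (cos x - cos x0)).
  assert (Rabs (cos x - cos x0) ^ 2 <= (ka / 2) ^ 2)
    by (apply pow_incr; split; [apply Rabs_pos|lra]).
  lra. }
set (la := Rmin (Rmin (eta / 2) (ka / 2)) (PI / 2)).
assert (Hla : 0 < la /\ la <= eta / 2 /\ la <= ka / 2 /\ la <= PI / 2).
{ unfold la; assert (A1 := Rmin_l (Rmin (eta / 2) (ka / 2)) (PI / 2)).
  assert (A2 := Rmin_r (Rmin (eta / 2) (ka / 2)) (PI / 2)).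
  assert (A3 := Rmin_l (eta / 2) (ka / 2)); assert (A4 := Rmin_r (eta / 2) (ka / 2)).
  repeat split; try lra; repeat apply Rmin_glb_lt; lra. }
(* An interval of length [la] on one side of [x0], inside [[0, PI]] even if [x0] is an end point: as
   [la <= PI / 2], one of the sides has room. *)
assert (exists u, 0 <= u /\ u + la <= PI /\ x0 - la <= u <= x0) as (u & Hu0 & HuP & Hux).
{ destruct (Rle_dec (x0 + la) PI); [exists x0|exists (x0 - la)]; lra. }
assert (Hbp : is_poly be).
{ exists 2%nat; unfold be.
  exists (fun k => match k with O => 1 - (cos x0) ^ 2 / 4 | 1%nat => cos x0 / 2 | _ => - / 4 end).
  intros t; rewrite !sum_Sn, sum_O; to_R; simpl; field. }
assert (HN : forall N, 0 >= de / 2 * la * q' ^ N - Mx * PI * q ^ N).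
{ intros N.
  assert (HP : is_poly (fun t => be t ^ N)).
  { apply (is_poly_ext (fun t => be t ^ N * 1)); [intros; ring|].
    apply is_poly_pow_mul; [exact Hbp|exists O; apply polynomial_le_const]. }
  assert (Hint := orthogonal_poly _ HP); cbv beta in Hint.
  set (g := fun x => E x * be (cos x) ^ N) in *.
  assert (Hex : forall a b, ex_RInt g a b).
  { intros a b; apply ex_RInt_continuous_all; intros x.
    apply (continuous_mul_poly_cos (fun t => be t ^ N)), HP. }
  assert (Hlow : forall x, 0 <= x <= PI -> - (Mx * q ^ N) <= g x).
  { intros x Hx; unfold g.
    assert (0 <= q ^ N) by (apply pow_le; lra).
    assert (0 <= be (cos x) ^ N) by (apply pow_le, Hbe).
    destruct (Rlt_le_dec (Rabs (x - x0)) eta) as [Hn|Hn].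
    - specialize (Hnear x Hn); apply Rle_trans with 0; [nra|].
      apply Rmult_le_pos; lra.
    - assert (be (cos x) ^ N <= q ^ N)
        by (apply pow_incr; split; [apply Hbe|apply Hbefar; assumption]).
      specialize (HMx x Hx); nra. }
  rewrite <- (RInt_Chasles (V := R_CompleteNormedModule) g 0 (u + la)),
    <- (RInt_Chasles (V := R_CompleteNormedModule) g 0 u (u + la)) in Hint by apply Hex.
  revert Hint; to_R; intros Hint.
  assert (I1 := RInt_ge_const g 0 u (- (Mx * q ^ N)) Hu0 (Hex _ _)
    ltac:(intros; apply Hlow; lra)).
  assert (I3 := RInt_ge_const g (u + la) PI (- (Mx * q ^ N)) HuP (Hex _ _)
    ltac:(intros; apply Hlow; lra)).
  assert (I2 : de / 2 * q' ^ N * (u + la - u) <= RInt g u (u + la)).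
  { apply RInt_ge_const; [lra|apply Hex|]; intros x Hx; unfold g.
    assert (Rabs (x - x0) <= la) by (apply Rabs_le; lra).
    assert (q' ^ N <= be (cos x) ^ N) by (apply pow_incr; split; [lra|apply Hbenear; lra]).
    assert (de / 2 < E x) by (apply Hnear; lra).
    assert (0 < q' ^ N) by (apply pow_lt; lra).
    apply Rmult_le_compat; lra. }
  assert (0 <= Mx * q ^ N) by (apply Rmult_le_pos; [lra|apply pow_le; lra]).
  assert (0 <= Mx * q ^ N * la) by (apply Rmult_le_pos; lra).
  lra. }
destruct (pow_lt_1_zero (q / q')) with (y := de / 2 * la / (Mx * PI + 1)) as [N HN'].
- rewrite Rabs_pos_eq; [|apply Rle_mult_inv_pos; lra].
  apply Rmult_lt_reg_r with q'; [lra|unfold Rdiv].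
  rewrite Rmult_assoc, Rinv_l; lra.
- apply Rdiv_lt_0_compat; nra.
- specialize (HN' N (Nat.le_refl N)); specialize (HN N).
  rewrite Rabs_pos_eq in HN' by (apply pow_le, Rle_mult_inv_pos; lra).
  unfold Rdiv in HN' at 1; rewrite Rpow_mult_distr, pow_inv in HN'.
  assert (H1 : 0 < q' ^ N) by (apply pow_lt; lra).
  assert (H2 : 0 < q ^ N) by (apply pow_lt; lra).
  assert (H3 : 0 < Mx * PI + 1) by nra.
  assert (H4 : q ^ N * (Mx * PI + 1) < de / 2 * la * q' ^ N); [|nra].
  replace (q ^ N * (Mx * PI + 1)) with ((q ^ N * / q' ^ N) * (q' ^ N * (Mx * PI + 1)))
    by (field; lra).
  replace (de / 2 * la * q' ^ N) with
    (de / 2 * la / (Mx * PI + 1) * (q' ^ N * (Mx * PI + 1))) by (field; lra).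
  apply Rmult_lt_compat_r; [nra|exact HN'].
Qed.

End Uniqueness.

Lemma orthogonal_zero (E : R -> R) : (forall x, continuous E x) ->
  (forall k : nat, RInt (fun x => E x * chebyshev k (cos x)) 0 PI = 0) ->
  forall x, 0 <= x <= PI -> E x = 0.
Proof.
intros HE Ho x Hx; apply Rle_antisym; [apply orthogonal_nonpos; assumption|].
apply Ropp_le_cancel; rewrite Ropp_0.
apply (orthogonal_nonpos (fun x => - E x)); [| |exact Hx].
- intros y; apply (continuous_opp (V := R_NormedModule)), HE.
- intros k; rewrite (RInt_ext _ (fun x => opp (E x * chebyshev k (cos x))))
    by (intros; to_R; ring).
  rewrite (RInt_opp (V := R_CompleteNormedModule)).
  + rewrite Ho; to_R; ring.
  + apply ex_RInt_continuous_all; intros y.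
    apply continuous_mul_poly_cos; [exact HE|apply is_poly_chebyshev].
Qed.

(** * Chebyshev series with geometrically decaying coefficients *)

(** Each factor [k + 1] is paid for by a square root of the ratio: for [z = sqrt x], [(k + 1) z^k <=
    1 + z + ... + z^k <= 1 / (1 - z)]. *)
Lemma polynomial_geom_bound (m : nat) (x : R) : 0 < x < 1 ->
  exists c y, 0 < c /\ 0 < y < 1 /\ forall k, (INR k + 1) ^ m * x ^ k <= c * y ^ k.
Proof.
revert x; induction m as [|m IH]; intros x Hx.
- exists 1, x; repeat split; try lra; intros k; simpl; lra.
- set (z := sqrt x).
  assert (Hz : 0 < z) by (apply sqrt_lt_R0; lra).
  assert (Hzz : z * z = x) by (apply sqrt_sqrt; lra).
  assert (Hz1 : z < 1) by nra.
  destruct (IH z (conj Hz Hz1)) as (c & y & Hc & Hy & H).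
  exists (c * / (1 - z)), y; split; [|split; [exact Hy|]].
  { apply Rmult_lt_0_compat; [lra|apply Rinv_0_lt_compat; lra]. }
  intros k; specialize (H k).
  assert (Hk : (INR k + 1) * z ^ k <= / (1 - z)).
  { apply Rmult_le_reg_r with (1 - z); [lra|]; rewrite Rinv_l by lra.
    assert (Hb : forall j, (INR j + 1) * z ^ j * (1 - z) <= 1 - z ^ S j).
    { induction j as [|j IHj]; [simpl; lra|].
      rewrite S_INR, <- !tech_pow_Rmult in *.
      assert (0 < z ^ j) by (apply pow_lt; lra).
      assert (0 <= INR j) by apply pos_INR.
      assert (z * ((INR j + 1) * z ^ j * (1 - z)) <= z * (1 - z * z ^ j))
        by (apply Rmult_le_compat_l; lra).
      assert (z * z ^ j <= 1).
      { rewrite tech_pow_Rmult, <- (pow1 (S j)); apply pow_incr; lra. }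
      nra. }
    specialize (Hb k); assert (0 < z ^ S k) by (apply pow_lt; lra); lra. }
  replace ((INR k + 1) ^ S m * x ^ k) with
    (((INR k + 1) * z ^ k) * ((INR k + 1) ^ m * z ^ k))
    by (rewrite <- Hzz, Rpow_mult_distr; simpl; ring).
  replace (c * / (1 - z) * y ^ k) with (/ (1 - z) * (c * y ^ k)) by ring.
  assert (0 <= INR k) by apply pos_INR.
  apply Rmult_le_compat; try assumption.
  + apply Rmult_le_pos; [lra|apply pow_le; lra].
  + apply Rmult_le_pos; apply pow_le; lra.
Qed.

Lemma ex_series_dominated (a g : nat -> R) :
  (forall k, Rabs (a k) <= g k) -> ex_series g -> ex_series a.
Proof. apply (ex_series_le (V := R_CompleteNormedModule)). Qed.

Lemma Series_dominated (a g : nat -> R) :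
  (forall k, Rabs (a k) <= g k) -> ex_series g -> Rabs (Series a) <= Series g.
Proof.
intros H Hg; eapply Rle_trans.
- apply Series_Rabs; apply ex_series_dominated with g; [|exact Hg].
  intros k; rewrite Rabs_Rabsolu; apply H.
- apply Series_le; [|exact Hg]; intros k; split; [apply Rabs_pos|apply H].
Qed.

(** A summable bound on the second derivatives gives each term a first-order Taylor error of at most
    [h ^ 2 * g k]; these errors add up to [h ^ 2 * Series g], which is small compared with [h]. *)
Lemma is_derive_series (u u1 u2 : nat -> R -> R) (g : nat -> R) (a b t : R) :
  (forall k y, a <= y <= b -> is_derive (u k) y (u1 k y)) ->
  (forall k y, a <= y <= b -> is_derive (u1 k) y (u2 k y)) ->
  (forall k y, a <= y <= b -> Rabs (u2 k y) <= g k) ->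
  ex_series g ->
  (forall y, a <= y <= b -> ex_series (fun k => u k y)) ->
  ex_series (fun k => u1 k t) -> a < t < b ->
  is_derive (fun y => Series (fun k => u k y)) t (Series (fun k => u1 k t)).
Proof.
intros D1 D2 H2 Hg Hu Hu1 Ht; apply is_derive_Reals; intros eps Heps.
set (G := Series g).
assert (HG : 0 <= G).
{ assert (Ha : Rabs (Series (fun k => u2 k t)) <= G)
    by (apply Series_dominated; [intros; apply H2; lra|exact Hg]).
  generalize (Rabs_pos (Series (fun k => u2 k t))); lra. }
set (del := Rmin (Rmin (t - a) (b - t)) (eps / (G + 1))).
assert (Hdel : 0 < del).
{ unfold del; repeat apply Rmin_glb_lt; try lra; apply Rdiv_lt_0_compat; lra. }
assert (A1 := Rmin_l (Rmin (t - a) (b - t)) (eps / (G + 1))).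
assert (A2 := Rmin_r (Rmin (t - a) (b - t)) (eps / (G + 1))).
assert (A3 := Rmin_l (t - a) (b - t)); assert (A4 := Rmin_r (t - a) (b - t)).
fold del in A1, A2.
exists (mkposreal del Hdel); intros h Hh0 Hh; simpl in Hh.
assert (Hth : a <= t + h <= b) by (apply Rabs_lt_between in Hh; lra).
assert (Hbd : forall k, Rabs (u k (t + h) - u k t - h * u1 k t) <= h ^ 2 * g k).
{ intros k.
  assert (Hin : forall c d x, a <= c <= b -> a <= d <= b ->
    Rmin c d <= x <= Rmax c d -> a <= x <= b).
  { intros c d x; unfold Rmin, Rmax; destruct Rle_dec; lra. }
  assert (MV : forall v v1 c d, (forall y, a <= y <= b -> is_derive v y (v1 y)) ->
    a <= c <= b -> a <= d <= b ->
    exists y, Rmin c d <= y <= Rmax c d /\ v d - v c = v1 y * (d - c)).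
  { intros v v1 c d Hv Hc Hd; apply MVT_gen.
    - intros x Hx; apply Hv, (Hin c d); lra.
    - intros x Hx; apply continuity_pt_filterlim.
      apply (ex_derive_continuous (K := R_AbsRing) (V := R_NormedModule)).
      exists (v1 x); apply Hv, (Hin c d); lra. }
  destruct (MV (u k) (u1 k) t (t + h) (D1 k) ltac:(lra) Hth) as (y & Hy & E1).
  assert (Hy' : a <= y <= b) by (apply (Hin t (t + h)); lra).
  destruct (MV (u1 k) (u2 k) t y (D2 k) ltac:(lra) Hy') as (z & Hz & E2).
  assert (Hz' : a <= z <= b) by (apply (Hin t y); lra).
  replace (u k (t + h) - u k t - h * u1 k t) with (h * (u1 k y - u1 k t))
    by (rewrite E1; ring).
  rewrite E2, !Rabs_mult, <- (pow2_abs h).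
  assert (Hyt : Rabs (y - t) <= Rabs h).
  { revert Hy; unfold Rmin, Rmax, Rabs; repeat destruct Rcase_abs;
      destruct Rle_dec; lra. }
  specialize (H2 k z Hz').
  replace (Rabs h ^ 2 * g k) with (Rabs h * (g k * Rabs h)) by ring.
  apply Rmult_le_compat_l; [apply Rabs_pos|].
  apply Rmult_le_compat; try apply Rabs_pos; assumption. }
assert (HS : Series (fun k => u k (t + h)) - Series (fun k => u k t)
   - h * Series (fun k => u1 k t) = Series (fun k => u k (t + h) - u k t - h * u1 k t)).
{ rewrite <- Series_scal_l, <- Series_minus by (apply Hu; lra).
  rewrite <- Series_minus; [reflexivity| |].
  - apply (ex_series_minus (V := R_NormedModule)); apply Hu; lra.
  - apply (ex_series_scal (V := R_NormedModule)), Hu1. }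
replace ((Series (fun k => u k (t + h)) - Series (fun k => u k t)) / h
    - Series (fun k => u1 k t))
  with ((Series (fun k => u k (t + h)) - Series (fun k => u k t)
   - h * Series (fun k => u1 k t)) / h) by (field; assumption).
rewrite HS; unfold Rdiv; rewrite Rabs_mult, Rabs_inv.
assert (Hh' : 0 < Rabs h) by (apply Rabs_pos_lt; assumption).
apply Rle_lt_trans with (Rabs h * G).
- apply Rmult_le_reg_r with (Rabs h); [assumption|].
  rewrite Rmult_assoc, Rinv_l, Rmult_1_r by lra.
  replace (Rabs h * G * Rabs h) with (h ^ 2 * G) by (rewrite <- (pow2_abs h); ring).
  unfold G; rewrite <- Series_scal_l; apply Series_dominated; [exact Hbd|].
  apply (ex_series_scal (V := R_NormedModule) (h ^ 2)), Hg.
- assert (Rabs h < eps / (G + 1)) by lra.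
  assert (Rabs h * (G + 1) < eps).
  { replace eps with (eps / (G + 1) * (G + 1)) at 1 by (field; lra).
    apply Rmult_lt_compat_r; lra. }
  nra.
Qed.

Lemma uniform_limit_continuous (F : R -> R) (x : R) :
  (forall eps, 0 < eps -> exists g : R -> R, continuous g x /\
     forall y, Rabs (F y - g y) <= eps) -> continuous F x.
Proof.
intros H; apply filterlim_locally; intros eps.
assert (He := cond_pos eps).
destruct (H (eps / 3)) as (g & Hg & HF); [lra|].
destruct (proj1 (filterlim_locally _ _) Hg (mkposreal (eps / 3) ltac:(lra))) as [d Hd].
exists d; intros y Hy; specialize (Hd y Hy).
apply Rabs_lt_between' in Hd; simpl in Hd.
assert (A := HF x); assert (B := HF y).
apply Rabs_le_between in A; apply Rabs_le_between in B.
apply Rabs_lt_between'; lra.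
Qed.

Lemma locally_open_interval (a b y : R) : a < y < b -> locally y (fun z => a < z < b).
Proof.
intros Hy; apply (open_and (fun z => a < z) (fun z => z < b));
  [apply open_gt|apply open_lt|exact Hy].
Qed.

(** The factor is the inverse of the square norm of [T_k], which is [PI] for [k = 0] and [PI / 2]
    otherwise. *)
Definition cheb_coef (f : R -> R) (k : nat) : R :=
  (if Nat.eqb k 0 then 1 else 2) / PI * cheb_integral k f.

Definition cheb_partial (b : nat -> R) (N : nat) (t : R) : R :=
  sum_n (fun k => b k * chebyshev k t) N.

Lemma is_poly_cheb_partial (b : nat -> R) (N : nat) : is_poly (cheb_partial b N).
Proof.
exists N; apply polynomial_le_sum_n_m; intros k Hk.
apply polynomial_le_weaken with k; [lia|apply polynomial_le_chebyshev].
Qed.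

Lemma poly_linear_cheb_partial (L : (R -> R) -> R) (b : nat -> R) (N : nat) :
  poly_linear L -> L (cheb_partial b N) = sum_n (fun k => b k * L (chebyshev k)) N.
Proof.
intros HL; apply (poly_linear_sum_n_m L N); [exact HL|].
intros k Hk; apply polynomial_le_weaken with k; [lia|apply polynomial_le_chebyshev].
Qed.

(** By [poly_linear_iter] with one factor, twice this integral is [PI] times the number of zeros
    among [k + m] and [k - m]. *)
Lemma cheb_integral_chebyshev (m k : nat) : cheb_integral m (chebyshev k) =
  if Nat.eqb m k then (if Nat.eqb k 0 then PI else PI / 2) else 0.
Proof.
assert (HL := poly_linear_iter cos_integral m 1 (Z.of_nat k) poly_linear_cos_integral).
rewrite Nat.iter_succ in HL; unfold shift_sum in HL; simpl Nat.iter in HL.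
rewrite !cos_integral_zchebyshev in HL.
replace (fun x => (2 * chebyshev m x) ^ 1 * zchebyshev (Z.of_nat k) x) with
  (fun x => 0 + 2 * (chebyshev m x * chebyshev k x)) in HL.
2:{ apply functional_extensionality; intros x; unfold zchebyshev.
    rewrite Zabs2Nat.id; ring. }
rewrite poly_linear_cos_integral in HL.
2:{ exists O; apply polynomial_le_const. }
2:{ apply is_poly_mul; apply is_poly_chebyshev. }
rewrite (poly_linear_0 _ poly_linear_cos_integral) in HL.
fold (cheb_integral m (chebyshev k)) in HL.
unfold zdelta0 in HL.
destruct (Nat.eqb_spec m k) as [->|Hmk]; [destruct (Nat.eqb_spec k 0) as [->|Hk]|].
- rewrite !(proj2 (Z.eqb_eq _ _)) in HL by lia; lra.
- rewrite (proj2 (Z.eqb_neq _ _)) in HL by lia.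
  rewrite (proj2 (Z.eqb_eq _ _)) in HL by lia; lra.
- rewrite !(proj2 (Z.eqb_neq _ _)) in HL by lia; lra.
Qed.

Lemma cheb_partial_integral (f : R -> R) (N m : nat) : (m <= N)%nat ->
  cheb_integral m (cheb_partial (cheb_coef f) N) = cheb_integral m f.
Proof.
intros Hm; rewrite (poly_linear_cheb_partial (cheb_integral m))
  by apply poly_linear_cheb_integral.
unfold sum_n; rewrite (sum_n_m_single _ 0 N m).
- rewrite cheb_integral_chebyshev, Nat.eqb_refl; unfold cheb_coef.
  generalize PI_RGT_0; destruct (Nat.eqb m 0); intros; field; lra.
- lia.
- intros k Hk Hne; rewrite cheb_integral_chebyshev.
  destruct (Nat.eqb_spec m k); [congruence|ring].
Qed.

Section Expansion.
Variables (f : R -> R) (K x : R).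
Hypothesis f_cont : forall t, -1 <= t <= 1 -> continuous f t.
Hypothesis x_bound : 0 < x < 1.
Let b := cheb_coef f.
Hypothesis b_bound : forall k, Rabs (b k) <= K * x ^ k.

Lemma coef_bound_ge0 : 0 <= K.
Proof.
specialize (b_bound O); simpl in b_bound; generalize (Rabs_pos (b O)); lra.
Qed.

(** Geometric decay of [b k] against polynomial growth of the derivatives. That [g] does not depend
    on [t] serves both uniform convergence and term-by-term differentiation. *)
Lemma Derive_n_term_bound (i : nat) : exists g : nat -> R, ex_series g /\
  forall k t, -1 <= t <= 1 -> Rabs (b k * Derive_n (chebyshev k) i t) <= g k.
Proof.
destruct (polynomial_geom_bound (2 * i) x x_bound) as (c & y & Hc & Hy & H).
exists (fun k => K * 2 ^ i * c * y ^ k); split.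
- apply (ex_series_scal (V := R_NormedModule) (K * 2 ^ i * c) (fun k => y ^ k)).
  apply ex_series_geom; rewrite Rabs_pos_eq; lra.
- intros k t Ht; rewrite Rabs_mult.
  apply Rle_trans with (K * x ^ k * (2 ^ i * (INR k + 1) ^ (2 * i))).
  + apply Rmult_le_compat; try apply Rabs_pos; [apply b_bound|].
    apply chebyshev_Derive_n_bound, Ht.
  + replace (K * x ^ k * (2 ^ i * (INR k + 1) ^ (2 * i))) with
      (K * 2 ^ i * ((INR k + 1) ^ (2 * i) * x ^ k)) by ring.
    rewrite (Rmult_assoc (K * 2 ^ i)); apply Rmult_le_compat_l; [|apply H].
    apply Rmult_le_pos; [apply coef_bound_ge0|apply pow_le; lra].
Qed.

Lemma ex_series_Derive_n (i : nat) (t : R) : -1 <= t <= 1 ->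
  ex_series (fun k => b k * Derive_n (chebyshev k) i t).
Proof.
intros Ht; destruct (Derive_n_term_bound i) as (g & Hg & H).
apply ex_series_dominated with g; auto.
Qed.

Lemma cheb_partial_uniform (eps : R) : 0 < eps -> exists N0, forall N t,
  (N0 <= N)%nat -> -1 <= t <= 1 ->
  Rabs (Series (fun k => b k * chebyshev k t) - cheb_partial b N t) <= eps.
Proof.
intros Heps; destruct (Derive_n_term_bound 0) as (g & Hg & H).
destruct (proj1 (filterlim_locally _ _) (Series_correct g Hg) (mkposreal eps Heps))
  as [N0 HN0].
exists N0; intros N t HN Ht.
specialize (HN0 N HN); apply Rabs_lt_between' in HN0; simpl in HN0.
apply proj1 in HN0; change (Series g - eps < sum_n (G := R_AbelianMonoid) g N) in HN0.
assert (Hs := ex_series_Derive_n 0 t Ht); simpl in Hs.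
rewrite (Series_incr_n _ (S N)) by (assumption || lia); simpl Init.Nat.pred.
unfold cheb_partial; rewrite <- sum_n_Reals.
replace (sum_n (fun k => b k * chebyshev k t) N +
    Series (fun k => b (S N + k)%nat * chebyshev (S N + k) t) -
    sum_n (fun k => b k * chebyshev k t) N)
  with (Series (fun k => b (S N + k)%nat * chebyshev (S N + k) t)) by ring.
apply Rle_trans with (Series (fun k => g (S N + k)%nat)).
- apply Series_dominated; [intros k; apply (H _ t Ht)|].
  apply (ex_series_incr_n (V := R_NormedModule) g), Hg.
- rewrite (Series_incr_n g (S N)) in HN0 by (assumption || lia); simpl Init.Nat.pred in HN0.
  rewrite <- sum_n_Reals in HN0; lra.
Qed.

(** The series converges uniformly, so it has the same coefficients as [f]; the difference is
    orthogonal to every [T_k] and [orthogonal_zero] applies. *)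
Lemma cheb_expansion (t : R) : -1 <= t <= 1 ->
  f t = Series (fun k => b k * chebyshev k t).
Proof.
intros Ht.
set (S := fun t => Series (fun k => b k * chebyshev k t)).
set (E := fun y => f (cos y) - S (cos y)).
assert (HS : forall y, continuous (fun y => S (cos y)) y).
{ intros y; apply uniform_limit_continuous; intros eps Heps.
  destruct (cheb_partial_uniform eps Heps) as [N HN].
  exists (fun y => cheb_partial b N (cos y)); split.
  - apply (continuous_comp_cos (cheb_partial b N)); intros.
    apply is_poly_continuous, is_poly_cheb_partial.
  - intros z; apply (HN N (cos z)); [lia|apply COS_bound]. }
assert (Hf : forall y, continuous (fun y => f (cos y)) y)
  by (apply continuous_comp_cos, f_cont).
assert (HE : forall y, continuous E y).
{ intros y; apply (continuous_minus (V := R_NormedModule)); auto. }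
assert (HT : forall k y, continuous (fun y => chebyshev k (cos y)) y).
{ intros k; apply continuous_comp_cos; intros; apply is_poly_continuous, is_poly_chebyshev. }
assert (H0 : E (acos t) = 0).
{ apply orthogonal_zero; [exact HE| |apply acos_bound].
  intros k; apply cond_eq; intros eps Heps; rewrite Rminus_0_r.
  assert (HPI := PI_RGT_0).
  destruct (cheb_partial_uniform (eps / (2 * PI))) as [N0 HN0];
    [apply Rdiv_lt_0_compat; lra|].
  set (N := (N0 + k)%nat).
  assert (HP : forall y, continuous (fun y => cheb_partial b N (cos y)) y).
  { apply (continuous_comp_cos (cheb_partial b N)); intros.
    apply is_poly_continuous, is_poly_cheb_partial. }
  (* For [N >= k] the partial sum has the same integral against [T_k] as [f], so it may take the
     place of [f] in [E]. *)
  replace (RInt (fun y => E y * chebyshev k (cos y)) 0 PI) with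
    (RInt (fun y => (cheb_partial b N (cos y) - S (cos y)) * chebyshev k (cos y)) 0 PI).
  - apply Rle_lt_trans with ((PI - 0) * (eps / (2 * PI))).
    + apply (norm_RInt_le_const (V := R_NormedModule)
        (fun y => (cheb_partial b N (cos y) - S (cos y)) * chebyshev k (cos y)) 0 PI);
        [lra| |].
      * intros y Hy.
        change (Rabs ((cheb_partial b N (cos y) - S (cos y)) * chebyshev k (cos y))
          <= eps / (2 * PI)).
        rewrite Rabs_mult, Rabs_minus_sym, <- (Rmult_1_r (eps / (2 * PI))).
        apply Rmult_le_compat; try apply Rabs_pos.
        -- apply (HN0 N (cos y)); [unfold N; lia|apply COS_bound].
        -- apply chebyshev_bound, COS_bound.
      * apply (RInt_correct (V := R_CompleteNormedModule)), ex_RInt_continuous_all.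
        intros y; apply continuous_Rmult; [|apply HT].
        apply (continuous_minus (V := R_NormedModule)); auto.
    + replace ((PI - 0) * (eps / (2 * PI))) with (eps / 2) by (field; lra); lra.
  - assert (A := cheb_partial_integral f N k ltac:(unfold N; lia)).
    fold b in A; unfold cheb_integral, cos_integral in A.
    rewrite (RInt_ext (fun y => E y * chebyshev k (cos y)) (fun y =>
      plus ((cheb_partial b N (cos y) - S (cos y)) * chebyshev k (cos y))
        (minus (chebyshev k (cos y) * f (cos y))
           (chebyshev k (cos y) * cheb_partial b N (cos y)))))
      by (intros y _; unfold E; to_R; ring).
    assert (X : forall g h, (forall y, continuous g y) -> (forall y, continuous h y) ->
      ex_RInt (fun y => g y * h y) 0 PI).
    { intros; apply ex_RInt_continuous_all; intros; apply continuous_Rmult; auto. }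
    rewrite (RInt_plus (V := R_CompleteNormedModule)),
      (RInt_minus (V := R_CompleteNormedModule)); auto.
    + rewrite A; to_R; rewrite Rminus_diag, Rplus_0_r; reflexivity.
    + apply (X (fun y => cheb_partial b N (cos y) - S (cos y))); auto.
      intros y; apply (continuous_minus (V := R_NormedModule)); auto.
    + apply (ex_RInt_minus (V := R_NormedModule)); auto. }
unfold E in H0; rewrite cos_acos in H0 by exact Ht; unfold S in H0; lra.
Qed.

(** [f] is only assumed continuous; its smoothness comes from the series. The second conclusion
    certifies that [Derive_n f (S i)] is a true derivative and not a default value. *)
Lemma cheb_expansion_Derive_n (i : nat) (t : R) : -1 < t < 1 ->
  Derive_n f i t = Series (fun k => b k * Derive_n (chebyshev k) i t) /\
  is_derive (Derive_n f i) t (Derive_n f (S i) t).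
Proof.
assert (HD : forall i t, -1 < t < 1 ->
  is_derive (fun y => Series (fun k => b k * Derive_n (chebyshev k) i y)) t
    (Series (fun k => b k * Derive_n (chebyshev k) (S i) t))).
{ intros j y Hy.
  destruct (Derive_n_term_bound (S (S j))) as (g & Hg & H).
  assert (HT : forall m k z, is_derive (fun y => b k * Derive_n (chebyshev k) m y) z
    (b k * Derive_n (chebyshev k) (S m) z)).
  { intros m k z; apply is_derive_scal.
    apply Derive_correct, (polynomial_le_ex_derive k).
    apply polynomial_le_Derive_n, polynomial_le_chebyshev. }
  apply (is_derive_series (fun k y => b k * Derive_n (chebyshev k) j y)
    (fun k y => b k * Derive_n (chebyshev k) (S j) y)
    (fun k y => b k * Derive_n (chebyshev k) (S (S j)) y) g (-1) 1); auto.
  - intros; apply ex_series_Derive_n; assumption.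
  - apply ex_series_Derive_n; lra. }
assert (HE : forall i t, -1 < t < 1 ->
  Derive_n f i t = Series (fun k => b k * Derive_n (chebyshev k) i t)).
{ induction i0 as [|j IH]; intros y Hy; [apply cheb_expansion; lra|].
  change (Derive_n f (S j) y) with (Derive (Derive_n f j) y).
  rewrite (Derive_ext_loc _ (fun y => Series (fun k => b k * Derive_n (chebyshev k) j y))).
  - apply is_derive_unique, HD, Hy.
  - generalize (locally_open_interval (-1) 1 y Hy); apply filter_imp; exact IH. }
intros Ht; split; [apply HE, Ht|].
rewrite HE by exact Ht.
apply is_derive_ext_loc with (2 := HD i t Ht).
generalize (locally_open_interval (-1) 1 t Ht); apply filter_imp; intros y Hy; symmetry; apply HE, Hy.
Qed.

Lemma is_lim_seq_sum_n_m (u : nat -> nat -> R) (v : nat -> R) (m N : nat) :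
  (forall k, (m <= k <= N)%nat -> is_lim_seq (fun j => u j k) (v k)) ->
  is_lim_seq (fun j => sum_n_m (u j) m N) (sum_n_m v m N).
Proof.
intros H; induction N as [|N IH].
- destruct m as [|m].
  + rewrite sum_n_n; apply is_lim_seq_ext with (fun j => u j O).
    * intros; rewrite sum_n_n; reflexivity.
    * apply H; lia.
  + rewrite sum_n_m_zero by lia; apply is_lim_seq_ext with (fun _ => 0).
    * intros; rewrite sum_n_m_zero by lia; reflexivity.
    * apply is_lim_seq_const.
- destruct (Nat.le_gt_cases m (S N)) as [Hm|Hm].
  + rewrite sum_n_Sm by lia.
    apply is_lim_seq_ext with (fun j => sum_n_m (u j) m N + u j (S N)).
    * intros; rewrite sum_n_Sm by lia; reflexivity.
    * apply is_lim_seq_plus'; [apply IH; intros; apply H; lia|apply H; lia].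
  + rewrite sum_n_m_zero by lia; apply is_lim_seq_ext with (fun _ => 0).
    * intros; rewrite sum_n_m_zero by lia; reflexivity.
    * apply is_lim_seq_const.
Qed.

Lemma real_remainder_limit (n s : nat) (xi : nat -> R) (l : nat -> nat -> R -> R) :
  (1 <= n)%nat -> (1 <= s)%nat -> chebyshev_zeros n xi -> hermite_fundamental n s xi l ->
  is_lim_seq (fun J => sum_n (fun j => PI / 2 *
      (b ((2 * s + 1) * n + 2 * n * j)%nat * alt_coef s j)) J)
    (real_remainder n s xi l f).
Proof.
intros Hn Hs Hz Hl.
assert (H1 : is_lim_seq (fun N => real_remainder n s xi l (cheb_partial b N))
  (real_remainder n s xi l f)).
{ unfold real_remainder.
  apply is_lim_seq_minus'.
  - apply is_lim_seq_ext_loc with (fun _ => cheb_integral n f); [|apply is_lim_seq_const].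
    exists n; intros N HN; symmetry; apply cheb_partial_integral, HN.
  - apply is_lim_seq_sum_n_m; intros nu Hnu.
    apply is_lim_seq_sum_n_m; intros i Hi.
    apply (is_lim_seq_scal_l _ _ (Finite _)).
    destruct Hz as [Hz _]; destruct (Hz nu Hnu) as [Hb _].
    destruct (cheb_expansion_Derive_n i (xi nu) Hb) as [-> _].
    apply is_lim_seq_ext with (sum_n (fun k => b k * Derive_n (chebyshev k) i (xi nu))).
    + intros N; symmetry; apply (poly_linear_cheb_partial (fun p => Derive_n p i (xi nu))).
      apply poly_linear_Derive_n.
    + apply (Series_correct (fun k => b k * Derive_n (chebyshev k) i (xi nu))).
      apply ex_series_Derive_n; lra. }
(* Between two points of the comb the partial sums do not change the remainder, so they are sampled
   where a new nonzero term may enter. *)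
assert (H2 := is_lim_seq_subseq _ _ (fun J => (2 * s + 1) * n + 2 * n * J)%nat
  (eventually_subseq (fun J => (2 * s + 1) * n + 2 * n * J)%nat ltac:(intros; cbv beta; nia)) H1).
apply is_lim_seq_ext with (2 := H2); intros J.
rewrite (poly_linear_cheb_partial (real_remainder n s xi l))
  by apply poly_linear_real_remainder.
rewrite (sum_n_ext _ (fun k => (PI / 2 * b k) *
  comb n (alt_coef s) (Z.of_nat ((2 * s + 1) * n)) (Z.of_nat k))).
- rewrite sum_n_comb by exact Hn.
  apply sum_n_ext; intros j; apply Rmult_assoc.
- intros k; replace (chebyshev k) with (zchebyshev (Z.of_nat k))
    by (unfold zchebyshev; rewrite Zabs2Nat.id; reflexivity).
  rewrite real_remainder_zchebyshev by assumption.
  replace (Z.abs (Z.of_nat k)) with (Z.of_nat k) by lia; to_R; ring.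
Qed.

End Expansion.

(** * Complex differentiation *)

(** A form of complex differentiability that does not depend on the choice of a normed module on
    [C]. *)
Definition cderiv (f : C -> C) (z L : C) : Prop :=
  forall eps, 0 < eps -> exists del, 0 < del /\ forall w, Cmod (w - z) < del ->
    Cmod (f w - f z - (w - z) * L) <= eps * Cmod (w - z).

Lemma cderiv_is_derive (f : C -> C) (z L : C) :
  cderiv f z L <-> is_derive (K := C_AbsRing) (V := C_NormedModule) f z L.
Proof.
split.
- intros H; split; [apply (is_linear_scal_l (K := C_AbsRing) (V := C_NormedModule))|].
  intros x Hx eps.
  apply (is_filter_lim_locally_unique (K := C_AbsRing) (V := AbsRing_NormedModule C_AbsRing)) in Hx.
  subst x; destruct (H eps (cond_pos eps)) as (del & Hdel & Hd).
  exists (mkposreal del Hdel); intros w Hw; apply (Hd w Hw).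
- intros [_ H] eps Heps.
  destruct (H z (fun P HP => HP) (mkposreal eps Heps)) as [del Hd].
  exists del; split; [apply cond_pos|]; intros w Hw; apply (Hd w Hw).
Qed.

(* Coquelicot's chain and product rules are stated in the normed module
   induced by the absolute value, which is not convertible to [C_NormedModule]. *)
Lemma cderiv_is_derive_abs (f : C -> C) (z L : C) :
  cderiv f z L <->
  is_derive (K := C_AbsRing) (V := AbsRing_NormedModule C_AbsRing) f z L.
Proof.
split.
- intros H; split;
    [apply (is_linear_scal_l (K := C_AbsRing) (V := AbsRing_NormedModule C_AbsRing))|].
  intros x Hx eps.
  apply (is_filter_lim_locally_unique (K := C_AbsRing) (V := AbsRing_NormedModule C_AbsRing)) in Hx.
  subst x; destruct (H eps (cond_pos eps)) as (del & Hdel & Hd).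
  exists (mkposreal del Hdel); intros w Hw; apply (Hd w Hw).
- intros [_ H] eps Heps.
  destruct (H z (fun P HP => HP) (mkposreal eps Heps)) as [del Hd].
  exists del; split; [apply cond_pos|]; intros w Hw; apply (Hd w Hw).
Qed.

Lemma cderiv_comp (f g : C -> C) (z df dg : C) :
  cderiv f (g z) df -> cderiv g z dg -> cderiv (fun w => f (g w)) z (Cmult dg df).
Proof.
rewrite !cderiv_is_derive_abs; intros Hf Hg.
exact (is_derive_comp (K := C_AbsRing) (V := AbsRing_NormedModule C_AbsRing) f g z df dg Hf Hg).
Qed.

Lemma cderiv_mult (f g : C -> C) (z df dg : C) :
  cderiv f z df -> cderiv g z dg ->
  cderiv (fun w => Cmult (f w) (g w)) z (Cplus (Cmult df (g z)) (Cmult (f z) dg)).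
Proof.
rewrite !cderiv_is_derive_abs; intros Hf Hg.
exact (is_derive_mult (K := C_AbsRing) f g z df dg Hf Hg Cmult_comm).
Qed.

Lemma cderiv_plus (f g : C -> C) (z df dg : C) :
  cderiv f z df -> cderiv g z dg ->
  cderiv (fun w => Cplus (f w) (g w)) z (Cplus df dg).
Proof.
rewrite !cderiv_is_derive_abs; intros Hf Hg.
exact (is_derive_plus (K := C_AbsRing) (V := AbsRing_NormedModule C_AbsRing) f g z df dg Hf Hg).
Qed.

Lemma cderiv_scal (c z : C) : cderiv (fun w => Cmult c w) z c.
Proof.
intros eps Heps; exists 1; split; [lra|]; intros w _.
replace (c * w - c * z - (w - z) * c)%C with (RtoC 0) by ring.
rewrite Cmod_0; apply Rmult_le_pos; [lra|apply Cmod_ge_0].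
Qed.

Lemma cderiv_const_mult (f : C -> C) (c z df : C) :
  cderiv f z df -> cderiv (fun w => Cmult c (f w)) z (Cmult df c).
Proof. intros H; apply (cderiv_comp (fun w => Cmult c w) f); [apply cderiv_scal|exact H]. Qed.

Definition cexp (z : C) : C := (exp (fst z) * cos (snd z), exp (fst z) * sin (snd z)).

Lemma cexp_plus (z w : C) : cexp (z + w) = (cexp z * cexp w)%C.
Proof.
destruct z as [x y], w as [u v]; unfold cexp, Cmult, Cplus; simpl.
rewrite exp_plus, cos_plus, sin_plus; f_equal; ring.
Qed.

Lemma Cmod_le_abs (z : C) : Cmod z <= Rabs (fst z) + Rabs (snd z).
Proof.
destruct z as [x y]; simpl.
replace (x, y) with (Cplus (RtoC x) (Ci * RtoC y)).
2:{ unfold Cplus, Cmult, RtoC, Ci; simpl; f_equal; ring. }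
eapply Rle_trans; [apply Cmod_triangle|].
rewrite Cmod_mult, !Cmod_R.
replace (Cmod Ci) with 1; [lra|].
unfold Cmod, Ci; simpl.
replace (0 * (0 * 1) + 1 * (1 * 1)) with 1 by ring; symmetry; apply sqrt_1.
Qed.

Lemma Rabs_fst_le (z : C) : Rabs (fst z) <= Cmod z.
Proof. eapply Rle_trans; [apply Rmax_l|apply Rmax_Cmod]. Qed.

Lemma Rabs_snd_le (z : C) : Rabs (snd z) <= Cmod z.
Proof. eapply Rle_trans; [apply Rmax_r|apply Rmax_Cmod]. Qed.

Lemma is_derive_linear_bound (g : R -> R) (x l : R) : is_derive g x l ->
  forall eps, 0 < eps -> exists del, 0 < del /\ forall h, Rabs h < del ->
    Rabs (g (x + h) - g x - h * l) <= eps * Rabs h.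
Proof.
intros H eps Heps; apply is_derive_Reals in H.
destruct (H eps Heps) as [del Hd]; exists del; split; [apply cond_pos|].
intros h Hh; destruct (Req_dec h 0) as [->|Hh0].
- rewrite Rplus_0_r, Rabs_R0; replace (g x - g x - 0 * l) with 0 by ring.
  rewrite Rabs_R0; lra.
- specialize (Hd h Hh0 Hh).
  replace (g (x + h) - g x - h * l) with (((g (x + h) - g x) / h - l) * h)
    by (field; assumption).
  rewrite Rabs_mult; apply Rmult_le_compat_r; [apply Rabs_pos|lra].
Qed.

Lemma cexp_cderiv_0 : cderiv cexp 0 1.
Proof.
intros eps Heps.
(* The components err by [3 eta] and [5 eta] times [|x| + |y| <= 2 |w|], in all [16 eta |w|], which
   is below [eps |w|]. *)
set (eta := Rmin 1 (eps / 20)).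
assert (Heta : 0 < eta <= 1 /\ eta <= eps / 20).
{ unfold eta; generalize (Rmin_l 1 (eps / 20)) (Rmin_r 1 (eps / 20)).
  repeat split; try apply Rmin_glb_lt; lra. }
assert (De : is_derive exp 0 1) by (auto_derive; [exact I|rewrite exp_0; ring]).
assert (Dc : is_derive cos 0 0) by (auto_derive; [exact I|rewrite sin_0; ring]).
assert (Ds : is_derive sin 0 1) by (auto_derive; [exact I|rewrite cos_0; ring]).
destruct (is_derive_linear_bound _ _ _ De eta) as (d1 & Hd1 & B1); [lra|].
destruct (is_derive_linear_bound _ _ _ Dc eta) as (d2 & Hd2 & B2); [lra|].
destruct (is_derive_linear_bound _ _ _ Ds eta) as (d3 & Hd3 & B3); [lra|].
set (del := Rmin (Rmin d1 d2) (Rmin d3 eta)).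
assert (Hdel : 0 < del /\ del <= d1 /\ del <= d2 /\ del <= d3 /\ del <= eta).
{ unfold del.
  generalize (Rmin_l (Rmin d1 d2) (Rmin d3 eta)) (Rmin_r (Rmin d1 d2) (Rmin d3 eta))
    (Rmin_l d1 d2) (Rmin_r d1 d2) (Rmin_l d3 eta) (Rmin_r d3 eta).
  repeat split; repeat apply Rmin_glb_lt; lra. }
exists del; split; [apply Hdel|]; intros w Hw.
replace (w - 0)%C with w in * by ring.
assert (Hx := Rabs_fst_le w); assert (Hy := Rabs_snd_le w).
destruct w as [x y]; simpl fst in *; simpl snd in *.
specialize (B1 x ltac:(lra)); specialize (B2 y ltac:(lra)); specialize (B3 y ltac:(lra)).
rewrite Rplus_0_l, exp_0 in B1; rewrite Rplus_0_l, cos_0 in B2; rewrite Rplus_0_l, sin_0 in B3.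
eapply Rle_trans; [apply Cmod_le_abs|].
assert (HA : Rabs (exp x * cos y - 1 - x) <= 3 * eta * (Rabs x + Rabs y)).
{ replace (exp x * cos y - 1 - x) with
    ((exp x - 1 - x * 1) * cos y + (1 + x) * (cos y - 1 - y * 0)) by ring.
  eapply Rle_trans; [apply Rabs_triang|]; rewrite !Rabs_mult.
  assert (Rabs (cos y) <= 1) by (apply Rabs_le, COS_bound).
  assert (Rabs (1 + x) <= 2).
  { apply Rabs_le; assert (Hx1 : Rabs x < 1) by lra; apply Rabs_lt_between in Hx1; lra. }
  assert (Rabs (exp x - 1 - x * 1) * Rabs (cos y) <= (eta * Rabs x) * 1)
    by (apply Rmult_le_compat; try apply Rabs_pos; assumption).
  assert (Rabs (1 + x) * Rabs (cos y - 1 - y * 0) <= 2 * (eta * Rabs y))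
    by (apply Rmult_le_compat; try apply Rabs_pos; assumption).
  assert (0 <= eta * Rabs x) by (apply Rmult_le_pos; [lra|apply Rabs_pos]).
  assert (0 <= eta * Rabs y) by (apply Rmult_le_pos; [lra|apply Rabs_pos]).
  lra. }
assert (HB : Rabs (exp x * sin y - y) <= 5 * eta * (Rabs x + Rabs y)).
{ replace (exp x * sin y - y) with
    (exp x * (sin y - 0 - y * 1) + (exp x - 1) * y) by ring.
  eapply Rle_trans; [apply Rabs_triang|]; rewrite !Rabs_mult.
  assert (Hex : Rabs (exp x - 1) <= 2 * eta).
  { replace (exp x - 1) with ((exp x - 1 - x * 1) + x) by ring.
    eapply Rle_trans; [apply Rabs_triang|].
    assert (eta * Rabs x <= 1 * Rabs x) by (apply Rmult_le_compat_r; [apply Rabs_pos|lra]).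
    lra. }
  assert (Rabs (exp x) <= 3).
  { apply Rabs_le_between in Hex; apply Rabs_le; lra. }
  assert (Rabs (exp x) * Rabs (sin y - 0 - y * 1) <= 3 * (eta * Rabs y))
    by (apply Rmult_le_compat; try apply Rabs_pos; assumption).
  assert (Rabs (exp x - 1) * Rabs y <= 2 * eta * Rabs y)
    by (apply Rmult_le_compat; try apply Rabs_pos; lra).
  assert (0 <= eta * Rabs x) by (apply Rmult_le_pos; [lra|apply Rabs_pos]).
  assert (0 <= eta * Rabs y) by (apply Rmult_le_pos; [lra|apply Rabs_pos]).
  lra. }
unfold cexp; simpl.
rewrite exp_0, cos_0, sin_0.
replace (exp x * cos y + - (1 * 1) + - (x * 1 - y * 0)) with (exp x * cos y - 1 - x) by ring.
replace (exp x * sin y + - (1 * 0) + - (x * 0 + y * 1)) with (exp x * sin y - y) by ring.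
set (m := Cmod (x, y)) in *.
assert (eta * (Rabs x + Rabs y) <= eps / 20 * (2 * m)).
{ apply Rmult_le_compat; try lra; generalize (Rabs_pos x) (Rabs_pos y); lra. }
assert (0 <= eps * m) by (apply Rmult_le_pos; [lra|apply Cmod_ge_0]).
lra.
Qed.

Lemma cexp_cderiv (z : C) : cderiv cexp z (cexp z).
Proof.
intros eps Heps; assert (Hp := Cmod_ge_0 (cexp z)).
destruct (cexp_cderiv_0 (eps / (Cmod (cexp z) + 1))) as (del & Hdel & H).
{ apply Rdiv_lt_0_compat; lra. }
exists del; split; [exact Hdel|]; intros w Hw.
specialize (H (w - z)%C); replace (w - z - 0)%C with (w - z)%C in H by ring.
specialize (H Hw).
replace w with (z + (w - z))%C at 1 by ring; rewrite cexp_plus.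
replace (cexp z * cexp (w - z) - cexp z - (w - z) * cexp z)%C with
  (cexp z * (cexp (w - z) - cexp 0 - (w - z) * 1))%C.
2:{ replace (cexp 0) with (RtoC 1); [ring|].
    unfold cexp; simpl; rewrite exp_0, cos_0, sin_0; unfold RtoC; f_equal; ring. }
rewrite Cmod_mult.
apply Rle_trans with (Cmod (cexp z) * (eps / (Cmod (cexp z) + 1) * Cmod (w - z))).
- apply Rmult_le_compat_l; assumption.
- rewrite <- Rmult_assoc; apply Rmult_le_compat_r; [apply Cmod_ge_0|].
  apply Rmult_le_reg_r with (Cmod (cexp z) + 1); [lra|].
  replace (Cmod (cexp z) * (eps / (Cmod (cexp z) + 1)) * (Cmod (cexp z) + 1))
    with (Cmod (cexp z) * eps) by (field; lra).
  nra.
Qed.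

Definition ccosh (z : C) : C := (RtoC (/ 2) * (cexp z + cexp (RtoC (-1) * z)))%C.

Lemma ccosh_cderiv (z : C) : exists L, cderiv ccosh z L.
Proof.
eexists; apply cderiv_const_mult, cderiv_plus; [apply cexp_cderiv|].
apply (cderiv_comp cexp (fun w => Cmult (RtoC (-1)) w)); [apply cexp_cderiv|apply cderiv_scal].
Qed.

Lemma ccoshE (x y : R) : ccosh (x, y) =
  ((exp x + exp (- x)) / 2 * cos y, (exp x - exp (- x)) / 2 * sin y).
Proof.
unfold ccosh, cexp, Cmult, Cplus, RtoC; simpl.
replace (-1 * x - 0 * y) with (- x) by ring.
replace (-1 * y + 0 * x) with (- y) by ring.
rewrite cos_neg, sin_neg; f_equal; field.
Qed.

Ltac rabs_ring H := match goal with |- Rabs ?a <= _ =>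
  match type of H with Rabs ?b <= _ => replace a with b by ring; exact H end end.

(** The two forms are the real and the imaginary part of [g dz]; the Cauchy-Riemann equations make
    them closed. *)
Lemma cderiv_closed_form (g : C -> C) (x y : R) (L : C) : cderiv g (x, y) L ->
  closed_form_at (fun u v => fst (g (u, v))) (fun u v => - snd (g (u, v))) x y /\
  closed_form_at (fun u v => snd (g (u, v))) (fun u v => fst (g (u, v))) x y.
Proof.
intros H; destruct L as [a b].
assert (HB : forall eps, 0 < eps -> exists del, 0 < del /\
    forall u v, Rabs (u - x) < del -> Rabs (v - y) < del ->
      Rabs (fst (g (u, v)) - fst (g (x, y)) - (a * (u - x) - b * (v - y)))
        <= eps * (Rabs (u - x) + Rabs (v - y)) /\
      Rabs (snd (g (u, v)) - snd (g (x, y)) - (b * (u - x) + a * (v - y)))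
        <= eps * (Rabs (u - x) + Rabs (v - y))).
{ intros eps Heps; destruct (H eps Heps) as (del & Hdel & Hd).
  exists (del / 2); split; [lra|]; intros u v Hu Hv.
  assert (Hm : Cmod ((u, v) - (x, y)) <= Rabs (u - x) + Rabs (v - y))
    by apply (Cmod_le_abs ((u, v) - (x, y))).
  specialize (Hd (u, v) ltac:(lra)).
  assert (Hm' : eps * Cmod ((u, v) - (x, y)) <= eps * (Rabs (u - x) + Rabs (v - y)))
    by (apply Rmult_le_compat_l; lra).
  set (z := (g (u, v) - g (x, y) - ((u, v) - (x, y)) * (a, b))%C) in *.
  assert (E1 := Rabs_fst_le z); assert (E2 := Rabs_snd_le z).
  replace (fst (g (u, v)) - fst (g (x, y)) - (a * (u - x) - b * (v - y))) with (fst z)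
    by (unfold z; simpl; ring).
  replace (snd (g (u, v)) - snd (g (x, y)) - (b * (u - x) + a * (v - y))) with (snd z)
    by (unfold z; simpl; ring).
  lra. }
split.
- exists a, (- b), (- a); intros eps Heps; destruct (HB eps Heps) as (del & Hdel & Hd).
  exists del; split; [exact Hdel|]; intros u v Hu Hv; destruct (Hd u v Hu Hv) as [A B].
  split; [|rewrite <- Rabs_Ropp].
  + rabs_ring A.
  + rabs_ring B.
- exists b, a, (- b); intros eps Heps; destruct (HB eps Heps) as (del & Hdel & Hd).
  exists del; split; [exact Hdel|]; intros u v Hu Hv; destruct (Hd u v Hu Hv) as [A B].
  split.
  + rabs_ring B.
  + rabs_ring A.
Qed.

(** In the circulation around the rectangle the horizontal sides cancel by periodicity, which leaves
    the two vertical ones. *)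
Lemma periodic_strip_integral (g : C -> C) (a b T : R) : a <= b -> 0 <= T ->
  (forall x y, a <= x <= b -> 0 <= y <= T -> exists L, cderiv g (x, y) L) ->
  (forall x, g (x, T) = g (x, 0)) ->
  RInt (fun y => fst (g (a, y))) 0 T = RInt (fun y => fst (g (b, y))) 0 T /\
  RInt (fun y => snd (g (a, y))) 0 T = RInt (fun y => snd (g (b, y))) 0 T.
Proof.
intros Hab HT Hg Hper.
assert (H : forall P Q : R -> R -> R,
  (forall x y, a <= x <= b -> 0 <= y <= T -> closed_form_at P Q x y) ->
  (forall x, P x T = P x 0) ->
  RInt (fun y => Q a y) 0 T = RInt (fun y => Q b y) 0 T).
{ intros P Q HPQ HP.
  assert (E := circulation_closed P Q a b 0 T HPQ Hab HT); unfold circulation in E.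
  rewrite (RInt_ext (fun x => P x 0 - P x T) (fun _ => 0)) in E
    by (intros; rewrite HP; to_R; ring).
  rewrite RInt_const, (RInt_minus (V := R_CompleteNormedModule)) in E
    by (apply (ex_RInt_closed_Q P Q a b 0 T); auto; lra).
  revert E; to_R; intros E; change (RInt (Q a) 0 T = RInt (Q b) 0 T :> R); lra. }
split.
- apply (H (fun u v => snd (g (u, v))) (fun u v => fst (g (u, v)))).
  + intros x y Hx Hy; destruct (Hg x y Hx Hy) as [L HL].
    apply (cderiv_closed_form g x y L HL).
  + intros x; rewrite Hper; reflexivity.
- assert (HP : forall x y, a <= x <= b -> 0 <= y <= T ->
     closed_form_at (fun u v => fst (g (u, v))) (fun u v => - snd (g (u, v))) x y).
  { intros x y Hx Hy; destruct (Hg x y Hx Hy) as [L HL].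
    apply (cderiv_closed_form g x y L HL). }
  assert (E := H _ _ HP ltac:(intros x; cbv beta; rewrite Hper; reflexivity)); cbv beta in E.
  assert (Hex : forall x, a <= x <= b -> ex_RInt (fun y => snd (g (x, y))) 0 T).
  { intros x Hx; apply (ex_RInt_ext (V := R_NormedModule) (fun y => opp (- snd (g (x, y))))).
    { intros; to_R; apply Ropp_involutive. }
    apply (ex_RInt_opp (V := R_NormedModule)).
    apply (ex_RInt_closed_Q _ _ a b 0 T HP); lra. }
  rewrite !(RInt_opp (V := R_CompleteNormedModule)) in E by (apply Hex; lra).
  revert E; to_R; intros E; apply Ropp_eq_reg; exact E.
Qed.

(** Estimating the components separately would lose a factor [sqrt 2]. Instead the vector integral
    is paired with itself, [m * m] being the integral of [I * u + J * v], and Cauchy-Schwarz is used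
    under the integral sign. *)
Lemma Cmod_RInt_le (u v : R -> R) (a b B : R) : a <= b -> 0 <= B ->
  (forall x, a <= x <= b -> continuous u x) ->
  (forall x, a <= x <= b -> continuous v x) ->
  (forall x, a <= x <= b -> Cmod (u x, v x) <= B) ->
  Cmod ((RInt u a b : R), (RInt v a b : R)) <= B * (b - a).
Proof.
intros Hab HB Hu Hv H.
set (I := RInt u a b : R); set (J := RInt v a b : R); set (m := Cmod (I, J)).
assert (Hsq : forall x y, Cmod (x, y) * Cmod (x, y) = x * x + y * y).
{ intros x y; unfold Cmod; simpl; rewrite sqrt_sqrt; [ring|nra]. }
assert (Hm0 : 0 <= m) by apply Cmod_ge_0.
assert (Eu : ex_RInt u a b) by (apply ex_RInt_continuous_le; assumption).
assert (Ev : ex_RInt v a b) by (apply ex_RInt_continuous_le; assumption).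
assert (Hm : m * m <= m * B * (b - a)).
{ unfold m at 1 2; rewrite Hsq.
  replace (I * I + J * J) with (RInt (fun x => plus (scal I (u x)) (scal J (v x))) a b).
  - apply Rle_trans with (RInt (fun _ => m * B) a b).
    + apply RInt_le; [assumption| |apply ex_RInt_const|].
      * apply (ex_RInt_plus (V := R_NormedModule));
          apply (ex_RInt_scal (V := R_NormedModule)); assumption.
      * intros x Hx; specialize (H x ltac:(lra)); to_R.
        apply Rle_trans with (m * Cmod (u x, v x)); [|apply Rmult_le_compat_l; assumption].
        apply Rsqr_incr_0_var; [|apply Rmult_le_pos; [assumption|apply Cmod_ge_0]].
        unfold Rsqr.
        replace (m * Cmod (u x, v x) * (m * Cmod (u x, v x))) with
          ((m * m) * (Cmod (u x, v x) * Cmod (u x, v x))) by ring.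
        unfold m; rewrite !Hsq.
        generalize (Rle_0_sqr (I * v x - J * u x)); unfold Rsqr; lra.
    + rewrite RInt_const; to_R; lra.
  - rewrite (RInt_plus (V := R_CompleteNormedModule)) by
      (apply (ex_RInt_scal (V := R_NormedModule)); assumption).
    rewrite !(RInt_scal (V := R_CompleteNormedModule)) by assumption.
    reflexivity. }
change (m <= B * (b - a)).
destruct (Req_dec m 0) as [E|E]; [rewrite E; apply Rmult_le_pos; lra|].
apply Rmult_le_reg_l with m; lra.
Qed.

(** * Chebyshev coefficients of functions analytic in an ellipse *)

Section Ellipse.
Variable rho : R.
Hypothesis rho_gt1 : 1 < rho.
Let A := (rho + / rho) / 2.
Let B := (rho - / rho) / 2.

Lemma semi_axes : 1 < A /\ 0 < B.
Proof.
assert (0 < / rho) by (apply Rinv_0_lt_compat; lra).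
assert (E : rho * / rho = 1) by (apply Rinv_r; lra).
unfold A, B; nra.
Qed.

Lemma ellipse_form_scal (z : C) (c : R) :
  ellipse_form rho (RtoC c * z) = c ^ 2 * ellipse_form rho z.
Proof.
destruct semi_axes as [HA HB]; unfold ellipse_form; fold A B.
destruct z as [x y]; unfold Re, Im, Cmult, RtoC; simpl; field; lra.
Qed.

(** The closed ellipse is star-shaped about 0: [(1 - t) z] is interior and as close to [z] as
    desired. *)
Lemma closure_ellipse_interior (z : C) :
  ellipse_form rho z <= 1 -> closure (ellipse_interior rho) z.
Proof.
intros Hz eps Heps; assert (Hm := Cmod_ge_0 z).
set (t := Rmin (/ 2) (eps / (2 * (Cmod z + 1)))).
assert (Ht : 0 < t <= / 2 /\ t <= eps / (2 * (Cmod z + 1))).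
{ unfold t; split; [split; [apply Rmin_glb_lt; [lra|apply Rdiv_lt_0_compat; lra]|apply Rmin_l]|apply Rmin_r]. }
exists (RtoC (1 - t) * z)%C; split.
- unfold ellipse_interior; rewrite ellipse_form_scal.
  assert (0 <= ellipse_form rho z).
  { unfold ellipse_form; generalize (pow2_ge_0 (Re z / A)) (pow2_ge_0 (Im z / B));
      unfold A, B; lra. }
  assert ((1 - t) ^ 2 < 1) by (simpl; nra).
  assert (0 <= (1 - t) ^ 2) by apply pow2_ge_0.
  nra.
- replace (RtoC (1 - t) * z - z)%C with (RtoC (- t) * z)%C
    by (unfold Rminus; rewrite RtoC_plus, !RtoC_opp; ring).
  rewrite Cmod_mult, Cmod_R, Rabs_Ropp, Rabs_pos_eq by lra.
  apply Rle_lt_trans with (eps / (2 * (Cmod z + 1)) * (Cmod z + 1)).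
  + apply Rmult_le_compat; lra.
  + replace (eps / (2 * (Cmod z + 1)) * (Cmod z + 1)) with (eps / 2) by (field; lra); lra.
Qed.

(** The line [Re w = x] is sent to the confocal ellipse with semi-axes [cosh x] and [sinh x]; the
    ratios [p] and [q] to the outer semi-axes increase to 1 as [x] reaches [ln rho]. *)
Lemma ellipse_form_ccosh (x y : R) : 0 <= x <= ln rho ->
  ellipse_form rho (ccosh (x, y)) <= 1 /\
  (x < ln rho -> ellipse_form rho (ccosh (x, y)) < 1).
Proof.
intros Hx; destruct semi_axes as [HA HB].
rewrite ccoshE; unfold ellipse_form; fold A B; simpl Re; simpl Im.
set (p := (exp x + exp (- x)) / 2 / A); set (q := (exp x - exp (- x)) / 2 / B).
replace ((exp x + exp (- x)) / 2 * cos y / A) with (p * cos y) by (unfold p; field; lra).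
replace ((exp x - exp (- x)) / 2 * sin y / B) with (q * sin y) by (unfold q; field; lra).
assert (E : rho = exp (ln rho)) by (symmetry; apply exp_ln; lra).
assert (Hsc : (sin y) ^ 2 + (cos y) ^ 2 = 1).
{ generalize (sin2_cos2 y); unfold Rsqr; intros H; rewrite <- H; ring. }
assert (He1 : 1 <= exp x) by (rewrite <- exp_0; destruct (proj1 Hx) as [H| <-];
  [left; apply exp_increasing, H|right; reflexivity]).
assert (He : exp (- x) = / exp x) by apply exp_Ropp.
assert (Hinv : exp x * exp (- x) = 1) by (rewrite He; apply Rinv_r; lra).
assert (Hrho : rho * / rho = 1) by (apply Rinv_r; lra).
assert (Hex0 : 0 < exp (- x)) by apply exp_pos.
assert (Hr0 : 0 < / rho) by (apply Rinv_0_lt_compat; lra).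
assert (Hex1 : exp (- x) <= 1) by (rewrite He; rewrite <- Rinv_1; apply Rinv_le_contravar; lra).
assert (Hq0 : 0 <= q) by (unfold q; apply Rle_mult_inv_pos; lra).
assert (Hp0 : 0 <= p) by (unfold p; apply Rle_mult_inv_pos; lra).
assert (Hs0 := pow2_ge_0 (sin y)); assert (Hc0 := pow2_ge_0 (cos y)).
rewrite !Rpow_mult_distr.
assert (Hlt : x < ln rho -> p < 1 /\ q < 1).
{ intros Hlt; apply exp_increasing in Hlt; rewrite <- E in Hlt.
  assert (/ rho < exp (- x)) by (rewrite He; apply Rinv_lt_contravar; [nra|exact Hlt]).
  split.
  - unfold p; apply Rmult_lt_reg_r with A; [lra|].
    replace ((exp x + exp (- x)) / 2 / A * A) with ((exp x + exp (- x)) / 2) by (field; lra).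
    unfold A.
    assert ((rho - exp x) * (exp (- x) * / rho) = exp (- x) - / rho).
    { transitivity ((rho * / rho) * exp (- x) - (exp x * exp (- x)) * / rho); [ring|].
      rewrite Hrho, Hinv; ring. }
    assert (exp (- x) * / rho < 1) 
      by (apply Rle_lt_trans with (1 * / rho); [apply Rmult_le_compat_r; lra|lra]).
    assert ((rho - exp x) * (exp (- x) * / rho) < (rho - exp x) * 1)
      by (apply Rmult_lt_compat_l; lra).
    lra.
  - unfold q; apply Rmult_lt_reg_r with B; [lra|].
    replace ((exp x - exp (- x)) / 2 / B * B) with ((exp x - exp (- x)) / 2) by (field; lra).
    unfold B; lra. }
assert (Hfin : forall e, p <= e -> q <= e -> 0 <= e -> p ^ 2 * cos y ^ 2 + q ^ 2 * sin y ^ 2 <= e ^ 2).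
{ intros e H1 H2 H3.
  assert (p ^ 2 <= e ^ 2) by (apply pow_incr; lra).
  assert (q ^ 2 <= e ^ 2) by (apply pow_incr; lra).
  replace (e ^ 2) with (e ^ 2 * cos y ^ 2 + e ^ 2 * sin y ^ 2)
    by (rewrite <- Rmult_plus_distr_l, (Rplus_comm (cos y ^ 2)), Hsc; ring).
  apply Rplus_le_compat; apply Rmult_le_compat_r; assumption. }
split.
- replace 1 with (1 ^ 2) by ring; apply Hfin; try lra.
  + destruct (Rle_lt_or_eq_dec _ _ (proj2 Hx)) as [H|H]; [destruct (Hlt H); lra|].
    unfold p; rewrite He, H, <- E; change (A / A <= 1).
    right; apply Rinv_r; lra.
  + destruct (Rle_lt_or_eq_dec _ _ (proj2 Hx)) as [H|H]; [destruct (Hlt H); lra|].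
    unfold q; rewrite He, H, <- E; change (B / B <= 1).
    right; apply Rinv_r; lra.
- intros H; destruct (Hlt H).
  apply Rle_lt_trans with ((Rmax p q) ^ 2).
  + apply Hfin; [apply Rmax_l|apply Rmax_r|].
    eapply Rle_trans; [exact Hp0|apply Rmax_l].
  + assert (0 <= Rmax p q < 1); [|simpl; nra].
    split; [eapply Rle_trans; [exact Hp0|apply Rmax_l]|apply Rmax_lub_lt; lra].
Qed.

Lemma ellipse_ccosh (z : C) : ellipse rho z <->
  exists theta, 0 <= theta <= 2 * PI /\ z = ccosh (ln rho, theta).
Proof.
assert (H : forall theta, ccosh (ln rho, theta) =
  (/ 2 * (RtoC rho * (cos theta, sin theta) + / (RtoC rho * (cos theta, sin theta))))%C).
{ intros theta; rewrite ccoshE, (ellipse_param rho theta rho_gt1).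
  rewrite exp_Ropp, exp_ln by lra; reflexivity. }
split; intros (theta & Ht & E); exists theta; (split; [exact Ht|]).
- rewrite H; exact E.
- cbv zeta; rewrite <- H; exact E.
Qed.

Lemma ellipse_interior_real (t : R) : -1 <= t <= 1 -> ellipse_interior rho (RtoC t).
Proof.
intros Ht; destruct semi_axes as [HA HB].
unfold ellipse_interior, ellipse_form; fold A B; simpl Re; simpl Im.
assert (Hq : -1 < t / A < 1).
{ split; apply Rmult_lt_reg_r with A; try lra; unfold Rdiv;
    rewrite Rmult_assoc, Rinv_l; lra. }
replace (0 / B) with 0 by (field; lra); simpl; nra.
Qed.

Section Function.
Variable f : C -> C.
Hypothesis f_analytic : analytic_on (ellipse_interior rho) f.
Hypothesis f_cont : continuous_on (closure (ellipse_interior rho)) f.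

(* Clamping keeps [ccosh] in the closed ellipse, where [f] is continuous, so that
   lemmas on two-sided continuity apply at the boundary. *)
Definition clamp (x : R) : R := Rmax 0 (Rmin x (ln rho)).

Definition modulus_on_confocal (x y : R) : R := Cmod (f (ccosh (clamp x, y))).

Lemma ln_rho_gt0 : 0 < ln rho.
Proof. rewrite <- ln_1; apply ln_increasing; lra. Qed.

Lemma clamp_bound (x : R) : 0 <= clamp x <= ln rho.
Proof.
assert (H := ln_rho_gt0); unfold clamp; split; [apply Rmax_l|].
apply Rmax_lub; [lra|apply Rmin_r].
Qed.

Lemma clamp_id (x : R) : 0 <= x <= ln rho -> clamp x = x.
Proof.
intros Hx; unfold clamp; rewrite Rmin_left, Rmax_right by lra; reflexivity.
Qed.

Lemma clamp_lipschitz (x u : R) : Rabs (clamp u - clamp x) <= Rabs (u - x).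
Proof.
assert (H := ln_rho_gt0); unfold clamp, Rmax, Rmin, Rabs.
repeat (destruct Rle_dec || destruct Rcase_abs); lra.
Qed.

Lemma cderiv_continuous (g : C -> C) (z L : C) : cderiv g z L ->
  forall eps, 0 < eps -> exists del, 0 < del /\ forall w, Cmod (w - z) < del ->
    Cmod (g w - g z) < eps.
Proof.
intros H eps Heps; destruct (H 1 Rlt_0_1) as (d & Hd & Hb).
assert (HL := Cmod_ge_0 L).
exists (Rmin d (eps / (Cmod L + 2))); split.
{ apply Rmin_glb_lt; [exact Hd|apply Rdiv_lt_0_compat; lra]. }
intros w Hw.
assert (H1 := Rmin_l d (eps / (Cmod L + 2))); assert (H2 := Rmin_r d (eps / (Cmod L + 2))).
specialize (Hb w ltac:(lra)); assert (Hm := Cmod_ge_0 (w - z)).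
replace (g w - g z)%C with ((g w - g z - (w - z) * L) + (w - z) * L)%C by ring.
eapply Rle_lt_trans; [apply Cmod_triangle|]; rewrite Cmod_mult.
assert (Cmod (w - z) * (Cmod L + 2) < eps).
{ replace eps with (eps / (Cmod L + 2) * (Cmod L + 2)) by (field; lra).
  apply Rmult_lt_compat_r; lra. }
lra.
Qed.

Lemma continuity_2d_modulus (x y : R) : continuity_2d_pt modulus_on_confocal x y.
Proof.
intros [eps Heps]; simpl.
set (z := ccosh (clamp x, y)).
assert (Hcl : forall u v, closure (ellipse_interior rho) (ccosh (clamp u, v))).
{ intros u v; apply closure_ellipse_interior, ellipse_form_ccosh, clamp_bound. }
assert (Hf := f_cont z (Hcl x y)).
destruct (proj1 (filterlim_locally _ _) Hf (mkposreal (eps / 2) ltac:(lra)))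
  as [d1 Hd1].
destruct (ccosh_cderiv (clamp x, y)) as [L HL].
destruct (cderiv_continuous _ _ _ HL d1 (cond_pos d1)) as (d2 & Hd2 & Hc).
exists (mkposreal (d2 / 2) ltac:(lra)); intros u v Hu Hv; simpl in Hu, Hv.
specialize (Hc (clamp u, v)).
assert (Hw : Cmod (ccosh (clamp u, v) - z) < d1).
{ apply Hc; eapply Rle_lt_trans; [apply Cmod_le_abs|].
  assert (H1 := clamp_lipschitz x u); simpl.
  change (Rabs (clamp u - clamp x) + Rabs (v - y) < d2); lra. }
assert (Hb : ball (f z) (eps / 2) (f (ccosh (clamp u, v)))).
{ apply Hd1; [|apply Hcl].
  split; apply (Rle_lt_trans _ (Cmod (ccosh (clamp u, v) - z))); try exact Hw.
  - apply (Rabs_fst_le (ccosh (clamp u, v) - z)).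
  - apply (Rabs_snd_le (ccosh (clamp u, v) - z)). }
destruct Hb as [Hb1 Hb2].
change (Rabs (fst (f (ccosh (clamp u, v))) - fst (f z)) < eps / 2) in Hb1.
change (Rabs (snd (f (ccosh (clamp u, v))) - snd (f z)) < eps / 2) in Hb2.
unfold modulus_on_confocal; fold z.
assert (H3 : Cmod (f (ccosh (clamp u, v)) - f z) < eps).
{ eapply Rle_lt_trans; [apply Cmod_le_abs|].
  change (Rabs (fst (f (ccosh (clamp u, v))) - fst (f z)) +
    Rabs (snd (f (ccosh (clamp u, v))) - snd (f z)) < eps); lra. }
apply Rabs_lt_between.
assert (T1 := Cmod_triangle (f (ccosh (clamp u, v)) - f z) (f z)).
assert (T2 := Cmod_triangle (- (f (ccosh (clamp u, v)) - f z)) (f (ccosh (clamp u, v)))).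
rewrite Cmod_opp in T2.
replace (f (ccosh (clamp u, v)) - f z + f z)%C with (f (ccosh (clamp u, v))) in T1 by ring.
replace (- (f (ccosh (clamp u, v)) - f z) + f (ccosh (clamp u, v)))%C with (f z) in T2 by ring.
lra.
Qed.

Lemma max_modulus_exists : exists M, is_max_modulus (ellipse rho) f M.
Proof.
assert (HPI := PI_RGT_0); assert (Hln := ln_rho_gt0).
destruct (continuity_ab_maj (fun y => modulus_on_confocal (ln rho) y) 0 (2 * PI))
  as (tm & Hmax & Htm); [lra| |].
- intros y _; intros eps Heps.
  destruct (continuity_2d_modulus (ln rho) y (mkposreal eps Heps)) as [d Hd].
  exists d; split; [apply cond_pos|]; intros v [_ Hv]; simpl in *.
  apply Hd; [rewrite Rminus_diag, Rabs_R0; apply cond_pos|exact Hv].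
- exists (modulus_on_confocal (ln rho) tm).
  assert (E : forall y, modulus_on_confocal (ln rho) y = Cmod (f (ccosh (ln rho, y)))).
  { intros y; unfold modulus_on_confocal; rewrite clamp_id by lra; reflexivity. }
  split.
  + exists (ccosh (ln rho, tm)); split; [apply ellipse_ccosh; exists tm; auto|].
    symmetry; apply E.
  + intros z Hz; apply ellipse_ccosh in Hz; destruct Hz as (y & Hy & ->).
    rewrite <- E; apply Hmax, Hy.
Qed.

(** * Chebyshev coefficients as integrals over vertical lines *)

Let f1 (t : R) : R := fst (f (RtoC t)).
Let f2 (t : R) : R := snd (f (RtoC t)).

Lemma interior_cderiv (z : C) : ellipse_interior rho z -> exists L, cderiv f z L.
Proof.
intros Hz; destruct (f_analytic z Hz) as [L HL]; exists L; apply cderiv_is_derive, HL.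
Qed.

Lemma continuous_components (t : R) : -1 <= t <= 1 -> continuous f1 t /\ continuous f2 t.
Proof.
intros Ht; destruct (interior_cderiv _ (ellipse_interior_real t Ht)) as [L HL].
assert (HC := cderiv_continuous _ _ _ HL).
assert (H : forall eps, 0 < eps -> exists del : posreal, forall u, Rabs (u - t) < del ->
  Cmod (f (RtoC u) - f (RtoC t)) < eps).
{ intros eps Heps; destruct (HC eps Heps) as (d & Hd & Hb).
  exists (mkposreal d Hd); intros u Hu; apply Hb.
  rewrite <- RtoC_minus, Cmod_R; exact Hu. }
split; apply filterlim_locally; intros [eps Heps]; destruct (H eps Heps) as [d Hd];
  exists d; intros u Hu; specialize (Hd u Hu);
  eapply Rle_lt_trans; [|exact Hd| |exact Hd].
- apply (Rabs_fst_le (f (RtoC u) - f (RtoC t))).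
- apply (Rabs_snd_le (f (RtoC u) - f (RtoC t))).
Qed.

(** With [u = e^w], the integral over a vertical segment of length [2 PI] is [2 PI] times the [k]-th
    Laurent coefficient of [f ((u + 1/u) / 2)]. *)
Definition laurent_integrand (k : nat) (w : C) : C :=
  (f (ccosh w) * cexp (RtoC (- INR k) * w))%C.

Lemma laurent_integrand_cderiv (k : nat) (x y : R) : 0 <= x < ln rho ->
  exists L, cderiv (laurent_integrand k) (x, y) L.
Proof.
intros Hx; destruct (interior_cderiv (ccosh (x, y))) as [L HL].
{ apply (ellipse_form_ccosh x y); lra. }
destruct (ccosh_cderiv (x, y)) as [L' HL'].
eexists; apply cderiv_mult.
- apply (cderiv_comp f ccosh); [exact HL|exact HL'].
- apply (cderiv_comp cexp (fun w => Cmult (RtoC (- INR k)) w));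
    [apply cexp_cderiv|apply cderiv_scal].
Qed.

Lemma laurent_integrandE (k : nat) (x y : R) : laurent_integrand k (x, y) =
  (f (ccosh (x, y)) * (RtoC (exp (- INR k * x)) * (cos (INR k * y), (- sin (INR k * y))%R)))%C.
Proof.
unfold laurent_integrand; f_equal; unfold cexp, Cmult, RtoC; simpl.
replace (- INR k * x - 0 * y) with (- INR k * x) by ring.
replace (- INR k * y + 0 * x) with (- (INR k * y)) by ring.
rewrite cos_neg, sin_neg; f_equal; ring.
Qed.

Lemma laurent_integrand_periodic (k : nat) (x : R) :
  laurent_integrand k (x, 2 * PI) = laurent_integrand k (x, 0).
Proof.
rewrite !laurent_integrandE, !ccoshE.
assert (E := cos_period 0 k); assert (E' := sin_period 0 k).
rewrite Rplus_0_l in E, E'.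
replace (INR k * (2 * PI)) with (2 * INR k * PI) by ring.
rewrite Rmult_0_r, E, E', cos_2PI, sin_2PI, cos_0, sin_0; reflexivity.
Qed.

Lemma RInt_reflect (h : R -> R) : (forall y, continuous h y) ->
  RInt h 0 (2 * PI) = RInt (fun y => h y + h (2 * PI - y)) 0 PI.
Proof.
intros Hh.
assert (Hr : forall y, continuous (fun y => h (2 * PI - y)) y).
{ intros y; apply (continuous_comp (fun y => 2 * PI - y) h); [|apply Hh].
  apply (ex_derive_continuous (K := R_AbsRing) (V := R_NormedModule)).
  auto_derive; exact I. }
rewrite (RInt_plus (V := R_CompleteNormedModule)) by (apply ex_RInt_continuous_all; assumption).
rewrite <- (RInt_Chasles (V := R_CompleteNormedModule) h 0 PI (2 * PI))
  by (apply ex_RInt_continuous_all; assumption).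
f_equal.
assert (E := RInt_comp_lin (V := R_CompleteNormedModule) h (-1) (2 * PI) 0 PI).
replace (-1 * 0 + 2 * PI) with (2 * PI) in E by ring.
replace (-1 * PI + 2 * PI) with PI in E by ring.
rewrite <- (opp_RInt_swap (V := R_CompleteNormedModule)), <- E
  by (apply ex_RInt_continuous_all; assumption).
rewrite <- (RInt_opp (V := R_CompleteNormedModule)).
- apply RInt_ext; intros y _; to_R.
  replace (-1 * y + 2 * PI) with (2 * PI - y) by ring; ring.
- apply ex_RInt_continuous_all; intros y.
  apply (continuous_scal_r (K := R_AbsRing) (V := R_NormedModule) (-1) (fun y => h (-1 * y + 2 * PI))).
  apply (continuous_comp (fun y => -1 * y + 2 * PI) h); [|apply Hh].
  apply (ex_derive_continuous (K := R_AbsRing) (V := R_NormedModule)).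
  auto_derive; exact I.
Qed.

(** On [Re w = 0] the argument of [f] is [cos y]. Adding the values at [y] and [2 PI - y] cancels
    the sine part and doubles [cos (k y) = T_k (cos y)]. *)
Lemma laurent_integral_0 (k : nat) :
  RInt (fun y => fst (laurent_integrand k (0, y))) 0 (2 * PI) = 2 * cheb_integral k f1 /\
  RInt (fun y => snd (laurent_integrand k (0, y))) 0 (2 * PI) = 2 * cheb_integral k f2.
Proof.
assert (E : forall y, laurent_integrand k (0, y) =
  (f1 (cos y) * cos (INR k * y) + f2 (cos y) * sin (INR k * y),
   f2 (cos y) * cos (INR k * y) - f1 (cos y) * sin (INR k * y))).
{ intros y; rewrite laurent_integrandE, ccoshE.
  rewrite Rmult_0_r, Ropp_0, exp_0.
  replace ((1 + 1) / 2 * cos y, (1 - 1) / 2 * sin y) with (RtoC (cos y))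
    by (unfold RtoC; f_equal; field).
  unfold f1, f2; destruct (f (RtoC (cos y))) as [u v].
  unfold Cmult, RtoC; simpl; f_equal; ring. }
assert (C1 : forall y, continuous (fun y => f1 (cos y)) y)
  by (apply continuous_comp_cos; intros; apply continuous_components; assumption).
assert (C2 : forall y, continuous (fun y => f2 (cos y)) y)
  by (apply continuous_comp_cos; intros; apply continuous_components; assumption).
assert (Cc : forall y, continuous (fun y => cos (INR k * y)) y).
{ intros y; apply (ex_derive_continuous (K := R_AbsRing) (V := R_NormedModule)).
  auto_derive; exact I. }
assert (Cs : forall y, continuous (fun y => sin (INR k * y)) y).
{ intros y; apply (ex_derive_continuous (K := R_AbsRing) (V := R_NormedModule)).
  auto_derive; exact I. }
assert (Hc : forall y, cos (INR k * (2 * PI - y)) = cos (INR k * y)).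
{ intros y; replace (INR k * (2 * PI - y)) with (- (INR k * y) + 2 * INR k * PI) by ring.
  rewrite cos_period; apply cos_neg. }
assert (Hs : forall y, sin (INR k * (2 * PI - y)) = - sin (INR k * y)).
{ intros y; replace (INR k * (2 * PI - y)) with (- (INR k * y) + 2 * INR k * PI) by ring.
  rewrite sin_period; apply sin_neg. }
assert (H1 : forall y, cos (2 * PI - y) = cos y).
{ intros y; rewrite cos_minus, cos_2PI, sin_2PI; ring. }
assert (HI : forall g : R -> R, (forall y, continuous (fun y => g (cos y)) y) ->
  RInt (fun y => 2 * (chebyshev k (cos y) * g (cos y))) 0 PI = 2 * cheb_integral k g).
{ intros g Hg.
  apply (RInt_scal (V := R_CompleteNormedModule) (fun y => chebyshev k (cos y) * g (cos y))).
  apply ex_RInt_continuous_all; intros; apply continuous_Rmult; [|apply Hg].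
  apply (continuous_comp_cos (chebyshev k)); intros; apply is_poly_continuous, is_poly_chebyshev. }
split.
- rewrite RInt_reflect.
  + rewrite <- HI by exact C1; apply RInt_ext; intros y _; rewrite !E; simpl fst.
    rewrite Hc, Hs, H1, chebyshev_cos; to_R; ring.
  + intros y; apply (continuous_ext (fun y =>
      plus (f1 (cos y) * cos (INR k * y)) (f2 (cos y) * sin (INR k * y)))).
    { intros; rewrite E; reflexivity. }
    apply (continuous_plus (V := R_NormedModule)); apply continuous_Rmult; auto.
- rewrite RInt_reflect.
  + rewrite <- HI by exact C2; apply RInt_ext; intros y _; rewrite !E; simpl snd.
    rewrite Hc, Hs, H1, chebyshev_cos; to_R; ring.
  + intros y; apply (continuous_ext (fun y =>
      minus (f2 (cos y) * cos (INR k * y)) (f1 (cos y) * sin (INR k * y)))).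
    { intros; rewrite E; reflexivity. }
    apply (continuous_minus (V := R_NormedModule)); apply continuous_Rmult; auto.
Qed.

Section Bound.
Variable M : R.
Hypothesis M_max : is_max_modulus (ellipse rho) f M.

Lemma max_modulus_ge0 : 0 <= M.
Proof. destruct M_max as [(z & _ & <-) _]; apply Cmod_ge_0. Qed.

(** Uniformity in [y], from compactness of [[0, 2 PI]], carries the bound [M] from the ellipse to
    nearby confocal ones, along which [f] is differentiable. *)
Lemma modulus_near_ellipse (eps : R) : 0 < eps -> exists del, 0 < del /\
  forall x y, ln rho - del <= x <= ln rho -> 0 <= x -> 0 <= y <= 2 * PI ->
    Cmod (f (ccosh (x, y))) <= M + eps.
Proof.
intros Heps; assert (Hln := ln_rho_gt0).
destruct (uniform_continuity_2d_1d' modulus_on_confocal 0 (2 * PI) (ln rho)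
  (fun y _ => continuity_2d_modulus (ln rho) y) (mkposreal eps Heps)) as [d Hd].
simpl in Hd; assert (Hd0 := cond_pos d).
exists d; split; [exact Hd0|]; intros x y Hx Hx0 Hy.
specialize (Hd y (ln rho) y x Hy ltac:(lra) Hy ltac:(lra)
  ltac:(rewrite Rminus_diag, Rabs_R0; lra)).
unfold modulus_on_confocal in Hd; rewrite !clamp_id in Hd by lra.
assert (Cmod (f (ccosh (ln rho, y))) <= M).
{ apply M_max, ellipse_ccosh; exists y; auto. }
apply Rabs_lt_between in Hd; lra.
Qed.

Lemma cderiv_continuous_section (g : C -> C) (x y : R) (L : C) : cderiv g (x, y) L ->
  continuous (fun v => fst (g (x, v))) y /\ continuous (fun v => snd (g (x, v))) y.
Proof.
intros H; assert (HC := cderiv_continuous _ _ _ H).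
split; apply filterlim_locally; intros [eps Heps]; destruct (HC eps Heps) as (d & Hd & Hb);
  exists (mkposreal d Hd); intros u Hu;
  (eapply Rle_lt_trans; [|apply (Hb (x, u));
    replace ((x, u) - (x, y))%C with (Ci * RtoC (u - y))%C
     by (unfold Ci, Cmult, Cminus, Cplus, Copp, RtoC; simpl; f_equal; ring);
    rewrite Cmod_mult, Cmod_R;
    replace (Cmod Ci) with 1 by (unfold Cmod, Ci; simpl;
      replace (0 * (0 * 1) + 1 * (1 * 1)) with 1 by ring; symmetry; apply sqrt_1);
    rewrite Rmult_1_l; exact Hu]).
- apply (Rabs_fst_le (g (x, u) - g (x, y))).
- apply (Rabs_snd_le (g (x, u) - g (x, y))).
Qed.

(** The integral moves from [Re w = 0] to [Re w = x]. The length [2 PI] of the segment is halved by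
    the factor 2 in [laurent_integral_0]. *)
Lemma cheb_integral_bound_level (k : nat) (x K : R) : 0 <= x < ln rho -> 0 <= K ->
  (forall y, 0 <= y <= 2 * PI -> Cmod (f (ccosh (x, y))) <= K) ->
  Cmod (cheb_integral k f1, cheb_integral k f2) <= PI * K * exp (- INR k * x).
Proof.
intros Hx HK H; assert (HPI := PI_RGT_0).
destruct (laurent_integral_0 k) as [I1 I2].
destruct (periodic_strip_integral (laurent_integrand k) 0 x (2 * PI)) as [P1 P2];
  [lra|lra|intros; apply laurent_integrand_cderiv; lra|apply laurent_integrand_periodic|].
assert (HB := Cmod_RInt_le (fun y => fst (laurent_integrand k (x, y)))
  (fun y => snd (laurent_integrand k (x, y))) 0 (2 * PI) (K * exp (- INR k * x))).
rewrite <- P1, <- P2, I1, I2 in HB.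
assert (E : Cmod (2 * cheb_integral k f1, 2 * cheb_integral k f2) =
  2 * Cmod (cheb_integral k f1, cheb_integral k f2)).
{ rewrite <- (Rabs_pos_eq 2) at 3 by lra; rewrite <- Cmod_R, <- Cmod_mult; f_equal.
  unfold Cmult, RtoC; simpl; f_equal; ring. }
rewrite E in HB.
assert (HC : forall y, continuous (fun y => fst (laurent_integrand k (x, y))) y /\
   continuous (fun y => snd (laurent_integrand k (x, y))) y).
{ intros y; destruct (laurent_integrand_cderiv k x y Hx) as [L HL].
  apply (cderiv_continuous_section _ _ _ L HL). }
assert (He := exp_pos (- INR k * x)).
apply Rmult_le_reg_l with 2; [lra|].
replace (2 * (PI * K * exp (- INR k * x))) with (K * exp (- INR k * x) * (2 * PI - 0)) by ring.
apply HB.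
{ lra. }
{ apply Rmult_le_pos; lra. }
{ intros y _; apply (HC y). }
{ intros y _; apply (HC y). }
intros y Hy; rewrite <- surjective_pairing, laurent_integrandE, !Cmod_mult, Cmod_R.
rewrite (Rabs_pos_eq (exp _)) by lra.
replace (Cmod (cos (INR k * y), - sin (INR k * y))) with 1.
- rewrite Rmult_1_r; apply Rmult_le_compat_r; [lra|apply H, Hy].
- unfold Cmod; simpl.
  replace (cos (INR k * y) * (cos (INR k * y) * 1) +
    - sin (INR k * y) * (- sin (INR k * y) * 1)) with 1; [symmetry; apply sqrt_1|].
  generalize (sin2_cos2 (INR k * y)); unfold Rsqr; lra.
Qed.

Lemma cheb_integral_bound (k : nat) :
  Cmod (cheb_integral k f1, cheb_integral k f2) <= PI * M * / rho ^ k.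
Proof.
assert (HPI := PI_RGT_0); assert (Hln := ln_rho_gt0); assert (HM := max_modulus_ge0).
assert (Hr : / rho ^ k = exp (- INR k * ln rho)).
{ rewrite <- (exp_ln rho) at 1 by lra.
  replace (- INR k * ln rho) with (- (INR k * ln rho)) by ring.
  rewrite exp_Ropp; f_equal.
  clear; induction k as [|k IH]; [simpl; rewrite Rmult_0_l, exp_0; reflexivity|].
  rewrite <- tech_pow_Rmult, IH, <- exp_plus, S_INR; f_equal; ring. }
set (z := Cmod _); apply Rnot_lt_le; intros N.
set (gap := z - PI * M * / rho ^ k).
assert (Hcont : continuous (fun t => PI * (M + t) * exp (- INR k * (ln rho - t))) 0).
{ apply (ex_derive_continuous (K := R_AbsRing) (V := R_NormedModule)).
  auto_derive; exact I. }
destruct (proj1 (filterlim_locally _ _) Hcont (mkposreal gap ltac:(unfold gap; lra)))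
  as [d Hd].
assert (Hd0 := cond_pos d).
set (t := Rmin (d / 2) (ln rho)).
assert (Ht : 0 < t <= d / 2 /\ t <= ln rho).
{ unfold t; split; [split; [apply Rmin_glb_lt; lra|apply Rmin_l]|apply Rmin_r]. }
specialize (Hd t); destruct (modulus_near_ellipse t) as (d' & Hd' & HN); [lra|].
(* The line is taken at [ln rho - t']: close enough to [ln rho] for the bound [M + t], and [t' <= t]
   keeps the exponential below its value at [ln rho - t]. *)
set (t' := Rmin d' t).
assert (Ht' : 0 < t' <= d' /\ t' <= t).
{ unfold t'; split; [split; [apply Rmin_glb_lt; lra|apply Rmin_l]|apply Rmin_r]. }
assert (HL := cheb_integral_bound_level k (ln rho - t') (M + t) ltac:(lra) ltac:(lra)
  ltac:(intros; apply HN; lra)).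
fold z in HL.
assert (Hb : ball 0 d t).
{ change (Rabs (t - 0) < d); rewrite Rminus_0_r, Rabs_pos_eq; lra. }
specialize (Hd Hb).
change (Rabs (PI * (M + t) * exp (- INR k * (ln rho - t)) -
  PI * (M + 0) * exp (- INR k * (ln rho - 0))) < gap) in Hd.
rewrite Rplus_0_r, Rminus_0_r, <- Hr in Hd.
apply Rabs_lt_between in Hd; unfold gap in Hd.
assert (exp (- INR k * (ln rho - t')) <= exp (- INR k * (ln rho - t))).
{ assert (0 <= INR k) by apply pos_INR.
  destruct (Rle_lt_or_eq_dec (- INR k * (ln rho - t')) (- INR k * (ln rho - t))) as [H'|H'].
  - nra.
  - left; apply exp_increasing, H'.
  - right; f_equal; exact H'. }
assert (PI * (M + t) * exp (- INR k * (ln rho - t')) <=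
  PI * (M + t) * exp (- INR k * (ln rho - t))).
{ apply Rmult_le_compat_l; [apply Rmult_le_pos; lra|assumption]. }
lra.
Qed.

Lemma cheb_coef_bound (k : nat) :
  Cmod (cheb_coef f1 k, cheb_coef f2 k) <= 2 * M * / rho ^ k.
Proof.
assert (HPI := PI_RGT_0); assert (HB := cheb_integral_bound k).
set (c := (if Nat.eqb k 0 then 1 else 2) / PI).
assert (Hc : 0 <= c <= 2 / PI).
{ unfold c; destruct (Nat.eqb k 0); (split; [apply Rle_mult_inv_pos; lra|]);
    [|lra]; apply Rmult_le_compat_r; [left; apply Rinv_0_lt_compat; lra|lra]. }
replace (cheb_coef f1 k, cheb_coef f2 k) with
  (Cmult (RtoC c) (cheb_integral k f1, cheb_integral k f2)).
2:{ unfold cheb_coef; fold c; unfold Cmult, RtoC; simpl; f_equal; ring. }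
rewrite Cmod_mult, Cmod_R, Rabs_pos_eq by apply Hc.
apply Rle_trans with (2 / PI * (PI * M * / rho ^ k)).
- apply Rmult_le_compat; try apply Hc; [apply Cmod_ge_0|exact HB].
- right; field; split; [apply pow_nonzero; lra|lra].
Qed.

End Bound.
End Function.
End Ellipse.

(** * The error bound *)

(* [C_derive] only takes the limit along the real direction. *)
Lemma C_derive_real (h : C -> C) (h1 h2 : R -> R) (d1 d2 t : R) :
  locally t (fun y => h (RtoC y) = (h1 y, h2 y)) ->
  is_derive h1 t d1 -> is_derive h2 t d2 -> C_derive h (RtoC t) = (d1, d2).
Proof.
intros Hh D1 D2.
assert (Ht : h (RtoC t) = (h1 t, h2 t)) by apply (locally_singleton _ _ Hh).
assert (HQ : locally' t (fun y =>
  ((h (y, 0%R) - h (RtoC t)) / ((y, 0%R) - RtoC t))%C =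
  ((h1 y - h1 t) / (y - t), (h2 y - h2 t) / (y - t)))).
{ destruct Hh as [e He]; exists e; intros y Hy Hne.
  change (y, 0) with (RtoC y); rewrite (He y Hy), Ht, <- RtoC_minus.
  assert (y - t <> 0) by lra.
  unfold Cdiv; rewrite <- RtoC_inv by assumption.
  unfold Cmult, Cminus, Cplus, Copp, RtoC; simpl; f_equal; field; assumption. }
assert (HL : forall g d, is_derive g t d ->
  is_lim (fun y => (g y - g t) / (y - t)) t d).
{ intros g d Hg; apply is_derive_Reals in Hg; apply is_lim_spec; intros eps.
  destruct (Hg eps (cond_pos eps)) as [del Hdel]; exists del; intros y Hy Hne.
  specialize (Hdel (y - t) ltac:(lra) Hy).
  rewrite Rplus_minus in Hdel; exact Hdel. }
unfold C_derive, C_lim; simpl fst; simpl snd; f_equal.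
- rewrite (is_lim_unique _ t d1); [reflexivity|].
  apply is_lim_ext_loc with (2 := HL h1 d1 D1).
  generalize HQ; apply filter_imp; intros y E; symmetry; exact (f_equal fst E).
- rewrite (is_lim_unique _ t d2); [reflexivity|].
  apply is_lim_ext_loc with (2 := HL h2 d2 D2).
  generalize HQ; apply filter_imp; intros y E; symmetry; exact (f_equal snd E).
Qed.

(** The identity is carried on the whole open interval because the next derivative looks at a
    neighbourhood of the point. *)
Lemma iter_C_derive_real (f : C -> C) :
  let f1 := fun t => fst (f (RtoC t)) in let f2 := fun t => snd (f (RtoC t)) in
  (forall i t, -1 < t < 1 -> is_derive (Derive_n f1 i) t (Derive_n f1 (S i) t)) ->
  (forall i t, -1 < t < 1 -> is_derive (Derive_n f2 i) t (Derive_n f2 (S i) t)) ->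
  forall i t, -1 < t < 1 ->
  Nat.iter i C_derive f (RtoC t) = (Derive_n f1 i t, Derive_n f2 i t).
Proof.
intros f1 f2 H1 H2 i; induction i as [|i IH]; intros t Ht.
- apply surjective_pairing.
- rewrite Nat.iter_succ.
  apply (C_derive_real _ (Derive_n f1 i) (Derive_n f2 i)); [|apply H1, Ht|apply H2, Ht].
  generalize (locally_open_interval (-1) 1 t Ht); apply filter_imp; exact IH.
Qed.

Lemma sum_n_m_pair (u v : nat -> R) (m N : nat) :
  sum_n_m (G := C_AbelianMonoid) (fun k => (u k, v k)) m N =
  (sum_n_m u m N, sum_n_m v m N).
Proof.
induction N as [|N IH].
- destruct m as [|m]; [rewrite !sum_n_n|rewrite !sum_n_m_zero by lia]; reflexivity.
- destruct (Nat.le_gt_cases m (S N)) as [Hm|Hm].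
  + rewrite !sum_n_Sm, IH by lia; reflexivity.
  + rewrite !sum_n_m_zero by lia; reflexivity.
Qed.

Lemma Cmod_lim_le (u v : nat -> R) (a b K : R) : 0 <= K ->
  is_lim_seq u a -> is_lim_seq v b ->
  (forall J, Cmod (u J, v J) <= K) -> Cmod (a, b) <= K.
Proof.
intros HK Hu Hv H.
assert (HL : is_lim_seq (fun J => u J * u J + v J * v J) (a * a + b * b)).
{ apply is_lim_seq_plus'; apply is_lim_seq_mult'; assumption. }
assert (Hsq : forall x y, Cmod (x, y) ^ 2 = x * x + y * y).
{ intros x y; unfold Cmod; rewrite pow2_sqrt; simpl; [ring|nra]. }
assert (HC : a * a + b * b <= K ^ 2).
{ apply (is_lim_seq_le (fun J => u J * u J + v J * v J) (fun _ => K ^ 2)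
    (a * a + b * b) (K ^ 2)); [|exact HL|apply is_lim_seq_const].
  intros J; rewrite <- Hsq; apply pow_incr; split; [apply Cmod_ge_0|apply H]. }
rewrite <- Hsq in HC; apply Rsqr_incr_0_var; [|exact HK].
unfold Rsqr; simpl in HC; lra.
Qed.

Lemma Cmod_sum_le (u v g : nat -> R) (N : nat) :
  (forall k, Cmod (u k, v k) <= g k) -> Cmod (sum_n u N, sum_n v N) <= sum_n g N.
Proof.
intros H; induction N as [|N IH]; [rewrite !sum_O; apply H|].
rewrite !sum_Sn; to_R.
change (sum_n u N + u (S N), sum_n v N + v (S N)) with
  (Cplus (sum_n u N, sum_n v N) (u (S N), v (S N))).
eapply Rle_trans; [apply Cmod_triangle|]; apply Rplus_le_compat; auto.
Qed.

(* Numerator and denominator are rescaled by powers of [y = rho^(-2n)]. *)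
Lemma bound_rescale (n s : nat) (rho : R) : (1 <= n)%nat -> 1 < rho ->
  let x := / rho in let y := x ^ (2 * n) in
  sum_n (fun k => (-1) ^ k * Binomial.C (2 * s + 1) (s - k)
                   * rho ^ (2 * n * (s - k))) s
    / (rho ^ n * (rho ^ (2 * n) - 1) ^ (2 * s)) =
  x ^ ((2 * s + 1) * n) *
  (sum_n (fun k => (-1) ^ k * Binomial.C (2 * s + 1) (s - k) * y ^ k) s
    / (1 - y) ^ (2 * s)).
Proof.
intros Hn Hrho x y.
assert (Hx : 0 < x < 1).
{ unfold x; split; [apply Rinv_0_lt_compat; lra|].
  rewrite <- Rinv_1; apply Rinv_lt_contravar; lra. }
assert (Hy : 0 < y < 1).
{ unfold y; split; [apply pow_lt; lra|].
  apply pow_lt_1_compat; [lra|lia]. }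
set (r := rho ^ (2 * n)).
assert (Hyr : r * y = 1).
{ unfold y, x, r; rewrite pow_inv; apply Rinv_r, pow_nonzero; lra. }
assert (Er : r = / y) by (apply Rmult_eq_reg_r with y; [rewrite Hyr, Rinv_l|]; lra).
set (S := sum_n (fun k => (-1) ^ k * Binomial.C (2 * s + 1) (s - k) * y ^ k) s).
replace (sum_n (fun k => (-1) ^ k * Binomial.C (2 * s + 1) (s - k)
  * rho ^ (2 * n * (s - k))) s) with (r ^ s * S).
- replace ((2 * s + 1) * n)%nat with (2 * n * s + n)%nat by lia.
  rewrite pow_add, (pow_mult x (2 * n) s); fold y.
  replace (r - 1) with (r * (1 - y)) by (rewrite Rmult_minus_distr_l, Hyr; ring).
  rewrite Rpow_mult_distr.
  replace (rho ^ n) with (/ x ^ n) by (unfold x; rewrite pow_inv, Rinv_inv; reflexivity).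
  rewrite Er, !pow_inv.
  replace (2 * s)%nat with (s + s)%nat by lia; rewrite !pow_add.
  assert (y ^ s <> 0) by (apply pow_nonzero; lra).
  assert (x ^ n <> 0) by (apply pow_nonzero; lra).
  assert ((1 - y) ^ s <> 0) by (apply pow_nonzero; lra).
  field; auto.
- unfold S; rewrite <- (sum_n_mult_l (K := R_Ring)).
  apply sum_n_ext_loc; intros k Hk; to_R.
  rewrite (pow_mult rho (2 * n)); fold r.
  replace (r ^ s) with (r ^ (s - k) * r ^ k) by (rewrite <- pow_add; f_equal; lia).
  assert (E : r ^ k * y ^ k = 1) by (rewrite <- Rpow_mult_distr, Hyr, pow1; reflexivity).
  transitivity ((-1) ^ k * Binomial.C (2 * s + 1) (s - k) * r ^ (s - k) * (r ^ k * y ^ k));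
    [ring|rewrite E; ring].
Qed.

Theorem theorem3 :
  forall (n s : nat) (rho : R) (xi : nat -> R) (l : nat -> nat -> R -> R)
    (f : C -> C),
  (1 <= n)%nat -> (1 <= s)%nat -> 1 < rho ->
  chebyshev_zeros n xi ->
  hermite_fundamental n s xi l ->
  analytic_on (ellipse_interior rho) f ->
  continuous_on (closure (ellipse_interior rho)) f ->
  exists M : R,
    is_max_modulus (ellipse rho) f M /\
    Cmod (remainder n s xi l f) <=
      2 * PI * M *
      (sum_n (fun k => (-1) ^ k * Binomial.C (2 * s + 1) (s - k)
                       * rho ^ (2 * n * (s - k))) s
       / (rho ^ n * (rho ^ (2 * n) - 1) ^ (2 * s))).
Proof.
intros n s rho xi l f Hn Hs Hrho Hz Hl Ha Hc.
destruct (max_modulus_exists rho Hrho f Hc) as [M HM].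
exists M; split; [exact HM|].
assert (HPI := PI_RGT_0); assert (HM0 : 0 <= M) by apply (max_modulus_ge0 rho f M HM).
set (f1 := fun t => fst (f (RtoC t))); set (f2 := fun t => snd (f (RtoC t))).
assert (HB := cheb_coef_bound rho Hrho f Ha Hc M HM); fold f1 f2 in HB.
rewrite bound_rescale by assumption; cbv zeta.
set (x := / rho).
assert (Hx : 0 < x < 1).
{ unfold x; split; [apply Rinv_0_lt_compat; lra|].
  rewrite <- Rinv_1; apply Rinv_lt_contravar; lra. }
assert (Hinv : forall k, / rho ^ k = x ^ k) by (intros; symmetry; apply pow_inv).
assert (C1 : forall t, -1 <= t <= 1 -> continuous f1 t)
  by (intros t Ht; apply (continuous_components rho Hrho f Ha t Ht)).
assert (C2 : forall t, -1 <= t <= 1 -> continuous f2 t)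
  by (intros t Ht; apply (continuous_components rho Hrho f Ha t Ht)).
assert (B1 : forall k, Rabs (cheb_coef f1 k) <= 2 * M * x ^ k).
{ intros k; rewrite <- Hinv; eapply Rle_trans; [|apply HB].
  apply (Rabs_fst_le (cheb_coef f1 k, cheb_coef f2 k)). }
assert (B2 : forall k, Rabs (cheb_coef f2 k) <= 2 * M * x ^ k).
{ intros k; rewrite <- Hinv; eapply Rle_trans; [|apply HB].
  apply (Rabs_snd_le (cheb_coef f1 k, cheb_coef f2 k)). }
assert (ER : remainder n s xi l f =
  (real_remainder n s xi l f1, real_remainder n s xi l f2)).
{ unfold remainder, real_remainder.
  rewrite fourier_chebyshevE by assumption; fold f1 f2.
  transitivity (Cminus (cheb_integral n f1, cheb_integral n f2)
    (sum_n_m (fun nu => sum_n_m (fun i =>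
       cheb_integral n (l i nu) * Derive_n f1 i (xi nu)) 0 (2 * s - 1)) 1 n,
     sum_n_m (fun nu => sum_n_m (fun i =>
       cheb_integral n (l i nu) * Derive_n f2 i (xi nu)) 0 (2 * s - 1)) 1 n));
    [apply (f_equal (Cminus _))|reflexivity].
  rewrite <- sum_n_m_pair.
  apply (sum_n_m_ext_loc (G := C_AbelianMonoid)); intros nu Hnu.
  rewrite <- sum_n_m_pair.
  apply (sum_n_m_ext_loc (G := C_AbelianMonoid)); intros i Hi.
  rewrite quadrature_weightE by (eexists; apply Hl; lia).
  rewrite (iter_C_derive_real f); fold f1 f2.
  + unfold Cmult, RtoC; simpl; f_equal; ring.
  + intros j t Ht; apply (cheb_expansion_Derive_n f1 (2 * M) x C1 Hx B1 j t Ht).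
  + intros j t Ht; apply (cheb_expansion_Derive_n f2 (2 * M) x C2 Hx B2 j t Ht).
  + apply Hz, Hnu. }
rewrite ER.
set (y := x ^ (2 * n)).
assert (Hy : 0 < y < 1).
{ unfold y; split; [apply pow_lt; lra|].
  apply pow_lt_1_compat; [lra|lia]. }
set (S := sum_n (fun k => (-1) ^ k * Binomial.C (2 * s + 1) (s - k) * y ^ k) s).
(* The terms of [S] alternate in sign; nonnegativity of the quotient is read off from
   [alt_coef_sum_le] with the single term [J = 0]. *)
assert (HS : 0 <= S / (1 - y) ^ (2 * s)).
{ eapply Rle_trans; [|apply (alt_coef_sum_le s 0 y Hs); lra].
  rewrite sum_O; apply Rmult_le_pos; [apply Rabs_pos|apply pow_le; lra]. }
assert (HK : 0 <= x ^ ((2 * s + 1) * n)) by (apply pow_le; lra).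
assert (HPM : 0 <= PI * M * x ^ ((2 * s + 1) * n))
  by (apply Rmult_le_pos; [apply Rmult_le_pos; lra|exact HK]).
apply Rle_trans with (PI * M * x ^ ((2 * s + 1) * n) * (S / (1 - y) ^ (2 * s))).
2:{ assert (0 <= PI * M * x ^ ((2 * s + 1) * n) * (S / (1 - y) ^ (2 * s)))
      by (apply Rmult_le_pos; assumption).
    lra. }
apply (Cmod_lim_le _ _ _ _ _ (Rmult_le_pos _ _ HPM HS)
  (real_remainder_limit f1 (2 * M) x C1 Hx B1 n s xi l Hn Hs Hz Hl)
  (real_remainder_limit f2 (2 * M) x C2 Hx B2 n s xi l Hn Hs Hz Hl)).
intros J; eapply Rle_trans.
{ apply Cmod_sum_le with (g := fun j => PI * M * x ^ ((2 * s + 1) * n) *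
    (Rabs (alt_coef s j) * y ^ j)).
  intros j; set (k := ((2 * s + 1) * n + 2 * n * j)%nat).
  (* Both coefficients are kept in one complex number, so that [HB] bounds its modulus by
     [2 * M * x ^ k]; with [PI / 2] this makes [PI * M]. *)
  replace (PI / 2 * (cheb_coef f1 k * alt_coef s j), PI / 2 * (cheb_coef f2 k * alt_coef s j))
    with (Cmult (RtoC (PI / 2 * alt_coef s j)) (cheb_coef f1 k, cheb_coef f2 k)).
  2:{ unfold Cmult, RtoC; simpl; f_equal; ring. }
  rewrite Cmod_mult, Cmod_R, Rabs_mult, (Rabs_pos_eq (PI / 2)) by lra.
  apply Rle_trans with (PI / 2 * Rabs (alt_coef s j) * (2 * M * x ^ k)).
  - apply Rmult_le_compat_l; [apply Rmult_le_pos; [lra|apply Rabs_pos]|].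
    rewrite <- Hinv; apply HB.
  - right; unfold k, y; rewrite pow_add, (pow_mult x (2 * n) j); field. }
rewrite (sum_n_ext _ (fun j => mult (PI * M * x ^ ((2 * s + 1) * n))
  (Rabs (alt_coef s j) * y ^ j))) by reflexivity.
rewrite (sum_n_mult_l (K := R_Ring)); to_R.
apply Rmult_le_compat_l; [exact HPM|apply alt_coef_sum_le; [exact Hs|lra]].
Qed.
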